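(* Assume $\mathrm{char}(k)=2$. Let $(P,Q)\in X_2(\mathcal{O}_K)$ be a non-singular generalised binary quartic with $v(P,Q)\in\{0,1\}$ and positive level. Then: (i) the reduction mod $\pi$ of $Q_1(x,z)=P(x,z)$ if $v(P)=0$; $Q_1=\partial^2Q/\partial x\partial z$ if $v(P)\geq1$ and $v(P,Q)=0$; $Q_1=\pi^{-1}Q(x,z)$ if $v(P)\geq1$ and $v(Q)=1$, has a unique repeated root, and it is defined over $k$; (ii) the following procedure replaces $(P,Q)$ by a $K$-equivalent integral model of the same level: if $v(P,Q)=1$, make a $y$-substitution so that $v(Q)\geq1$; move the repeated root of $Q_1$ mod $\pi$ to $(x:z)=(0:1)$ by a substitution with matrix in $GL_2(\mathcal{O}_K)$; make a $y$-substitution so that $\pi\mid e$; then replace $P(x,z)$ by $\pi^{-1}P(\pi x,z)$ and $Q(x,z)$ by $\pi^{-2}Q(\pi x,z)$; (iii) if $(P,Q)$ is non-minimal, then at most $2$ iterations of the procedure in (ii) produce a model with $v(P,Q)\geq2$.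
   Context: $K$ is a field with normalised discrete valuation $v$, valuation ring $\mathcal{O}_K$, uniformiser $\pi$, perfect residue field $k$. $X_2(R)$: pairs $(P,Q)$ of binary forms in $x,z$ over $R$, $P=lx^2+mxz+nz^2$, $Q=ax^4+bx^3z+cx^2z^2+dxz^3+ez^4$, representing $y^2+P(x,z)y=Q(x,z)$. $R$-equivalence: substitutions $x\leftarrow m_{11}x+m_{21}z$, $z\leftarrow m_{12}x+m_{22}z$, $y\leftarrow\mu^{-1}y+r_0x^2+r_1xz+r_2z^2$ (then rescale to make the $y^2$-coefficient $1$), with $\mu\in R^\times$, $r_i\in R$, $(m_{ij})\in GL_2(R)$. A $y$-substitution is one with $M=I_2$, $\mu=1$: $y\leftarrow y+r_0x^2+r_1xz+r_2z^2$ ($r_i\in\mathcal{O}_K$); models related by one are $y$-equivalent. For a form $G$, $v(G)$ is the minimum valuation of its coefficients; $v(P,Q)=\max\{\min(2v(P'),v(Q')):(P',Q')\ y\text{-equivalent to }(P,Q)\}$. Invariants: for $G=\tfrac14P^2+Q=\alpha x^4+\beta x^3z+\gamma x^2z^2+\delta xz^3+\epsilon z^4$, $I=12\alpha\epsilon-3\beta\delta+\gamma^2$, $J=72\alpha\gamma\epsilon-27\alpha\delta^2-27\beta^2\epsilon+9\beta\gamma\delta-2\gamma^3$, $c_4=2^4I$, $c_6=2^5J$, $\Delta(P,Q)=(c_4^3-c_6^2)/1728$ (an integer polynomial in $l,m,n,a,\dots,e$). Non-singular: $\Delta\ne0$; then $y^2+Py=Q$ is a smooth genus one curve with Jacobian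 $E$ of minimal discriminant $\Delta_E$, and $v(\Delta(P,Q))=v(\Delta_E)+12\ell$, $\ell\in\mathbb{Z}$ the level. Integral: coefficients in $\mathcal{O}_K$. An integral model is minimal if $v(\Delta)$ is minimal among integral models $K$-equivalent to it, non-minimal otherwise. *)

(* Defs.v *)
From HB Require Import structures.
From mathcomp Require Import all_boot all_order all_algebra.
From mathcomp Require Import ring.
Set Implicit Arguments.
Unset Strict Implicit.
Unset Printing Implicit Defensive.
Import Order.TTheory GRing.Theory Num.Theory.
Local Open Scope ring_scope.

(* [dv x] is the valuation of a NONZERO x; the value at 0 is irrelevant     *)
(* (v(0) = +oo is encoded by the predicate [vge] below).                    *)
Record dvaluation (K : fieldType) := DVal {
  dv : K -> int;
  dv_mul : forall x y : K, x != 0 -> y != 0 -> dv (x * y) = dv x + dv y;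
  dv_add : forall x y : K, x != 0 -> y != 0 -> x + y != 0 ->
             (dv x <= dv (x + y)) \/ (dv y <= dv (x + y));
  dv_normalised : exists p : K, p != 0 /\ dv p = 1
}.

Section Valuation.
Variables (K : fieldType) (v : dvaluation K).

Definition vge (x : K) (k : int) : Prop := x = 0 \/ k <= dv v x.
Definition vge2 (x : K) (k : int) : Prop := x = 0 \/ k <= 2 * dv v x.
Definition inO (x : K) : Prop := vge x 0.

Definition residue_char2 : Prop := vge 2%:R 1.

Definition residue_perfect : Prop :=
  forall p : nat, prime p -> vge p%:R 1 ->
  forall x : K, inO x -> exists y : K, inO y /\ vge (x - y ^+ p) 1.

(* rho : K -> L restricted to O_K is a ring morphism with kernel pi O_K,
   i.e. it induces an embedding of the residue field k into L *)
Definition residue_embedding (L : fieldType) (rho : K -> L) : Prop :=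
  (forall x y : K, inO x -> inO y ->
     rho (x + y) = rho x + rho y /\ rho (x * y) = rho x * rho y) /\
  rho 1 = 1 /\
  (forall x : K, inO x -> (rho x = 0 <-> vge x 1)).

(* Binary forms.  A binary form of degree d,  F(x,z) = sum_i F_i x^i z^(d-i), *)
(* is represented by the polynomial  sum_i F_i 'X^i  (of size <= d+1);      *)
(* products of forms correspond to products of polynomials.                 *)

Definition form_vge (F : {poly K}) (k : int) : Prop := forall i, vge F`_i k.

End Valuation.

(* F(m11 x + m21 z, m12 x + m22 z) for a form F of degree d, with
   M = (m_ij) and M i j = m_(i+1)(j+1) *)
Definition form_subst (R : comNzRingType) (d : nat) (F : {poly R}) (M : 'M[R]_2)
  : {poly R} :=
  \sum_(i < d.+1) F`_i *: ((M 0 0 *: 'X + (M 1 0)%:P) ^+ i *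
                            (M 0 1 *: 'X + (M 1 1)%:P) ^+ (d - i)).

(* Generalised binary quartics (P,Q):  y^2 + P(x,z) y = Q(x,z),             *)
(* P = l x^2 + m xz + n z^2,  Q = a x^4 + b x^3 z + c x^2 z^2 + d x z^3 + e z^4 *)
Definition model (R : comNzRingType) := ({poly R} * {poly R})%type.

Section Coeffs.
Variable (R : comNzRingType).
Implicit Type PQ : model R.
Definition cl PQ := PQ.1`_2.
Definition cm PQ := PQ.1`_1.
Definition cn PQ := PQ.1`_0.
Definition ca PQ := PQ.2`_4.
Definition cb PQ := PQ.2`_3.
Definition cc PQ := PQ.2`_2.
Definition cd PQ := PQ.2`_1.
Definition ce PQ := PQ.2`_0.

Definition wf_model PQ : Prop := (size PQ.1 <= 3)%N /\ (size PQ.2 <= 5)%N.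

(* The discriminant Delta(P,Q) = (c4^3 - c6^2)/1728, as the integer
   polynomial in l,m,n,a,b,c,d,e (see lemma [disc_c4c6] below). *)
Definition disc_poly (l m n a b c d e : R) : R :=
    0
  + 16%:R * l ^+ 6 * n ^+ 2 * e ^+ 2
  + 64%:R * l ^+ 6 * e ^+ 3
  - 8%:R * l ^+ 5 * m ^+ 2 * n * e ^+ 2
  - 16%:R * l ^+ 5 * m * n ^+ 2 * d * e
  - 96%:R * l ^+ 5 * m * d * e ^+ 2
  - 32%:R * l ^+ 5 * n ^+ 3 * c * e
  + 16%:R * l ^+ 5 * n ^+ 3 * d ^+ 2
  - 128%:R * l ^+ 5 * n * c * e ^+ 2
  + 72%:R * l ^+ 5 * n * d ^+ 2 * e
  + 1%:R * l ^+ 4 * m ^+ 4 * e ^+ 2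
  + 8%:R * l ^+ 4 * m ^+ 3 * n * d * e
  + 32%:R * l ^+ 4 * m ^+ 2 * n ^+ 2 * c * e
  - 8%:R * l ^+ 4 * m ^+ 2 * n ^+ 2 * d ^+ 2
  + 80%:R * l ^+ 4 * m ^+ 2 * c * e ^+ 2
  + 30%:R * l ^+ 4 * m ^+ 2 * d ^+ 2 * e
  + 48%:R * l ^+ 4 * m * n ^+ 3 * b * e
  - 16%:R * l ^+ 4 * m * n ^+ 3 * c * d
  + 192%:R * l ^+ 4 * m * n * b * e ^+ 2
  - 16%:R * l ^+ 4 * m * n * c * d * e
  - 36%:R * l ^+ 4 * m * n * d ^+ 3
  + 32%:R * l ^+ 4 * n ^+ 4 * a * e
  - 32%:R * l ^+ 4 * n ^+ 4 * b * d
  + 16%:R * l ^+ 4 * n ^+ 4 * c ^+ 2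
  + 320%:R * l ^+ 4 * n ^+ 2 * a * e ^+ 2
  - 176%:R * l ^+ 4 * n ^+ 2 * b * d * e
  + 32%:R * l ^+ 4 * n ^+ 2 * c ^+ 2 * e
  + 24%:R * l ^+ 4 * n ^+ 2 * c * d ^+ 2
  + 768%:R * l ^+ 4 * a * e ^+ 3
  - 192%:R * l ^+ 4 * b * d * e ^+ 2
  - 128%:R * l ^+ 4 * c ^+ 2 * e ^+ 2
  + 144%:R * l ^+ 4 * c * d ^+ 2 * e
  - 27%:R * l ^+ 4 * d ^+ 4
  - 1%:R * l ^+ 3 * m ^+ 5 * d * e
  - 10%:R * l ^+ 3 * m ^+ 4 * n * c * e
  + 1%:R * l ^+ 3 * m ^+ 4 * n * d ^+ 2
  - 40%:R * l ^+ 3 * m ^+ 3 * n ^+ 2 * b * e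
  + 8%:R * l ^+ 3 * m ^+ 3 * n ^+ 2 * c * d
  - 72%:R * l ^+ 3 * m ^+ 3 * b * e ^+ 2
  - 44%:R * l ^+ 3 * m ^+ 3 * c * d * e
  + 1%:R * l ^+ 3 * m ^+ 3 * d ^+ 3
  - 80%:R * l ^+ 3 * m ^+ 2 * n ^+ 3 * a * e
  + 32%:R * l ^+ 3 * m ^+ 2 * n ^+ 3 * b * d
  - 8%:R * l ^+ 3 * m ^+ 2 * n ^+ 3 * c ^+ 2
  - 352%:R * l ^+ 3 * m ^+ 2 * n * a * e ^+ 2
  + 4%:R * l ^+ 3 * m ^+ 2 * n * b * d * e
  - 8%:R * l ^+ 3 * m ^+ 2 * n * c ^+ 2 * e
  + 46%:R * l ^+ 3 * m ^+ 2 * n * c * d ^+ 2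
  + 48%:R * l ^+ 3 * m * n ^+ 4 * a * d
  - 16%:R * l ^+ 3 * m * n ^+ 4 * b * c
  + 32%:R * l ^+ 3 * m * n ^+ 2 * a * d * e
  + 80%:R * l ^+ 3 * m * n ^+ 2 * b * c * e
  + 52%:R * l ^+ 3 * m * n ^+ 2 * b * d ^+ 2
  - 64%:R * l ^+ 3 * m * n ^+ 2 * c ^+ 2 * d
  - 768%:R * l ^+ 3 * m * a * d * e ^+ 2
  + 576%:R * l ^+ 3 * m * b * c * e ^+ 2
  - 24%:R * l ^+ 3 * m * b * d ^+ 2 * e
  - 160%:R * l ^+ 3 * m * c ^+ 2 * d * e
  + 36%:R * l ^+ 3 * m * c * d ^+ 3
  - 32%:R * l ^+ 3 * n ^+ 5 * a * c
  + 16%:R * l ^+ 3 * n ^+ 5 * b ^+ 2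
  - 384%:R * l ^+ 3 * n ^+ 3 * a * c * e
  + 136%:R * l ^+ 3 * n ^+ 3 * a * d ^+ 2
  + 136%:R * l ^+ 3 * n ^+ 3 * b ^+ 2 * e
  - 80%:R * l ^+ 3 * n ^+ 3 * b * c * d
  + 32%:R * l ^+ 3 * n ^+ 3 * c ^+ 3
  - 1024%:R * l ^+ 3 * n * a * c * e ^+ 2
  + 576%:R * l ^+ 3 * n * a * d ^+ 2 * e
  + 288%:R * l ^+ 3 * n * b ^+ 2 * e ^+ 2
  - 320%:R * l ^+ 3 * n * b * c * d * e
  + 36%:R * l ^+ 3 * n * b * d ^+ 3
  + 128%:R * l ^+ 3 * n * c ^+ 3 * e
  - 24%:R * l ^+ 3 * n * c ^+ 2 * d ^+ 2
  + 1%:R * l ^+ 2 * m ^+ 6 * c * e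
  + 11%:R * l ^+ 2 * m ^+ 5 * n * b * e
  - 1%:R * l ^+ 2 * m ^+ 5 * n * c * d
  + 50%:R * l ^+ 2 * m ^+ 4 * n ^+ 2 * a * e
  - 10%:R * l ^+ 2 * m ^+ 4 * n ^+ 2 * b * d
  + 1%:R * l ^+ 2 * m ^+ 4 * n ^+ 2 * c ^+ 2
  + 80%:R * l ^+ 2 * m ^+ 4 * a * e ^+ 2
  + 34%:R * l ^+ 2 * m ^+ 4 * b * d * e
  + 12%:R * l ^+ 2 * m ^+ 4 * c ^+ 2 * e
  - 1%:R * l ^+ 2 * m ^+ 4 * c * d ^+ 2
  - 40%:R * l ^+ 2 * m ^+ 3 * n ^+ 3 * a * d
  + 8%:R * l ^+ 2 * m ^+ 3 * n ^+ 3 * b * c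
  + 104%:R * l ^+ 2 * m ^+ 3 * n * a * d * e
  - 20%:R * l ^+ 2 * m ^+ 3 * n * b * c * e
  - 41%:R * l ^+ 2 * m ^+ 3 * n * b * d ^+ 2
  - 8%:R * l ^+ 2 * m ^+ 3 * n * c ^+ 2 * d
  + 32%:R * l ^+ 2 * m ^+ 2 * n ^+ 4 * a * c
  - 8%:R * l ^+ 2 * m ^+ 2 * n ^+ 4 * b ^+ 2
  + 192%:R * l ^+ 2 * m ^+ 2 * n ^+ 2 * a * c * e
  - 162%:R * l ^+ 2 * m ^+ 2 * n ^+ 2 * a * d ^+ 2
  - 162%:R * l ^+ 2 * m ^+ 2 * n ^+ 2 * b ^+ 2 * e
  + 84%:R * l ^+ 2 * m ^+ 2 * n ^+ 2 * b * c * d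
  + 8%:R * l ^+ 2 * m ^+ 2 * n ^+ 2 * c ^+ 3
  + 64%:R * l ^+ 2 * m ^+ 2 * a * c * e ^+ 2
  + 264%:R * l ^+ 2 * m ^+ 2 * a * d ^+ 2 * e
  - 504%:R * l ^+ 2 * m ^+ 2 * b ^+ 2 * e ^+ 2
  + 56%:R * l ^+ 2 * m ^+ 2 * b * c * d * e
  - 30%:R * l ^+ 2 * m ^+ 2 * b * d ^+ 3
  + 48%:R * l ^+ 2 * m ^+ 2 * c ^+ 3 * e
  - 8%:R * l ^+ 2 * m ^+ 2 * c ^+ 2 * d ^+ 2
  - 16%:R * l ^+ 2 * m * n ^+ 5 * a * b
  + 32%:R * l ^+ 2 * m * n ^+ 3 * a * b * e
  + 80%:R * l ^+ 2 * m * n ^+ 3 * a * c * d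
  + 52%:R * l ^+ 2 * m * n ^+ 3 * b ^+ 2 * d
  - 64%:R * l ^+ 2 * m * n ^+ 3 * b * c ^+ 2
  + 384%:R * l ^+ 2 * m * n * a * b * e ^+ 2
  + 512%:R * l ^+ 2 * m * n * a * c * d * e
  - 360%:R * l ^+ 2 * m * n * a * d ^+ 3
  + 192%:R * l ^+ 2 * m * n * b ^+ 2 * d * e
  - 256%:R * l ^+ 2 * m * n * b * c ^+ 2 * e
  + 124%:R * l ^+ 2 * m * n * b * c * d ^+ 2
  - 16%:R * l ^+ 2 * m * n * c ^+ 3 * d
  + 16%:R * l ^+ 2 * n ^+ 6 * a ^+ 2
  + 320%:R * l ^+ 2 * n ^+ 4 * a ^+ 2 * e
  - 176%:R * l ^+ 2 * n ^+ 4 * a * b * d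
  + 32%:R * l ^+ 2 * n ^+ 4 * a * c ^+ 2
  + 24%:R * l ^+ 2 * n ^+ 4 * b ^+ 2 * c
  + 1792%:R * l ^+ 2 * n ^+ 2 * a ^+ 2 * e ^+ 2
  - 1088%:R * l ^+ 2 * n ^+ 2 * a * b * d * e
  - 128%:R * l ^+ 2 * n ^+ 2 * a * c ^+ 2 * e
  + 240%:R * l ^+ 2 * n ^+ 2 * a * c * d ^+ 2
  + 240%:R * l ^+ 2 * n ^+ 2 * b ^+ 2 * c * e
  - 2%:R * l ^+ 2 * n ^+ 2 * b ^+ 2 * d ^+ 2
  - 80%:R * l ^+ 2 * n ^+ 2 * b * c ^+ 2 * d
  + 16%:R * l ^+ 2 * n ^+ 2 * c ^+ 4
  + 3072%:R * l ^+ 2 * a ^+ 2 * e ^+ 3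
  - 1536%:R * l ^+ 2 * a * b * d * e ^+ 2
  - 1024%:R * l ^+ 2 * a * c ^+ 2 * e ^+ 2
  + 1152%:R * l ^+ 2 * a * c * d ^+ 2 * e
  - 216%:R * l ^+ 2 * a * d ^+ 4
  + 576%:R * l ^+ 2 * b ^+ 2 * c * e ^+ 2
  - 24%:R * l ^+ 2 * b ^+ 2 * d ^+ 2 * e
  - 320%:R * l ^+ 2 * b * c ^+ 2 * d * e
  + 72%:R * l ^+ 2 * b * c * d ^+ 3
  + 64%:R * l ^+ 2 * c ^+ 4 * e
  - 16%:R * l ^+ 2 * c ^+ 3 * d ^+ 2
  - 1%:R * l * m ^+ 7 * b * e
  - 12%:R * l * m ^+ 6 * n * a * e
  + 1%:R * l * m ^+ 6 * n * b * d
  + 11%:R * l * m ^+ 5 * n ^+ 2 * a * d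
  - 1%:R * l * m ^+ 5 * n ^+ 2 * b * c
  - 40%:R * l * m ^+ 5 * a * d * e
  - 12%:R * l * m ^+ 5 * b * c * e
  + 1%:R * l * m ^+ 5 * b * d ^+ 2
  - 10%:R * l * m ^+ 4 * n ^+ 3 * a * c
  + 1%:R * l * m ^+ 4 * n ^+ 3 * b ^+ 2
  - 64%:R * l * m ^+ 4 * n * a * c * e
  + 48%:R * l * m ^+ 4 * n * a * d ^+ 2
  + 48%:R * l * m ^+ 4 * n * b ^+ 2 * e
  + 8%:R * l * m ^+ 4 * n * b * c * d
  + 8%:R * l * m ^+ 3 * n ^+ 4 * a * b
  + 104%:R * l * m ^+ 3 * n ^+ 2 * a * b * e
  - 20%:R * l * m ^+ 3 * n ^+ 2 * a * c * d
  - 41%:R * l * m ^+ 3 * n ^+ 2 * b ^+ 2 * d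
  - 8%:R * l * m ^+ 3 * n ^+ 2 * b * c ^+ 2
  + 576%:R * l * m ^+ 3 * a * b * e ^+ 2
  - 320%:R * l * m ^+ 3 * a * c * d * e
  + 36%:R * l * m ^+ 3 * a * d ^+ 3
  + 108%:R * l * m ^+ 3 * b ^+ 2 * d * e
  - 48%:R * l * m ^+ 3 * b * c ^+ 2 * e
  + 8%:R * l * m ^+ 3 * b * c * d ^+ 2
  - 8%:R * l * m ^+ 2 * n ^+ 5 * a ^+ 2
  - 352%:R * l * m ^+ 2 * n ^+ 3 * a ^+ 2 * e
  + 4%:R * l * m ^+ 2 * n ^+ 3 * a * b * d
  - 8%:R * l * m ^+ 2 * n ^+ 3 * a * c ^+ 2
  + 46%:R * l * m ^+ 2 * n ^+ 3 * b ^+ 2 * c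
  - 1280%:R * l * m ^+ 2 * n * a ^+ 2 * e ^+ 2
  - 416%:R * l * m ^+ 2 * n * a * b * d * e
  + 64%:R * l * m ^+ 2 * n * a * c ^+ 2 * e
  + 168%:R * l * m ^+ 2 * n * a * c * d ^+ 2
  + 168%:R * l * m ^+ 2 * n * b ^+ 2 * c * e
  - 140%:R * l * m ^+ 2 * n * b ^+ 2 * d ^+ 2
  + 16%:R * l * m ^+ 2 * n * b * c ^+ 2 * d
  + 192%:R * l * m * n ^+ 4 * a ^+ 2 * d
  - 16%:R * l * m * n ^+ 4 * a * b * c
  - 36%:R * l * m * n ^+ 4 * b ^+ 3
  + 384%:R * l * m * n ^+ 2 * a ^+ 2 * d * e
  + 512%:R * l * m * n ^+ 2 * a * b * c * e
  + 192%:R * l * m * n ^+ 2 * a * b * d ^+ 2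
  - 256%:R * l * m * n ^+ 2 * a * c ^+ 2 * d
  - 360%:R * l * m * n ^+ 2 * b ^+ 3 * e
  + 124%:R * l * m * n ^+ 2 * b ^+ 2 * c * d
  - 16%:R * l * m * n ^+ 2 * b * c ^+ 3
  - 1536%:R * l * m * a ^+ 2 * d * e ^+ 2
  + 2304%:R * l * m * a * b * c * e ^+ 2
  - 96%:R * l * m * a * b * d ^+ 2 * e
  - 640%:R * l * m * a * c ^+ 2 * d * e
  + 144%:R * l * m * a * c * d ^+ 3
  - 864%:R * l * m * b ^+ 3 * e ^+ 2
  + 432%:R * l * m * b ^+ 2 * c * d * e
  - 96%:R * l * m * b ^+ 2 * d ^+ 3
  - 64%:R * l * m * b * c ^+ 3 * e
  + 16%:R * l * m * b * c ^+ 2 * d ^+ 2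
  - 128%:R * l * n ^+ 5 * a ^+ 2 * c
  + 72%:R * l * n ^+ 5 * a * b ^+ 2
  - 1024%:R * l * n ^+ 3 * a ^+ 2 * c * e
  + 288%:R * l * n ^+ 3 * a ^+ 2 * d ^+ 2
  + 576%:R * l * n ^+ 3 * a * b ^+ 2 * e
  - 320%:R * l * n ^+ 3 * a * b * c * d
  + 128%:R * l * n ^+ 3 * a * c ^+ 3
  + 36%:R * l * n ^+ 3 * b ^+ 3 * d
  - 24%:R * l * n ^+ 3 * b ^+ 2 * c ^+ 2
  - 2048%:R * l * n * a ^+ 2 * c * e ^+ 2
  + 1152%:R * l * n * a ^+ 2 * d ^+ 2 * e
  + 1152%:R * l * n * a * b ^+ 2 * e ^+ 2
  - 1280%:R * l * n * a * b * c * d * e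
  + 144%:R * l * n * a * b * d ^+ 3
  + 512%:R * l * n * a * c ^+ 3 * e
  - 96%:R * l * n * a * c ^+ 2 * d ^+ 2
  + 144%:R * l * n * b ^+ 3 * d * e
  - 96%:R * l * n * b ^+ 2 * c ^+ 2 * e
  + 16%:R * l * n * b ^+ 2 * c * d ^+ 2
  + 1%:R * m ^+ 8 * a * e
  - 1%:R * m ^+ 7 * n * a * d
  + 1%:R * m ^+ 6 * n ^+ 2 * a * c
  + 16%:R * m ^+ 6 * a * c * e
  - 1%:R * m ^+ 6 * a * d ^+ 2
  - 1%:R * m ^+ 6 * b ^+ 2 * e
  - 1%:R * m ^+ 5 * n ^+ 3 * a * b
  - 40%:R * m ^+ 5 * n * a * b * e
  - 12%:R * m ^+ 5 * n * a * c * d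
  + 1%:R * m ^+ 5 * n * b ^+ 2 * d
  + 1%:R * m ^+ 4 * n ^+ 4 * a ^+ 2
  + 80%:R * m ^+ 4 * n ^+ 2 * a ^+ 2 * e
  + 34%:R * m ^+ 4 * n ^+ 2 * a * b * d
  + 12%:R * m ^+ 4 * n ^+ 2 * a * c ^+ 2
  - 1%:R * m ^+ 4 * n ^+ 2 * b ^+ 2 * c
  - 128%:R * m ^+ 4 * a ^+ 2 * e ^+ 2
  - 80%:R * m ^+ 4 * a * b * d * e
  + 96%:R * m ^+ 4 * a * c ^+ 2 * e
  - 12%:R * m ^+ 4 * a * c * d ^+ 2
  - 12%:R * m ^+ 4 * b ^+ 2 * c * e
  + 1%:R * m ^+ 4 * b ^+ 2 * d ^+ 2
  - 72%:R * m ^+ 3 * n ^+ 3 * a ^+ 2 * d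
  - 44%:R * m ^+ 3 * n ^+ 3 * a * b * c
  + 1%:R * m ^+ 3 * n ^+ 3 * b ^+ 3
  + 576%:R * m ^+ 3 * n * a ^+ 2 * d * e
  - 320%:R * m ^+ 3 * n * a * b * c * e
  + 108%:R * m ^+ 3 * n * a * b * d ^+ 2
  - 48%:R * m ^+ 3 * n * a * c ^+ 2 * d
  + 36%:R * m ^+ 3 * n * b ^+ 3 * e
  + 8%:R * m ^+ 3 * n * b ^+ 2 * c * d
  + 80%:R * m ^+ 2 * n ^+ 4 * a ^+ 2 * c
  + 30%:R * m ^+ 2 * n ^+ 4 * a * b ^+ 2
  + 64%:R * m ^+ 2 * n ^+ 2 * a ^+ 2 * c * e
  - 504%:R * m ^+ 2 * n ^+ 2 * a ^+ 2 * d ^+ 2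
  + 264%:R * m ^+ 2 * n ^+ 2 * a * b ^+ 2 * e
  + 56%:R * m ^+ 2 * n ^+ 2 * a * b * c * d
  + 48%:R * m ^+ 2 * n ^+ 2 * a * c ^+ 3
  - 30%:R * m ^+ 2 * n ^+ 2 * b ^+ 3 * d
  - 8%:R * m ^+ 2 * n ^+ 2 * b ^+ 2 * c ^+ 2
  - 1024%:R * m ^+ 2 * a ^+ 2 * c * e ^+ 2
  + 576%:R * m ^+ 2 * a ^+ 2 * d ^+ 2 * e
  + 576%:R * m ^+ 2 * a * b ^+ 2 * e ^+ 2
  - 640%:R * m ^+ 2 * a * b * c * d * e
  + 72%:R * m ^+ 2 * a * b * d ^+ 3
  + 256%:R * m ^+ 2 * a * c ^+ 3 * e
  - 48%:R * m ^+ 2 * a * c ^+ 2 * d ^+ 2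
  + 72%:R * m ^+ 2 * b ^+ 3 * d * e
  - 48%:R * m ^+ 2 * b ^+ 2 * c ^+ 2 * e
  + 8%:R * m ^+ 2 * b ^+ 2 * c * d ^+ 2
  - 96%:R * m * n ^+ 5 * a ^+ 2 * b
  - 768%:R * m * n ^+ 3 * a ^+ 2 * b * e
  + 576%:R * m * n ^+ 3 * a ^+ 2 * c * d
  - 24%:R * m * n ^+ 3 * a * b ^+ 2 * d
  - 160%:R * m * n ^+ 3 * a * b * c ^+ 2
  + 36%:R * m * n ^+ 3 * b ^+ 3 * c
  - 1536%:R * m * n * a ^+ 2 * b * e ^+ 2
  + 2304%:R * m * n * a ^+ 2 * c * d * e
  - 864%:R * m * n * a ^+ 2 * d ^+ 3
  - 96%:R * m * n * a * b ^+ 2 * d * e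
  - 640%:R * m * n * a * b * c ^+ 2 * e
  + 432%:R * m * n * a * b * c * d ^+ 2
  - 64%:R * m * n * a * c ^+ 3 * d
  + 144%:R * m * n * b ^+ 3 * c * e
  - 96%:R * m * n * b ^+ 3 * d ^+ 2
  + 16%:R * m * n * b ^+ 2 * c ^+ 2 * d
  + 64%:R * n ^+ 6 * a ^+ 3
  + 768%:R * n ^+ 4 * a ^+ 3 * e
  - 192%:R * n ^+ 4 * a ^+ 2 * b * d
  - 128%:R * n ^+ 4 * a ^+ 2 * c ^+ 2
  + 144%:R * n ^+ 4 * a * b ^+ 2 * c
  - 27%:R * n ^+ 4 * b ^+ 4
  + 3072%:R * n ^+ 2 * a ^+ 3 * e ^+ 2
  - 1536%:R * n ^+ 2 * a ^+ 2 * b * d * e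
  - 1024%:R * n ^+ 2 * a ^+ 2 * c ^+ 2 * e
  + 576%:R * n ^+ 2 * a ^+ 2 * c * d ^+ 2
  + 1152%:R * n ^+ 2 * a * b ^+ 2 * c * e
  - 24%:R * n ^+ 2 * a * b ^+ 2 * d ^+ 2
  - 320%:R * n ^+ 2 * a * b * c ^+ 2 * d
  + 64%:R * n ^+ 2 * a * c ^+ 4
  - 216%:R * n ^+ 2 * b ^+ 4 * e
  + 72%:R * n ^+ 2 * b ^+ 3 * c * d
  - 16%:R * n ^+ 2 * b ^+ 2 * c ^+ 3
  + 4096%:R * a ^+ 3 * e ^+ 3
  - 3072%:R * a ^+ 2 * b * d * e ^+ 2
  - 2048%:R * a ^+ 2 * c ^+ 2 * e ^+ 2
  + 2304%:R * a ^+ 2 * c * d ^+ 2 * e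
  - 432%:R * a ^+ 2 * d ^+ 4
  + 2304%:R * a * b ^+ 2 * c * e ^+ 2
  - 96%:R * a * b ^+ 2 * d ^+ 2 * e
  - 1280%:R * a * b * c ^+ 2 * d * e
  + 288%:R * a * b * c * d ^+ 3
  + 256%:R * a * c ^+ 4 * e
  - 64%:R * a * c ^+ 3 * d ^+ 2
  - 432%:R * b ^+ 4 * e ^+ 2
  + 288%:R * b ^+ 3 * c * d * e
  - 64%:R * b ^+ 3 * d ^+ 3
  - 64%:R * b ^+ 2 * c ^+ 3 * e
  + 16%:R * b ^+ 2 * c ^+ 2 * d ^+ 2
.

Definition discPQ PQ : R :=
  disc_poly (cl PQ) (cm PQ) (cn PQ) (ca PQ) (cb PQ) (cc PQ) (cd PQ) (ce PQ).

(* The substitution x <- m11 x + m21 z, z <- m12 x + m22 z,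
   y <- mu^-1 y + r0 x^2 + r1 xz + r2 z^2, followed by rescaling so that
   the y^2 coefficient is 1:
     y^2 + mu (P o M + 2 r) y = mu^2 (Q o M - r (P o M) - r^2). *)
Definition rpoly (r0 r1 r2 : R) : {poly R} := r0 *: 'X^2 + r1 *: 'X + r2%:P.

Definition transform (M : 'M[R]_2) (mu r0 r1 r2 : R) PQ : model R :=
  let PM := form_subst 2 PQ.1 M in
  let QM := form_subst 4 PQ.2 M in
  let r := rpoly r0 r1 r2 in
  (mu *: (PM + 2%:R *: r), mu ^+ 2 *: (QM - r * PM - r ^+ 2)).
End Coeffs.

(* Weierstrass equations y^2 + a1 xy + a3 y = x^3 + a2 x^2 + a4 x + a6.      *)
Record weier (R : Type) := Weier { w1 : R; w2 : R; w3 : R; w4 : R; w6 : R }.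

Section Weierstrass.
Variable (R : comNzRingType).
Definition wdisc (W : weier R) : R :=
  let a1 := w1 W in let a2 := w2 W in let a3 := w3 W in
  let a4 := w4 W in let a6 := w6 W in
  let b2 := a1 ^+ 2 + 4%:R * a2 in
  let b4 := 2%:R * a4 + a1 * a3 in
  let b6 := a3 ^+ 2 + 4%:R * a6 in
  let b8 := a1 ^+ 2 * a6 + 4%:R * a2 * a6 - a1 * a3 * a4 + a2 * a3 ^+ 2
            - a4 ^+ 2 in
  - b2 ^+ 2 * b8 - 8%:R * b4 ^+ 3 - 27%:R * b6 ^+ 2 + 9%:R * b2 * b4 * b6.

(* A Weierstrass equation for the Jacobian E of y^2 + P y = Q
   (classical formula; its discriminant equals Delta(P,Q), see
   [disc_jacobian] and its invariants are c4, c6 of the model). *)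
Definition jacobian (PQ : model R) : weier R :=
  let l := cl PQ in let m := cm PQ in let n := cn PQ in
  let a := ca PQ in let b := cb PQ in let c := cc PQ in
  let d := cd PQ in let e := ce PQ in
  Weier m (c - l * n) (n * b + l * d)
    (b * d - 4%:R * a * e - n ^+ 2 * a - l * n * c - l ^+ 2 * e)
    (b ^+ 2 * e + a * d ^+ 2 - 4%:R * a * c * e - n ^+ 2 * a * c + m * n * a * d
     - m ^+ 2 * a * e - l * n * b * d + l * m * b * e - l ^+ 2 * c * e).
End Weierstrass.

(* change of Weierstrass coordinates x = u^2 x' + r, y = u^3 y' + u^2 s x' + t *)
Definition wtransform (K : fieldType) (u r s t : K) (W : weier K) : weier K :=
  let a1 := w1 W in let a2 := w2 W in let a3 := w3 W in
  let a4 := w4 W in let a6 := w6 W in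
  Weier ((a1 + 2%:R * s) / u)
        ((a2 - s * a1 + 3%:R * r - s ^+ 2) / u ^+ 2)
        ((a3 + r * a1 + 2%:R * t) / u ^+ 3)
        ((a4 - s * a3 + 2%:R * r * a2 - (t + r * s) * a1 + 3%:R * r ^+ 2
          - 2%:R * s * t) / u ^+ 4)
        ((a6 + r * a4 + r ^+ 2 * a2 + r ^+ 3 - t * a3 - t ^+ 2 - r * t * a1)
          / u ^+ 6).

Section Models.
Variables (K : fieldType) (v : dvaluation K).
Implicit Type PQ : model K.

Definition w_integral (W : weier K) : Prop :=
  inO v (w1 W) /\ inO v (w2 W) /\ inO v (w3 W) /\ inO v (w4 W) /\ inO v (w6 W).

Definition min_disc_val (W : weier K) (delta : int) : Prop :=
  (exists u r s t : K, u != 0 /\ w_integral (wtransform u r s t W) /\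
      dv v (wdisc (wtransform u r s t W)) = delta) /\
  (forall u r s t : K, u != 0 -> w_integral (wtransform u r s t W) ->
      delta <= dv v (wdisc (wtransform u r s t W))).

Definition nonsingular PQ : Prop := discPQ PQ != 0.

Definition level_is PQ (lev : int) : Prop :=
  exists delta : int, min_disc_val (jacobian PQ) delta /\
    dv v (discPQ PQ) = delta + 12%:R * lev.

Definition integral PQ : Prop := form_vge v PQ.1 0 /\ form_vge v PQ.2 0.

Definition Kequiv PQ PQ' : Prop :=
  exists (M : 'M[K]_2) (mu r0 r1 r2 : K),
    \det M != 0 /\ mu != 0 /\ PQ' = transform M mu r0 r1 r2 PQ.

Definition yequiv PQ PQ' : Prop :=
  exists r0 r1 r2 : K, inO v r0 /\ inO v r1 /\ inO v r2 /\
    PQ' = transform 1%:M 1 r0 r1 r2 PQ.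

Definition vPQ_ge PQ (k : int) : Prop :=
  exists PQ', yequiv PQ PQ' /\ (forall i, vge2 v PQ'.1`_i k) /\ form_vge v PQ'.2 k.

Definition vPQ_eq PQ (k : int) : Prop := vPQ_ge PQ k /\ ~ vPQ_ge PQ (k + 1).

Definition nonminimal PQ : Prop :=
  exists PQ', Kequiv PQ PQ' /\ integral PQ' /\
    dv v (discPQ PQ') < dv v (discPQ PQ).

Definition GL2O (M : 'M[K]_2) : Prop :=
  (forall i j, inO v (M i j)) /\ \det M != 0 /\ dv v (\det M) = 0.

(* d^2 Q / dx dz = 3b x^2 + 4c xz + 3d z^2 *)
Definition dxdz (Q : {poly K}) : {poly K} :=
  (3%:R * Q`_3) *: 'X^2 + (4%:R * Q`_2) *: 'X + (3%:R * Q`_1)%:P.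

Definition isQ1 (pi : K) PQ (dg : nat) (F : {poly K}) : Prop :=
  (~ form_vge v PQ.1 1 /\ dg = 2%N /\ F = PQ.1) \/
  (form_vge v PQ.1 1 /\ vPQ_eq PQ 0 /\ dg = 2%N /\ F = dxdz PQ.2) \/
  (form_vge v PQ.1 1 /\ form_vge v PQ.2 1 /\ ~ form_vge v PQ.2 2 /\
     dg = 4%N /\ F = pi^-1 *: PQ.2).

Definition double_root (L : fieldType) (dg : nat) (F : {poly L}) (x0 z0 : L) : Prop :=
  (x0 != 0 \/ z0 != 0) /\
  exists G : {poly L}, (size G <= dg.-1)%N /\ F = (z0 *: 'X - x0%:P) ^+ 2 * G.

(* The reduction mod pi of F (coefficients in O_K) has a unique repeated
   root over an algebraic closure of k, and it is defined over k.
   (Quantified over every algebraically closed field L containing k.) *)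
Definition unique_rational_double_root (dg : nat) (F : {poly K}) : Prop :=
  forall (L : closedFieldType) (rho : K -> L), residue_embedding v rho ->
  exists x0 z0 : K, inO v x0 /\ inO v z0 /\
    double_root dg (map_poly rho F) (rho x0) (rho z0) /\
    (forall x1 z1 : L, double_root dg (map_poly rho F) x1 z1 ->
       x1 * rho z0 = rho x0 * z1).

Definition double_root_modpi (dg : nat) (F : {poly K}) (x0 z0 : K) : Prop :=
  inO v x0 /\ inO v z0 /\ ~ (vge v x0 1 /\ vge v z0 1) /\
  exists G : {poly K}, (size G <= dg.-1)%N /\ (forall i, inO v G`_i) /\
    forall i, vge v (F - (z0 *: 'X - x0%:P) ^+ 2 * G)`_i 1.

Definition rescale (pi : K) PQ : model K :=
  (pi^-1 *: \poly_(i < 3) (pi ^+ i * PQ.1`_i),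
   pi^-2 *: \poly_(i < 5) (pi ^+ i * PQ.2`_i)).

Definition procedure_step (pi : K) PQ PQ' : Prop :=
  exists PQ1 : model K,
    (vPQ_eq PQ 1 -> yequiv PQ PQ1 /\ form_vge v PQ1.2 1) /\
    (vPQ_eq PQ 0 -> PQ1 = PQ) /\
  exists (dg : nat) (F : {poly K}), isQ1 pi PQ1 dg F /\
  exists M : 'M[K]_2, GL2O M /\
    (* M sends (0:1) to the repeated root of Q1 mod pi *)
    double_root_modpi dg F (M 1 0) (M 1 1) /\
  exists PQ3 : model K,
    yequiv (transform M 1 0 0 0 PQ1) PQ3 /\ vge v (ce PQ3) 1 /\
    PQ' = rescale pi PQ3.

End Models.

Lemma disc_jacobian (R : comNzRingType) (PQ : model R) :
  discPQ PQ = wdisc (jacobian PQ).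
Proof.
rewrite /discPQ /wdisc /jacobian /disc_poly /=.
set l := cl PQ; set m := cm PQ; set n := cn PQ; set a := ca PQ.
set b := cb PQ; set c := cc PQ; set d := cd PQ; set e := ce PQ.
ring.
Qed.

(* Delta(P,Q) = (c4^3 - c6^2)/1728 with c4 = 2^4 I, c6 = 2^5 J, where I, J
   are the invariants of G = P^2/4 + Q (over a field of characteristic 0). *)
Definition c4c6 (R : fieldType) (l m n a b c d e : R) : R * R :=
  let al := a + l ^+ 2 / 4%:R in
  let be := b + l * m / 2%:R in
  let ga := c + (m ^+ 2 + 2%:R * l * n) / 4%:R in
  let de := d + m * n / 2%:R in
  let ep := e + n ^+ 2 / 4%:R in
  let I := 12%:R * al * ep - 3%:R * be * de + ga ^+ 2 in
  let J := 72%:R * al * ga * ep - 27%:R * al * de ^+ 2 - 27%:R * be ^+ 2 * ep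
           + 9%:R * be * ga * de - 2%:R * ga ^+ 3 in
  (16%:R * I, 32%:R * J).

Lemma disc_c4c6 (R : numFieldType) (l m n a b c d e : R) :
  1728%:R * disc_poly l m n a b c d e =
  (c4c6 l m n a b c d e).1 ^+ 3 - (c4c6 l m n a b c d e).2 ^+ 2.
Proof.
rewrite /c4c6 /disc_poly /=.
have h2 : (2%:R : R) != 0 by rewrite pnatr_eq0.
have h4 : (4%:R : R) != 0 by rewrite pnatr_eq0.
field; by rewrite ?h2 ?h4 ?pnatr_eq0.
Qed.

(* Main.v *)
(* Positive level means that the Weierstrass equation of the Jacobian is non-minimal, so
   that Tate's algorithm applied to it runs to the end.  Each stage passed is a congruence
   on the coefficients of the model: [pi] divides [m] (case 1), the invariants [I] and [J]
   of [pi^-1 Q] vanish mod [pi] (case 3).  In residue characteristic 2 these force [Q_1] to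
   be a multiple of a square, or a quartic with a root of multiplicity at least 3.  Once
   the root is at (0:1), the same congruences give [pi | d] and [pi^2 | e], which is what
   the last step of the procedure needs.

   If the model is non-minimal, the Smith normal form of the transformation that lowers
   the discriminant provides an O_K-equivalent model on which the diagonal substitution
   x <- pi^s x followed by division by (pi^s, pi^2s) gives v(P,Q) >= 2, and the resulting
   bounds on the coefficients for s > 2 imply those for s = 2.  The repeated root of this
   model is (0:1), so the matrix relating it to any model on which the procedure has moved
   the root to (0:1) is triangular mod [pi] and stays integral under conjugation by
   diag(pi, 1).  Hence each iteration lowers s by 1. *)
Require Import Defs.
From Stdlib Require Import Classical.
From HB Require Import structures.
From mathcomp Require Import all_boot all_order all_algebra.
From mathcomp Require Import ring zify.
Set Implicit Arguments.
Unset Strict Implicit.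
Unset Printing Implicit Defensive.
Import Order.TTheory GRing.Theory Num.Theory.
Local Open Scope ring_scope.

(** * Valuation bounds *)

Section ValuationBounds.
Variables (K : fieldType) (v : dvaluation K).

(** Since 2 is not invertible, the square in $y$ cannot be completed, and every comparison of models
    carries a y-substitution. Its coefficients are known at first only in $K$; they become integral
    as roots of monic equations over $O_K$. The procedure leaves choices open (lift of the root,
    matrix, y-substitutions), so a run is followed only up to $O_K$-equivalence, and part (iii)
    compares an arbitrary run with one fixed adapted model. The bounds in [adapted] say that
    $\pi^{-s}P(\pi^s x,z)$ is divisible by $\pi$ and $\pi^{-2s}Q(\pi^s x,z)$ by $\pi^2$: $v(m)\ge1$,
    $v(c)\ge2$, $v(n)\ge s+1$, $v(d)\ge s+2$, $v(e)\ge 2s+2$, and $v(l)\ge 1-s$, $v(a)\ge 2-2s$,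
    $v(b)\ge 2-s$. From $s=2$ on the last three hold for every integral model, which is why two
    iterations suffice. The extra factors $\pi$ and $\pi^2$ come from the discriminant: it is
    multiplied by $(\mu\det M)^{12}$, so lowering it forces $v(\mu\det M)\le-1$. *)

Lemma dv1 : dv v 1 = 0.
Proof.
have := dv_mul v (oner_neq0 K) (oner_neq0 K); rewrite mulr1 => e.
by apply: (addrI (dv v 1)); rewrite -e addr0.
Qed.

Lemma dvN x : x != 0 -> dv v (- x) = dv v x.
Proof.
move=> nx; have n1 : (- 1 : K) != 0 by rewrite oppr_eq0 oner_neq0.
have := dv_mul v n1 n1; rewrite mulrNN mulr1 dv1 => e.
by rewrite -mulN1r dv_mul //; lia.
Qed.

Lemma dvV x : x != 0 -> dv v x^-1 = - dv v x.
Proof.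
move=> nx; have nxi : x^-1 != 0 by rewrite invr_eq0.
by have := dv_mul v nx nxi; rewrite divff // dv1; lia.
Qed.

Lemma dvX x n : x != 0 -> dv v (x ^+ n) = n%:Z * dv v x.
Proof.
move=> nx; elim: n => [|n IHn]; first by rewrite expr0 dv1; lia.
by rewrite exprS dv_mul ?expf_neq0 // IHn; lia.
Qed.

(** Boolean and with natural bounds, so that [vtac] can compare bounds by computation. *)
Definition vgeb (k : nat) (x : K) : bool := (x == 0) || (k%:Z <= dv v x).

Lemma vgeP k x : reflect (vge v x k%:Z) (vgeb k x).
Proof.
apply: (iffP orP) => [[/eqP|] | [->|]]; [by left|by right|by left|by right].
Qed.

Lemma vge2_1 x : vge2 v x 1 <-> vge v x 1.
Proof. by split=> -[->|h]; [left|right; lia|left|right; lia]. Qed.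

Lemma vge2_0 x : vge v x 0 -> vge2 v x 0.
Proof. by move=> [->|h]; [left|right; lia]. Qed.

Lemma vge2_2 x : vge v x 1 -> vge2 v x 2.
Proof. by move=> [->|h]; [left|right; lia]. Qed.

Lemma vgeb0 k : vgeb k 0.
Proof. by rewrite /vgeb eqxx. Qed.

Lemma vgeb1 : vgeb 0 1.
Proof. by rewrite /vgeb dv1 orbT. Qed.

Lemma vgeb_le j k x : vgeb j x -> (k <= j)%N -> vgeb k x.
Proof. by rewrite /vgeb => /orP[->//|h] kj; apply/orP; right; lia. Qed.

Lemma vgeb_eq k x y : x = y -> vgeb k x -> vgeb k y.
Proof. by move=> ->. Qed.

Lemma vgebN k x : vgeb k x -> vgeb k (- x).
Proof.
rewrite /vgeb oppr_eq0; case: eqVneq => //= nx; by rewrite dvN.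
Qed.

Lemma vgebD_same k x y : vgeb k x -> vgeb k y -> vgeb k (x + y).
Proof.
rewrite /vgeb; case: (eqVneq x 0) => [->|nx]; first by rewrite add0r.
case: (eqVneq y 0) => [->|ny] /=; first by rewrite addr0 (negbTE nx).
case: (eqVneq (x + y) 0) => //= nxy hx hy.
by case: (dv_add v nx ny nxy) => h; lia.
Qed.

Lemma vgebD i j x y : vgeb i x -> vgeb j y -> vgeb (minn i j) (x + y).
Proof.
by move=> hx hy; apply: vgebD_same; [apply: vgeb_le hx _|apply: vgeb_le hy _];
  lia.
Qed.

Lemma vgebM i j x y : vgeb i x -> vgeb j y -> vgeb (i + j) (x * y).
Proof.
rewrite /vgeb; case: (eqVneq x 0) => [->|nx]; first by rewrite mul0r eqxx.
case: (eqVneq y 0) => [->|ny] /=; first by rewrite mulr0 eqxx.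
by rewrite mulf_eq0 (negbTE nx) (negbTE ny) /= dv_mul //; lia.
Qed.

Lemma vgebX i x n : vgeb i x -> vgeb (n * i) (x ^+ n).
Proof.
move=> hx; elim: n => [|n IHn]; first by rewrite expr0 vgeb1.
by rewrite exprS mulSn; apply: vgebM.
Qed.

Lemma vgeb_nat n : vgeb 1 2%:R -> vgeb (~~ odd n) n%:R.
Proof.
move=> h2; have hn m : vgeb 0 m%:R.
  by elim: m => [|m IHm]; rewrite ?vgeb0 // -natr1 vgebD_same ?vgeb1.
case: (boolP (odd n)) => on //=.
rewrite -(odd_double_half n) (negbTE on) add0n -muln2 natrM mulrC.
exact: (vgebM (i := 1) (j := 0)).
Qed.

End ValuationBounds.

(* Bounds the valuation of a polynomial expression below, using for each
   subexpression the most recent bound in the context. *)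
Ltac vgeb_bound v x :=
  match goal with
  | H : is_true (vgeb v ?k x) |- _ => constr:(H)
  | _ =>
    lazymatch x with
    | ?a + ?b => let p := vgeb_bound v a in let q := vgeb_bound v b in
                 constr:(vgebD p q)
    | - ?a => let p := vgeb_bound v a in constr:(vgebN p)
    | ?a * ?b => let p := vgeb_bound v a in let q := vgeb_bound v b in
                 constr:(vgebM p q)
    | ?a ^+ ?n => let p := vgeb_bound v a in constr:(vgebX n p)
    | 1 => constr:(vgeb1 v)
    (* The bound 6 stands for infinity: it is the largest one asked for, by $a_6$ and by the
       coefficient $e$ in [adapted]. *)
    | 0 => constr:(vgeb0 v 6)
    | 1 *+ ?n => match goal with
                 | H : is_true (vgeb v ?k (1 *+ n)) |- _ => constr:(H)
                 | H : is_true (vgeb v 1 2%:R) |- _ => constr:(vgeb_nat n H)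
                 end
    end
  | H : is_true (vgeb v ?k ?y) |- _ =>
    let _ := match goal with _ => unify x y end in constr:(H)
  end.

Ltac vtac :=
  lazymatch goal with
  | |- is_true (vgeb ?v ?k ?x) =>
    let p := vgeb_bound v x in exact: (@vgeb_le _ v _ k x p isT)
  end.

(** Bounds are computed from the syntax, so the goal is first replaced by an equal expression [e]
    that groups the terms already known to be small. *)
Ltac vring e :=
  match goal with |- is_true (vgeb ?v ?k ?x) =>
    replace x with e by ring; vtac end.

Ltac vring_unfold E e :=
  match goal with |- is_true (vgeb ?v ?k ?x) =>
    replace x with e by (unfold E; ring); vtac end.

(** * Units, integral closure and the uniformiser *)

Section ValuationUnits.
Variables (K : fieldType) (v : dvaluation K).
Local Notation vgeb := (vgeb v).

Lemma vgeb_mulr_unit k x y : ~~ vgeb 1 y -> vgeb k (x * y) -> vgeb k x.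
Proof.
rewrite /vgeb negb_or => /andP[ny hy]; case: (eqVneq x 0) => //= nx.
by rewrite mulf_eq0 (negbTE nx) (negbTE ny) /= dv_mul //; lia.
Qed.

Lemma vgeb_mull_unit k x y : ~~ vgeb 1 y -> vgeb k (y * x) -> vgeb k x.
Proof. by rewrite mulrC; apply: vgeb_mulr_unit. Qed.

(** The valuation of a square is even, so an odd bound gains one. For [k] equal to 0: $\pi\mid x^2$
    implies $\pi\mid x$. *)
Lemma vgeb_sqr_odd k x : vgeb (k.*2.+1) (x ^+ 2) -> vgeb k.+1 x.
Proof.
rewrite /vgeb sqrf_eq0; case: eqVneq => //= nx; by rewrite dvX //; lia.
Qed.

Lemma vgeb1_unit : ~~ vgeb 1 1.
Proof. by rewrite /vgeb oner_eq0 dv1. Qed.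

Definition vunit x := (x != 0) && (dv v x == 0).

Lemma vunitE x : vunit x = vgeb 0 x && ~~ vgeb 1 x.
Proof.
rewrite /vunit /vgeb; case: eqVneq => //= nx.
by apply/idP/idP; lia.
Qed.

Lemma vunitV x : vunit x -> vunit x^-1.
Proof.
rewrite /vunit => /andP[nx /eqP hx].
by rewrite invr_eq0 nx dvV // hx oppr0.
Qed.

Lemma vunitM x y : vunit x -> vunit y -> vunit (x * y).
Proof.
rewrite /vunit => /andP[nx /eqP hx] /andP[ny /eqP hy].
by rewrite mulf_neq0 // dv_mul // hx hy.
Qed.

Lemma vunitN x : vunit x -> vunit (- x).
Proof. by rewrite /vunit oppr_eq0 => /andP[nx]; rewrite nx dvN. Qed.

Lemma vunit1 : vunit 1.
Proof. by rewrite /vunit oner_neq0 dv1. Qed.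

Lemma vunit_ge0 x : vunit x -> vgeb 0 x.
Proof. by rewrite vunitE => /andP[]. Qed.

Lemma vunit_neq0 x : vunit x -> x != 0.
Proof. by case/andP. Qed.

Lemma vunit_ge1 x : vunit x -> ~~ vgeb 1 x.
Proof. by rewrite vunitE => /andP[]. Qed.

Lemma vunitI x : vgeb 0 x -> ~~ vgeb 1 x -> vunit x.
Proof. by rewrite vunitE => -> ->. Qed.

(** $O_K$ is integrally closed: if $v(x)<0$, dividing the equation by $x^4$ writes 1 as a
    combination of positive powers of $x^{-1}$, which lies in the maximal ideal. *)
Lemma vgeb_monic_root c0 c1 c2 c3 x :
  vgeb 0 c0 -> vgeb 0 c1 -> vgeb 0 c2 -> vgeb 0 c3 ->
  x ^+ 4 + c3 * x ^+ 3 + c2 * x ^+ 2 + c1 * x + c0 = 0 -> vgeb 0 x.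
Proof.
move=> h0 h1 h2 h3 e; apply: contraT; rewrite /vgeb negb_or => /andP[nx hx].
have hy : vgeb 1 x^-1 by rewrite /vgeb dvV //; apply/orP; right; lia.
move: vgeb1_unit; apply: contraNT => _.
have -> : 1 = - (c3 * x^-1 + c2 * x^-1 ^+ 2 + c1 * x^-1 ^+ 3 + c0 * x^-1 ^+ 4).
  have -> : c3 * x^-1 + c2 * x^-1 ^+ 2 + c1 * x^-1 ^+ 3 + c0 * x^-1 ^+ 4 =
    (x ^+ 4 + c3 * x ^+ 3 + c2 * x ^+ 2 + c1 * x + c0) * x^-1 ^+ 4 - 1 by field.
  by rewrite e; ring.
vtac.
Qed.

Lemma vgeb_monic_root2 c0 c1 x :
  vgeb 0 c0 -> vgeb 0 c1 -> x ^+ 2 + c1 * x + c0 = 0 -> vgeb 0 x.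
Proof.
move=> h0 h1 e.
(* The quadratic equation is multiplied by $x^2$. *)
apply: (@vgeb_monic_root 0 0 c0 c1) => //; rewrite ?vgeb0 //.
by rewrite -[RHS](mulr0 (x ^+ 2)) -[in RHS]e; ring.
Qed.

Variable pi : K.
Hypotheses (npi : pi != 0) (dvpi : dv v pi = 1).

Lemma vgeb_pi : vgeb 1 pi.
Proof. by rewrite /vgeb dvpi orbT. Qed.

Lemma vgeb_pimul j k x : vgeb (j + k) (pi ^+ j * x) = vgeb k x.
Proof.
rewrite /vgeb mulf_eq0 expf_eq0 (negbTE npi) andbF /=.
case: eqVneq => //= nx; rewrite dv_mul ?expf_neq0 // dvX // dvpi.
by apply/idP/idP; lia.
Qed.

Lemma vgeb_pidiv j k x : vgeb (j + k) x -> vgeb k (x / pi ^+ j).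
Proof.
move=> h; rewrite -(vgeb_pimul j) mulrC divfK //; exact: expf_neq0.
Qed.

Lemma vgeb_factor j k x : vgeb (j + k) x -> exists2 y, vgeb k y & x = pi ^+ j * y.
Proof.
move=> h; exists (x / pi ^+ j); first exact: vgeb_pidiv.
by rewrite mulrC divfK //; apply: expf_neq0.
Qed.

End ValuationUnits.

(** * Action on coefficients *)

Section Transform.
Variable R : comNzRingType.
Implicit Types (PQ A B : model R) (M N : 'M[R]_2).

Lemma mulmx2E M N i j : (M *m N) i j = M i 0 * N 0 j + M i 1 * N 1 j.
Proof.
rewrite mxE !big_ord_recl big_ord0 addr0.
by have -> : lift ord0 ord0 = 1 :> 'I_2 by apply/val_inj.
Qed.

Definition mx2 (p q s t : R) : 'M[R]_2 :=
  \matrix_(i, j) if i == 0 then if j == 0 then p else q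
                 else if j == 0 then s else t.

Lemma mx2E p q s t :
  (mx2 p q s t 0 0 = p) * (mx2 p q s t 0 1 = q) *
  (mx2 p q s t 1 0 = s) * (mx2 p q s t 1 1 = t).
Proof. by rewrite !mxE. Qed.

Lemma mx2_eq M N : M 0 0 = N 0 0 -> M 0 1 = N 0 1 -> M 1 0 = N 1 0 ->
  M 1 1 = N 1 1 -> M = N.
Proof.
move=> h00 h01 h10 h11; apply/matrixP => i j.
have two (k : 'I_2) : k = 0 \/ k = 1.
  by case: k => [[|[|k]] hk] //; [left|right]; apply/val_inj.
by case: (two i) => ->; case: (two j) => ->.
Qed.

Lemma scalar_mx2 (x : R) : x%:M = mx2 x 0 0 x.
Proof. by apply: mx2_eq; rewrite !mxE ?mulr1n ?mulr0n. Qed.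

Lemma form_subst2E (F : {poly R}) M :
  form_subst 2 F M =
  (F`_2 * M 0 0 ^+ 2 + F`_1 * M 0 0 * M 0 1 + F`_0 * M 0 1 ^+ 2) *: 'X^2 +
  (2%:R * F`_2 * M 0 0 * M 1 0 + F`_1 * (M 0 0 * M 1 1 + M 1 0 * M 0 1)
   + 2%:R * F`_0 * M 0 1 * M 1 1) *: 'X +
  (F`_2 * M 1 0 ^+ 2 + F`_1 * M 1 0 * M 1 1 + F`_0 * M 1 1 ^+ 2)%:P.
Proof.
rewrite /form_subst !big_ord_recl big_ord0 /= /bump /= !subn0 ?subnn ?add1n.
rewrite -!mul_polyC.
ring.
Qed.

Lemma form_subst4E (F : {poly R}) M :
  let a := F`_4 in let b := F`_3 in let c := F`_2 in let d := F`_1 in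
  let e := F`_0 in
  let p := M 0 0 in let q := M 0 1 in let s := M 1 0 in let t := M 1 1 in
  form_subst 4 F M =
  (a * p ^+ 4 + b * p ^+ 3 * q + c * p ^+ 2 * q ^+ 2 + d * p * q ^+ 3
   + e * q ^+ 4) *: 'X^4 +
  (4%:R * a * p ^+ 3 * s + b * (p ^+ 3 * t + 3%:R * p ^+ 2 * s * q)
   + c * (2%:R * p * s * q ^+ 2 + 2%:R * p ^+ 2 * q * t)
   + d * (s * q ^+ 3 + 3%:R * p * q ^+ 2 * t) + 4%:R * e * q ^+ 3 * t) *: 'X^3 +
  (6%:R * a * p ^+ 2 * s ^+ 2 + b * (3%:R * p ^+ 2 * s * t + 3%:R * p * s ^+ 2 * q)
   + c * (p ^+ 2 * t ^+ 2 + s ^+ 2 * q ^+ 2 + 4%:R * p * s * q * t)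
   + d * (3%:R * p * q * t ^+ 2 + 3%:R * s * q ^+ 2 * t)
   + 6%:R * e * q ^+ 2 * t ^+ 2) *: 'X^2 +
  (4%:R * a * p * s ^+ 3 + b * (s ^+ 3 * q + 3%:R * p * s ^+ 2 * t)
   + c * (2%:R * p * s * t ^+ 2 + 2%:R * s ^+ 2 * q * t)
   + d * (p * t ^+ 3 + 3%:R * s * q * t ^+ 2) + 4%:R * e * q * t ^+ 3) *: 'X +
  (a * s ^+ 4 + b * s ^+ 3 * t + c * s ^+ 2 * t ^+ 2 + d * s * t ^+ 3
   + e * t ^+ 4)%:P.
Proof.
move=> a b c d e p q s t.
rewrite /form_subst !big_ord_recl big_ord0 /= /bump /= !subn0 ?subnn ?add1n.
rewrite -/a -/b -/c -/d -/e -/p -/q -/s -/t -!mul_polyC.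
ring.
Qed.

Lemma transform1E M mu r0 r1 r2 PQ : (transform M mu r0 r1 r2 PQ).1 =
  (mu * (cl PQ * M 0 0 ^+ 2 + cm PQ * M 0 0 * M 0 1 + cn PQ * M 0 1 ^+ 2 + 2%:R * r0)) *: 'X^2 +
  (mu * (2%:R * cl PQ * M 0 0 * M 1 0 + cm PQ * (M 0 0 * M 1 1 + M 1 0 * M 0 1)
        + 2%:R * cn PQ * M 0 1 * M 1 1 + 2%:R * r1)) *: 'X +
  (mu * (cl PQ * M 1 0 ^+ 2 + cm PQ * M 1 0 * M 1 1 + cn PQ * M 1 1 ^+ 2 + 2%:R * r2))%:P.
Proof.
rewrite /cl /cm /cn /transform /= form_subst2E /rpoly -!mul_polyC; ring.
Qed.

Lemma transform2E M mu r0 r1 r2 PQ : (transform M mu r0 r1 r2 PQ).2 =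
  (mu ^+ 2 * (ca PQ * M 0 0 ^+ 4 + cb PQ * M 0 0 ^+ 3 * M 0 1 + cc PQ * M 0 0 ^+ 2 * M 0 1 ^+ 2
     + cd PQ * M 0 0 * M 0 1 ^+ 3 + ce PQ * M 0 1 ^+ 4
     - r0 * (cl PQ * M 0 0 ^+ 2 + cm PQ * M 0 0 * M 0 1 + cn PQ * M 0 1 ^+ 2) - r0 ^+ 2)) *: 'X^4 +
  (mu ^+ 2 * (4%:R * ca PQ * M 0 0 ^+ 3 * M 1 0
     + cb PQ * (M 0 0 ^+ 3 * M 1 1 + 3%:R * M 0 0 ^+ 2 * M 1 0 * M 0 1)
     + cc PQ * (2%:R * M 0 0 * M 1 0 * M 0 1 ^+ 2 + 2%:R * M 0 0 ^+ 2 * M 0 1 * M 1 1)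
     + cd PQ * (M 1 0 * M 0 1 ^+ 3 + 3%:R * M 0 0 * M 0 1 ^+ 2 * M 1 1)
     + 4%:R * ce PQ * M 0 1 ^+ 3 * M 1 1
     - r0 * (2%:R * cl PQ * M 0 0 * M 1 0 + cm PQ * (M 0 0 * M 1 1 + M 1 0 * M 0 1)
             + 2%:R * cn PQ * M 0 1 * M 1 1)
     - r1 * (cl PQ * M 0 0 ^+ 2 + cm PQ * M 0 0 * M 0 1 + cn PQ * M 0 1 ^+ 2) - 2%:R * r0 * r1)) *: 'X^3 +
  (mu ^+ 2 * (6%:R * ca PQ * M 0 0 ^+ 2 * M 1 0 ^+ 2
     + cb PQ * (3%:R * M 0 0 ^+ 2 * M 1 0 * M 1 1 + 3%:R * M 0 0 * M 1 0 ^+ 2 * M 0 1)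
     + cc PQ * (M 0 0 ^+ 2 * M 1 1 ^+ 2 + M 1 0 ^+ 2 * M 0 1 ^+ 2
                + 4%:R * M 0 0 * M 1 0 * M 0 1 * M 1 1)
     + cd PQ * (3%:R * M 0 0 * M 0 1 * M 1 1 ^+ 2 + 3%:R * M 1 0 * M 0 1 ^+ 2 * M 1 1)
     + 6%:R * ce PQ * M 0 1 ^+ 2 * M 1 1 ^+ 2
     - r0 * (cl PQ * M 1 0 ^+ 2 + cm PQ * M 1 0 * M 1 1 + cn PQ * M 1 1 ^+ 2)
     - r1 * (2%:R * cl PQ * M 0 0 * M 1 0 + cm PQ * (M 0 0 * M 1 1 + M 1 0 * M 0 1)
             + 2%:R * cn PQ * M 0 1 * M 1 1)
     - r2 * (cl PQ * M 0 0 ^+ 2 + cm PQ * M 0 0 * M 0 1 + cn PQ * M 0 1 ^+ 2)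
     - r1 ^+ 2 - 2%:R * r0 * r2)) *: 'X^2 +
  (mu ^+ 2 * (4%:R * ca PQ * M 0 0 * M 1 0 ^+ 3
     + cb PQ * (M 1 0 ^+ 3 * M 0 1 + 3%:R * M 0 0 * M 1 0 ^+ 2 * M 1 1)
     + cc PQ * (2%:R * M 0 0 * M 1 0 * M 1 1 ^+ 2 + 2%:R * M 1 0 ^+ 2 * M 0 1 * M 1 1)
     + cd PQ * (M 0 0 * M 1 1 ^+ 3 + 3%:R * M 1 0 * M 0 1 * M 1 1 ^+ 2)
     + 4%:R * ce PQ * M 0 1 * M 1 1 ^+ 3
     - r1 * (cl PQ * M 1 0 ^+ 2 + cm PQ * M 1 0 * M 1 1 + cn PQ * M 1 1 ^+ 2)
     - r2 * (2%:R * cl PQ * M 0 0 * M 1 0 + cm PQ * (M 0 0 * M 1 1 + M 1 0 * M 0 1)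
             + 2%:R * cn PQ * M 0 1 * M 1 1) - 2%:R * r1 * r2)) *: 'X +
  (mu ^+ 2 * (ca PQ * M 1 0 ^+ 4 + cb PQ * M 1 0 ^+ 3 * M 1 1 + cc PQ * M 1 0 ^+ 2 * M 1 1 ^+ 2
     + cd PQ * M 1 0 * M 1 1 ^+ 3 + ce PQ * M 1 1 ^+ 4
     - r2 * (cl PQ * M 1 0 ^+ 2 + cm PQ * M 1 0 * M 1 1 + cn PQ * M 1 1 ^+ 2) - r2 ^+ 2))%:P.
Proof.
rewrite /cl /cm /cn /ca /cb /cc /cd /ce /transform /= form_subst2E form_subst4E.
rewrite /rpoly -!mul_polyC; ring.
Qed.

Lemma clE M mu r0 r1 r2 PQ : cl (transform M mu r0 r1 r2 PQ) =
  mu * (cl PQ * M 0 0 ^+ 2 + cm PQ * M 0 0 * M 0 1 + cn PQ * M 0 1 ^+ 2 + 2%:R * r0).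
Proof. by rewrite {1}/cl transform1E !coefE /= !(mulr0, mulr1, add0r, addr0). Qed.

Lemma cmE M mu r0 r1 r2 PQ : cm (transform M mu r0 r1 r2 PQ) =
  mu * (2%:R * cl PQ * M 0 0 * M 1 0 + cm PQ * (M 0 0 * M 1 1 + M 1 0 * M 0 1)
        + 2%:R * cn PQ * M 0 1 * M 1 1 + 2%:R * r1).
Proof. by rewrite {1}/cm transform1E !coefE /= !(mulr0, mulr1, add0r, addr0). Qed.

Lemma cnE M mu r0 r1 r2 PQ : cn (transform M mu r0 r1 r2 PQ) =
  mu * (cl PQ * M 1 0 ^+ 2 + cm PQ * M 1 0 * M 1 1 + cn PQ * M 1 1 ^+ 2 + 2%:R * r2).
Proof. by rewrite {1}/cn transform1E !coefE /= !(mulr0, mulr1, add0r, addr0). Qed.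

Lemma caE M mu r0 r1 r2 PQ : ca (transform M mu r0 r1 r2 PQ) =
  mu ^+ 2 * (ca PQ * M 0 0 ^+ 4 + cb PQ * M 0 0 ^+ 3 * M 0 1 + cc PQ * M 0 0 ^+ 2 * M 0 1 ^+ 2
     + cd PQ * M 0 0 * M 0 1 ^+ 3 + ce PQ * M 0 1 ^+ 4
     - r0 * (cl PQ * M 0 0 ^+ 2 + cm PQ * M 0 0 * M 0 1 + cn PQ * M 0 1 ^+ 2) - r0 ^+ 2).
Proof. by rewrite {1}/ca transform2E !coefE /= !(mulr0, mulr1, add0r, addr0). Qed.

Lemma cbE M mu r0 r1 r2 PQ : cb (transform M mu r0 r1 r2 PQ) =
  mu ^+ 2 * (4%:R * ca PQ * M 0 0 ^+ 3 * M 1 0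
     + cb PQ * (M 0 0 ^+ 3 * M 1 1 + 3%:R * M 0 0 ^+ 2 * M 1 0 * M 0 1)
     + cc PQ * (2%:R * M 0 0 * M 1 0 * M 0 1 ^+ 2 + 2%:R * M 0 0 ^+ 2 * M 0 1 * M 1 1)
     + cd PQ * (M 1 0 * M 0 1 ^+ 3 + 3%:R * M 0 0 * M 0 1 ^+ 2 * M 1 1)
     + 4%:R * ce PQ * M 0 1 ^+ 3 * M 1 1
     - r0 * (2%:R * cl PQ * M 0 0 * M 1 0 + cm PQ * (M 0 0 * M 1 1 + M 1 0 * M 0 1)
             + 2%:R * cn PQ * M 0 1 * M 1 1)
     - r1 * (cl PQ * M 0 0 ^+ 2 + cm PQ * M 0 0 * M 0 1 + cn PQ * M 0 1 ^+ 2) - 2%:R * r0 * r1).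
Proof. by rewrite {1}/cb transform2E !coefE /= !(mulr0, mulr1, add0r, addr0). Qed.

Lemma ccE M mu r0 r1 r2 PQ : cc (transform M mu r0 r1 r2 PQ) =
  mu ^+ 2 * (6%:R * ca PQ * M 0 0 ^+ 2 * M 1 0 ^+ 2
     + cb PQ * (3%:R * M 0 0 ^+ 2 * M 1 0 * M 1 1 + 3%:R * M 0 0 * M 1 0 ^+ 2 * M 0 1)
     + cc PQ * (M 0 0 ^+ 2 * M 1 1 ^+ 2 + M 1 0 ^+ 2 * M 0 1 ^+ 2
                + 4%:R * M 0 0 * M 1 0 * M 0 1 * M 1 1)
     + cd PQ * (3%:R * M 0 0 * M 0 1 * M 1 1 ^+ 2 + 3%:R * M 1 0 * M 0 1 ^+ 2 * M 1 1)
     + 6%:R * ce PQ * M 0 1 ^+ 2 * M 1 1 ^+ 2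
     - r0 * (cl PQ * M 1 0 ^+ 2 + cm PQ * M 1 0 * M 1 1 + cn PQ * M 1 1 ^+ 2)
     - r1 * (2%:R * cl PQ * M 0 0 * M 1 0 + cm PQ * (M 0 0 * M 1 1 + M 1 0 * M 0 1)
             + 2%:R * cn PQ * M 0 1 * M 1 1)
     - r2 * (cl PQ * M 0 0 ^+ 2 + cm PQ * M 0 0 * M 0 1 + cn PQ * M 0 1 ^+ 2)
     - r1 ^+ 2 - 2%:R * r0 * r2).
Proof. by rewrite {1}/cc transform2E !coefE /= !(mulr0, mulr1, add0r, addr0). Qed.

Lemma cdE M mu r0 r1 r2 PQ : cd (transform M mu r0 r1 r2 PQ) =
  mu ^+ 2 * (4%:R * ca PQ * M 0 0 * M 1 0 ^+ 3
     + cb PQ * (M 1 0 ^+ 3 * M 0 1 + 3%:R * M 0 0 * M 1 0 ^+ 2 * M 1 1)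
     + cc PQ * (2%:R * M 0 0 * M 1 0 * M 1 1 ^+ 2 + 2%:R * M 1 0 ^+ 2 * M 0 1 * M 1 1)
     + cd PQ * (M 0 0 * M 1 1 ^+ 3 + 3%:R * M 1 0 * M 0 1 * M 1 1 ^+ 2)
     + 4%:R * ce PQ * M 0 1 * M 1 1 ^+ 3
     - r1 * (cl PQ * M 1 0 ^+ 2 + cm PQ * M 1 0 * M 1 1 + cn PQ * M 1 1 ^+ 2)
     - r2 * (2%:R * cl PQ * M 0 0 * M 1 0 + cm PQ * (M 0 0 * M 1 1 + M 1 0 * M 0 1)
             + 2%:R * cn PQ * M 0 1 * M 1 1) - 2%:R * r1 * r2).
Proof. by rewrite {1}/cd transform2E !coefE /= !(mulr0, mulr1, add0r, addr0). Qed.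

Lemma ceE M mu r0 r1 r2 PQ : ce (transform M mu r0 r1 r2 PQ) =
  mu ^+ 2 * (ca PQ * M 1 0 ^+ 4 + cb PQ * M 1 0 ^+ 3 * M 1 1 + cc PQ * M 1 0 ^+ 2 * M 1 1 ^+ 2
     + cd PQ * M 1 0 * M 1 1 ^+ 3 + ce PQ * M 1 1 ^+ 4
     - r2 * (cl PQ * M 1 0 ^+ 2 + cm PQ * M 1 0 * M 1 1 + cn PQ * M 1 1 ^+ 2) - r2 ^+ 2).
Proof. by rewrite {1}/ce transform2E !coefE /= !(mulr0, mulr1, add0r, addr0). Qed.

Definition transformE := (clE, cmE, cnE, caE, cbE, ccE, cdE, ceE).

Lemma ysubE r0 r1 r2 PQ (A := transform 1%:M 1 r0 r1 r2 PQ) :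
  (cl A = cl PQ + 2%:R * r0) * (cm A = cm PQ + 2%:R * r1) *
  (cn A = cn PQ + 2%:R * r2) * (ca A = ca PQ - r0 * cl PQ - r0 ^+ 2) *
  (cb A = cb PQ - r0 * cm PQ - r1 * cl PQ - 2%:R * r0 * r1) *
  (cc A = cc PQ - r0 * cn PQ - r1 * cm PQ - r2 * cl PQ - r1 ^+ 2 - 2%:R * r0 * r2) *
  (cd A = cd PQ - r1 * cn PQ - r2 * cm PQ - 2%:R * r1 * r2) *
  (ce A = ce PQ - r2 * cn PQ - r2 ^+ 2).
Proof. by rewrite /A !transformE scalar_mx2 !mx2E; do !split; ring. Qed.

Lemma wf_transform M mu r0 r1 r2 PQ : wf_model (transform M mu r0 r1 r2 PQ).
Proof.
split; apply/leq_sizeP => j hj; rewrite ?transform1E ?transform2E !coefE.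
  by case: j hj => [|[|[|j]]] //= _; rewrite !mulr0 !addr0.
by case: j hj => [|[|[|[|[|j]]]]] //= _; rewrite !mulr0 !addr0.
Qed.

Lemma model_eq A B : wf_model A -> wf_model B ->
  cl A = cl B -> cm A = cm B -> cn A = cn B -> ca A = ca B -> cb A = cb B ->
  cc A = cc B -> cd A = cd B -> ce A = ce B -> A = B.
Proof.
case: A B => [P Q] [P' Q'] [/= hP hQ] [/= hP' hQ'] h2 h1 h0 g4 g3 g2 g1 g0.
congr (_, _); apply/polyP.
  by case=> [|[|[|j]]] //; rewrite !nth_default // (leq_trans _ (isT : 3 <= j.+3)%N).
by case=> [|[|[|[|[|j]]]]] //; rewrite !nth_default // (leq_trans _ (isT : 5 <= j.+4.+1)%N).
Qed.
End Transform.

Section TransformField.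
Variable K : fieldType.
Implicit Types (PQ A B : model K) (M N : 'M[K]_2) (W : weier K).

Lemma transform_comp M N mu nu r0 r1 r2 s0 s1 s2 PQ : mu != 0 ->
  transform N nu s0 s1 s2 (transform M mu r0 r1 r2 PQ) =
  transform (N *m M) (nu * mu)
    (r0 * N 0 0 ^+ 2 + r1 * N 0 0 * N 0 1 + r2 * N 0 1 ^+ 2 + s0 / mu)
    (2%:R * r0 * N 0 0 * N 1 0 + r1 * (N 0 0 * N 1 1 + N 1 0 * N 0 1)
     + 2%:R * r2 * N 0 1 * N 1 1 + s1 / mu)
    (r0 * N 1 0 ^+ 2 + r1 * N 1 0 * N 1 1 + r2 * N 1 1 ^+ 2 + s2 / mu) PQ.
Proof.
(* Writing each $s_i$ as a multiple of [mu] clears the denominators, so that [ring] can decide the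
   eight identities. *)
move=> nmu; have e x : exists y, x = y * mu by exists (x / mu); rewrite divfK.
have [{}s0 ->] := e s0; have [{}s1 ->] := e s1; have [{}s2 ->] := e s2.
rewrite !mulfK //.
apply: model_eq; try exact: wf_transform; rewrite !transformE !mulmx2E.
all: move: (M 0 0) (M 0 1) (M 1 0) (M 1 1) (N 0 0) (N 0 1) (N 1 0) (N 1 1)
  (cl PQ) (cm PQ) (cn PQ) (ca PQ) (cb PQ) (cc PQ) (cd PQ) (ce PQ).
all: clear; move=> *; ring.
Qed.

Lemma det_mx2 M : \det M = M 0 0 * M 1 1 - M 0 1 * M 1 0.
Proof.
rewrite (expand_det_row _ 0) !big_ord_recl big_ord0 addr0 /cofactor !det_mx11 !mxE.
have -> : lift ord0 ord0 = 1 :> 'I_2 by apply/val_inj.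
have -> : lift 1 0 = 0 :> 'I_2 by apply/val_inj.
rewrite !add0n -[(-1) ^+ ord0]/(1 : K) -[(-1) ^+ (1%R : 'I_2)]/(-1 : K).
by rewrite mul1r mulN1r mulrN.
Qed.

End TransformField.

(** * The Jacobian of a transformed model *)

Section TransformField.
Variable K : fieldType.
Implicit Types (PQ A B : model K) (M N : 'M[K]_2) (W : weier K).

Lemma wtransform_comp u r s t u' r' s' t' W : u != 0 -> u' != 0 ->
  wtransform u' r' s' t' (wtransform u r s t W) =
  wtransform (u * u') (u ^+ 2 * r' + r) (u * s' + s)
    (u ^+ 3 * t' + u ^+ 2 * r' * s + t) W.
Proof.
by case: W => a1 a2 a3 a4 a6 nu nu'; rewrite /wtransform /=; congr Weier; field;
  rewrite nu nu'.
Qed.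

Lemma wtransform_id W : wtransform 1 0 0 0 W = W.
Proof.
by case: W => a1 a2 a3 a4 a6; rewrite /wtransform /= !expr1n !divr1; congr Weier; ring.
Qed.

Lemma wtransform_inv u r s t W : u != 0 ->
  wtransform u^-1 (- r / u ^+ 2) (- s / u) ((r * s - t) / u ^+ 3)
    (wtransform u r s t W) = W.
Proof.
move=> nu; rewrite wtransform_comp ?invr_eq0 // -[RHS]wtransform_id.
by congr wtransform; field.
Qed.

Lemma wdisc_wtransform u r s t W : u != 0 ->
  wdisc W = u ^+ 12 * wdisc (wtransform u r s t W).
Proof.
by case: W => a1 a2 a3 a4 a6 nu; rewrite /wdisc /wtransform /=; field.
Qed.

(* [jacobian_rel x PQ PQ']: the Jacobians are related by a change of coordinates
   whose scaling factor is [x^-1] up to sign. *)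
Definition jacobian_rel (x : K) PQ PQ' := exists u r s t : K,
  (x * u) ^+ 2 = 1 /\ jacobian PQ' = wtransform u r s t (jacobian PQ).

Lemma jacobian_rel_comp x y PQ1 PQ2 PQ3 :
  jacobian_rel x PQ1 PQ2 -> jacobian_rel y PQ2 PQ3 -> jacobian_rel (y * x) PQ1 PQ3.
Proof.
move=> [u [r [s [t [hu e]]]]] [u' [r' [s' [t' [hu' e']]]]].
rewrite /jacobian_rel e' e.
have nz (z w : K) : (z * w) ^+ 2 = 1 -> w != 0.
  by move=> h; apply: contra_eq_neq h => ->; rewrite mulr0 expr0n eq_sym oner_neq0.
rewrite wtransform_comp ?(nz x u hu) ?(nz y u' hu') //; do 4!eexists; split; last by [].
have -> : y * x * (u * u') = x * u * (y * u') by ring.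
by rewrite exprMn hu hu' mulr1.
Qed.

Lemma jacobian_rel_ysub r0 r1 r2 PQ :
  jacobian_rel 1 PQ (transform 1%:M 1 r0 r1 r2 PQ).
Proof.
(* For generic coefficients $s$, $r$ and $t$ are forced in turn by the formulas for $a_1$, $a_2$ and
   $a_3$; those for $a_4$ and $a_6$ are then identities. *)
exists 1, (- (r0 * cn PQ + r2 * cl PQ + 2%:R * r0 * r2)), r1,
 (r2 * cb PQ + r0 * cd PQ - r1 * cl PQ * cn PQ - 2%:R * r0 * r1 * cn PQ
  - 2%:R * r1 * r2 * cl PQ - r0 * r2 * cm PQ - 4%:R * r0 * r1 * r2).
split; first by rewrite mulr1 expr1n.
rewrite /jacobian /wtransform /= !transformE scalar_mx2 !mx2E !expr1n !divr1.
by congr Weier; ring.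
Qed.

Lemma jacobian_rel_scale mu PQ : mu != 0 ->
  jacobian_rel mu PQ (transform 1%:M mu 0 0 0 PQ).
Proof.
move=> nmu; exists mu^-1, 0, 0, 0; split; first by rewrite divff ?expr1n.
rewrite /jacobian /wtransform /= !transformE scalar_mx2 !mx2E.
by congr Weier; field; rewrite nmu oner_neq0.
Qed.

Lemma jacobian_rel_shear k PQ :
  jacobian_rel 1 PQ (transform (mx2 1 0 k 1) 1 0 0 0 PQ).
Proof.
exists 1, (k * cb PQ + 2%:R * k ^+ 2 * ca PQ), (k * cl PQ),
 (2%:R * k * ca PQ * cn PQ + k ^+ 2 * ca PQ * cm PQ + 2%:R * k ^+ 2 * cl PQ * cb PQ
  + 4%:R * k ^+ 3 * ca PQ * cl PQ + k * cl PQ * cc PQ).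
split; first by rewrite mulr1 expr1n.
rewrite /jacobian /wtransform /= !transformE !mx2E !expr1n !divr1.
by congr Weier; ring.
Qed.

Lemma jacobian_rel_diag p q PQ : p != 0 -> q != 0 ->
  jacobian_rel (p * q) PQ (transform (mx2 p 0 0 q) 1 0 0 0 PQ).
Proof.
move=> np nq; exists (p * q)^-1, 0, 0, 0; split.
  by rewrite divff ?expr1n ?mulf_neq0.
rewrite /jacobian /wtransform /= !transformE !mx2E.
by congr Weier; field; rewrite ?oner_neq0 np nq.
Qed.

(** The formulas for the Jacobian are symmetric under exchanging $x$ and $z$, so $u=1$ although the
    determinant is $-1$: this is the sign that [jacobian_rel] leaves open. *)
Lemma jacobian_rel_swap PQ :
  jacobian_rel (- 1) PQ (transform (mx2 0 1 1 0) 1 0 0 0 PQ).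
Proof.
exists 1, 0, 0, 0; split; first by rewrite mulr1 sqrrN expr1n.
rewrite /jacobian /wtransform /= !transformE !mx2E !expr1n !divr1.
by congr Weier; ring.
Qed.

Lemma transform_mulmx M N PQ :
  transform (N *m M) 1 0 0 0 PQ = transform N 1 0 0 0 (transform M 1 0 0 0 PQ).
Proof.
rewrite transform_comp ?oner_neq0 //.
by rewrite !(mul0r, mulr0, addr0, mulr1).
Qed.

(** Gaussian elimination. If the top left entry is nonzero, the matrix is a lower shear times a
    diagonal matrix times an upper shear, and the upper shear is a lower one conjugated by the swap.
    Otherwise the rows are swapped first. *)
Lemma jacobian_rel_linear M PQ : \det M != 0 ->
  jacobian_rel (\det M) PQ (transform M 1 0 0 0 PQ).
Proof.
have nz p q s t : p != 0 -> p * t - q * s != 0 ->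
    jacobian_rel (p * t - q * s) PQ (transform (mx2 p q s t) 1 0 0 0 PQ).
  move=> np nd.
  have -> : mx2 p q s t = mx2 1 0 (s / p) 1 *m (mx2 p 0 0 (t - s * q / p)
             *m (mx2 0 1 1 0 *m (mx2 1 0 (q / p) 1 *m mx2 0 1 1 0))).
    by apply: mx2_eq; rewrite !mulmx2E !mx2E; field.
  rewrite !transform_mulmx.
  have -> : p * t - q * s = 1 * (p * (t - s * q / p) * (- 1 * (1 * - 1))) by field.
  have h1 := jacobian_rel_comp (jacobian_rel_comp (jacobian_rel_swap PQ)
               (jacobian_rel_shear (q / p) _)) (jacobian_rel_swap _).
  apply: jacobian_rel_comp (jacobian_rel_shear _ _).
  apply: jacobian_rel_comp h1 (jacobian_rel_diag _ np _).
  apply: contra_neq nd => e.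
  have -> : p * t - q * s = p * (t - s * q / p) by field.
  by rewrite e mulr0.
rewrite det_mx2 => nd.
have eM : M = mx2 (M 0 0) (M 0 1) (M 1 0) (M 1 1) by apply: mx2_eq; rewrite !mx2E.
case: (eqVneq (M 0 0) 0) => n00; last by rewrite eM !mx2E; exact: nz.
have -> : M = mx2 0 1 1 0 *m mx2 (M 1 0) (M 1 1) (M 0 0) (M 0 1).
  by apply: mx2_eq; rewrite !mulmx2E !mx2E; ring.
rewrite transform_mulmx !mulmx2E !mx2E.
have -> : (0 * M 1 0 + 1 * M 0 0) * (1 * M 1 1 + 0 * M 0 1)
   - (0 * M 1 1 + 1 * M 0 1) * (1 * M 1 0 + 0 * M 0 0) =
   - 1 * (M 1 0 * M 0 1 - M 1 1 * M 0 0) by ring.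
apply: jacobian_rel_comp (jacobian_rel_swap _); apply: nz.
  by apply: contra_neq nd => ->; rewrite n00; ring.
by apply: contra_neq nd => e; rewrite -[RHS]oppr0 -[in RHS]e; ring.
Qed.

Lemma jacobian_rel_transform M mu r0 r1 r2 PQ : \det M != 0 -> mu != 0 ->
  jacobian_rel (mu * \det M) PQ (transform M mu r0 r1 r2 PQ).
Proof.
move=> nd nmu.
have -> : transform M mu r0 r1 r2 PQ =
  transform 1%:M mu 0 0 0 (transform 1%:M 1 r0 r1 r2 (transform M 1 0 0 0 PQ)).
  rewrite !transform_comp ?mulr1 ?oner_neq0 // !mul1mx.
  by rewrite !scalar_mx2 !mx2E !(mul0r, mulr0, expr1n, expr0n, addr0, add0r, mulr1, divr1).
have := jacobian_rel_comp (jacobian_rel_comp (jacobian_rel_linear PQ nd)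
  (jacobian_rel_ysub r0 r1 r2 _)) (jacobian_rel_scale _ nmu).
by rewrite mul1r.
Qed.

Lemma jacobian_rel_disc x PQ PQ' : jacobian_rel x PQ PQ' ->
  discPQ PQ' = x ^+ 12 * discPQ PQ.
Proof.
move=> [u [r [s [t [hu e]]]]]; have nu : u != 0.
  by apply: contra_eq_neq hu => ->; rewrite mulr0 expr0n eq_sym oner_neq0.
rewrite !disc_jacobian e (wdisc_wtransform r s t (jacobian PQ) nu) mulrA -exprMn.
by rewrite (exprM _ 2 6) hu expr1n mul1r.
Qed.
End TransformField.

(** * Non-minimal Weierstrass equations in residue characteristic 2 *)

Section NonminimalWeierstrass.
Variables (K : fieldType) (v : dvaluation K).
Hypothesis h2 : vgeb v 1 2%:R.

Lemma vunit3 : vunit v 3%:R.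
Proof.
apply: vunitI; first vtac.
apply: contra (vgeb1_unit v) => h3; vring (3%:R - 2%:R : K).
Qed.

(** The only form in which positive level is used: some integral equation is reached with $\pi\mid
    u$. No minimal discriminant is mentioned, so it passes easily to equivalent models. *)
Definition nonminimal_weier (W : weier K) : Prop :=
  exists u r s t, u != 0 /\ vgeb v 1 u /\ w_integral v (wtransform u r s t W).

Section Relations.
Variables a1 a2 a3 a4 a6 : K.
Hypotheses (h1 : vgeb v 0 a1) (h2' : vgeb v 0 a2) (h3 : vgeb v 0 a3)
  (h4 : vgeb v 0 a4) (h6 : vgeb v 0 a6).
Hypothesis nmin : nonminimal_weier (Weier a1 a2 a3 a4 a6).

(** Clearing the powers of $u$ turns integrality of the new coefficients into congruences. The work
    is to show that $r$, $s$, $t$ are integral: $r$ is a root of a quartic, after which the formulas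
    for $a_2$ and $a_6$ are monic quadratics in $s$ and $t$. *)
Lemma nonminimal_weier_relations : exists r s t : K,
  [/\ vgeb v 0 r, vgeb v 0 s & vgeb v 0 t] /\
  [/\ vgeb v 1 (a1 + 2%:R * s),
      vgeb v 2 (a2 - s * a1 + 3%:R * r - s ^+ 2),
      vgeb v 3 (a3 + r * a1 + 2%:R * t),
      vgeb v 4 (a4 - s * a3 + 2%:R * r * a2 - (t + r * s) * a1 + 3%:R * r ^+ 2
          - 2%:R * s * t)
    & vgeb v 6 (a6 + r * a4 + r ^+ 2 * a2 + r ^+ 3 - t * a3 - t ^+ 2 - r * t * a1)].
Proof.
case: nmin => u [r [s [t [nu [hu [/vgeP k1 [/vgeP k2 [/vgeP k3 [/vgeP k4 /vgeP k6]]]]]]]]].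
have sc n x : vgeb v 0 (x / u ^+ n) -> vgeb v n x.
  move=> h; rewrite -[x](divfK (expf_neq0 n nu)).
  by have := vgebM h (vgebX n hu); rewrite muln1.
have {}k1 := sc 1%N _ k1; have {}k2 := sc _ _ k2; have {}k3 := sc _ _ k3.
have {}k4 := sc _ _ k4; have {}k6 := sc _ _ k6.
move: k1 k2 k3 k4 k6 => /=.
set n1 := a1 + _; set n2 := a2 - _ + _ - _; set n3 := a3 + _ + _.
set n4 := a4 - _ + _ - _ + _ - _; set n6 := a6 + _ + _ + _ - _ - _ - _.
move=> k1 k2 k3 k4 k6; exists r, s, t; split=> //.
have i3 := vunit_ge0 (vunitV vunit3).
have hr : vgeb v 0 r.
  (* The invariant $b_8$ satisfies $u^8b_8' = b_8+3rb_6+3r^2b_4+r^3b_2+3r^4$. The leading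
     coefficient 3 is a unit in residue characteristic 2. *)
  pose b8 x1 x2 x3 x4 x6 : K := x1 ^+ 2 * x6 + 4%:R * x2 * x6 - x1 * x3 * x4
    + x2 * x3 ^+ 2 - x4 ^+ 2.
  apply: (@vgeb_monic_root K v (3%:R^-1 * (b8 a1 a2 a3 a4 a6 - b8 n1 n2 n3 n4 n6))
    (a3 ^+ 2 + 4%:R * a6) (2%:R * a4 + a1 * a3) (3%:R^-1 * (a1 ^+ 2 + 4%:R * a2))).
  - by rewrite /b8; vtac.
  - vtac.
  - vtac.
  - vtac.
  rewrite /b8 /n1 /n2 /n3 /n4 /n6; field.
  exact: vunit_neq0 vunit3.
split=> //.
  apply: (@vgeb_monic_root2 K v (n2 - a2 - 3%:R * r) a1) => //; first vtac.
  by rewrite /n2; ring.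
apply: (@vgeb_monic_root2 K v (n6 - a6 - r * a4 - r ^+ 2 * a2 - r ^+ 3) (a3 + r * a1)).
- vtac.
- vtac.
- by rewrite /n6; ring.
Qed.

Lemma nonminimal_weier_a1 : vgeb v 1 a1.
Proof.
have [r [s [t [[hr hs ht] [e1 _ _ _ _]]]]] := nonminimal_weier_relations.
vring (a1 + 2%:R * s - 2%:R * s).
Qed.

Lemma nonminimal_weier_a3 : vgeb v 1 a3.
Proof.
have k1 := nonminimal_weier_a1.
have [r [s [t [[hr hs ht] [_ _ e3 _ _]]]]] := nonminimal_weier_relations.
vring (a3 + r * a1 + 2%:R * t - r * a1 - 2%:R * t).
Qed.

(* Tate's algorithm does not stop at type II. *)
Lemma nonminimal_weier_pi2 : vgeb v 1 a4 -> vgeb v 1 a6 ->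
  [/\ vgeb v 2 a3, vgeb v 2 a4 & vgeb v 2 a6].
Proof.
move=> k4 k6; have k1 := nonminimal_weier_a1; have k3 := nonminimal_weier_a3.
have [r [s [t [[hr hs ht] [_ _ e3 e4 e6]]]]] := nonminimal_weier_relations.
(* The singular point of the reduction is already at the origin: mod $\pi$ the condition on $a_4$
   becomes $3r^2\equiv0$, and then the one on $a_6$ becomes $t^2\equiv0$. *)
have kr : vgeb v 1 r.
  apply: (vgeb_sqr_odd (k := 0)); apply: (vgeb_mull_unit (vunit_ge1 vunit3)).
  vring ((a4 - s * a3 + 2%:R * r * a2 - (t + r * s) * a1 + 3%:R * r ^+ 2
          - 2%:R * s * t) - (a4 - s * a3 + 2%:R * r * a2 - (t + r * s) * a1
          - 2%:R * s * t)).
have kt : vgeb v 1 t.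
  apply: (vgeb_sqr_odd (k := 0)).
  vring (a6 + r * a4 + r ^+ 2 * a2 + r ^+ 3 - t * a3 - r * t * a1 -
    (a6 + r * a4 + r ^+ 2 * a2 + r ^+ 3 - t * a3 - t ^+ 2 - r * t * a1)).
have k3' : vgeb v 2 a3 by vring (a3 + r * a1 + 2%:R * t - r * a1 - 2%:R * t).
split=> //.
- vring ((a4 - s * a3 + 2%:R * r * a2 - (t + r * s) * a1 + 3%:R * r ^+ 2
          - 2%:R * s * t) - (- s * a3 + 2%:R * r * a2 - (t + r * s) * a1
          + 3%:R * r ^+ 2 - 2%:R * s * t)).
- vring ((a6 + r * a4 + r ^+ 2 * a2 + r ^+ 3 - t * a3 - t ^+ 2 - r * t * a1) -
    (r * a4 + r ^+ 2 * a2 + r ^+ 3 - t * a3 - t ^+ 2 - r * t * a1)).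
Qed.

(* Tate's algorithm reaches the cubic [T^3 + a2/pi T^2 + a4/pi^2 T + a6/pi^3]
   and finds a triple root. *)
Lemma nonminimal_weier_triple :
  vgeb v 1 a2 -> vgeb v 2 a3 -> vgeb v 2 a4 -> vgeb v 3 a6 ->
  vgeb v 3 (a4 - a2 ^+ 2) /\ vgeb v 4 (a6 - a2 * a4).
Proof.
move=> k2 k3 k4 k6; have k1 := nonminimal_weier_a1.
have [r [s [t [[hr hs ht] [_ e2 _ e4 e6]]]]] := nonminimal_weier_relations.
have kr : vgeb v 1 r.
  apply: (vgeb_sqr_odd (k := 0)); apply: (vgeb_mull_unit (vunit_ge1 vunit3)).
  vring ((a4 - s * a3 + 2%:R * r * a2 - (t + r * s) * a1 + 3%:R * r ^+ 2
          - 2%:R * s * t) - (a4 - s * a3 + 2%:R * r * a2 - (t + r * s) * a1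
          - 2%:R * s * t)).
have ks : vgeb v 1 s.
  apply: (vgeb_sqr_odd (k := 0)).
  vring (a2 - s * a1 + 3%:R * r - (a2 - s * a1 + 3%:R * r - s ^+ 2)).
have kt : vgeb v 2 t.
  apply: (vgeb_sqr_odd (k := 1)).
  have kt1 : vgeb v 1 t.
    apply: (vgeb_sqr_odd (k := 0)).
    vring (a6 + r * a4 + r ^+ 2 * a2 + r ^+ 3 - t * a3 - r * t * a1 -
      (a6 + r * a4 + r ^+ 2 * a2 + r ^+ 3 - t * a3 - t ^+ 2 - r * t * a1)).
  vring (a6 + r * a4 + r ^+ 2 * a2 + r ^+ 3 - t * a3 - r * t * a1 -
    (a6 + r * a4 + r ^+ 2 * a2 + r ^+ 3 - t * a3 - t ^+ 2 - r * t * a1)).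
(* Since $3\equiv1$ and signs do not matter mod 2, the cubic is $(T+r/\pi)^3$, that is $a_2\equiv
   r$, $a_4\equiv r^2$, $a_6\equiv r^3$ to the relevant precision. Eliminating $r$ gives the
   claim. *)
have f2 : vgeb v 2 (a2 - r).
  vring (a2 - s * a1 + 3%:R * r - s ^+ 2 + s * a1 + s ^+ 2 - 2%:R * 2%:R * r).
have f4 : vgeb v 3 (a4 - r ^+ 2).
  vring ((a4 - s * a3 + 2%:R * r * a2 - (t + r * s) * a1 + 3%:R * r ^+ 2
          - 2%:R * s * t) - (- s * a3 + 2%:R * r * a2 - (t + r * s) * a1
          + 2%:R * 2%:R * r ^+ 2 - 2%:R * s * t)).
have f6 : vgeb v 4 (a6 - r ^+ 3).
  vring ((a6 + r * a4 + r ^+ 2 * a2 + r ^+ 3 - t * a3 - t ^+ 2 - r * t * a1) -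
    (r * (a4 - r ^+ 2) + r ^+ 2 * (a2 - r) + 2%:R * 2%:R * r ^+ 3 - t * a3 - t ^+ 2
     - r * t * a1)).
split.
- vring (a4 - r ^+ 2 - (a2 - r) * (a2 + r)).
- vring (a6 - r ^+ 3 - (a2 - r) * a4 - r * (a4 - r ^+ 2)).
Qed.
End Relations.

End NonminimalWeierstrass.

(** * Integral equivalence and level *)

Section IntegralModels.
Variables (K : fieldType) (v : dvaluation K).
Implicit Types (PQ A B : model K) (M N : 'M[K]_2).

Definition Pge k PQ := [&& vgeb v k (cl PQ), vgeb v k (cm PQ) & vgeb v k (cn PQ)].
Definition Qge k PQ := [&& vgeb v k (ca PQ), vgeb v k (cb PQ), vgeb v k (cc PQ),
  vgeb v k (cd PQ) & vgeb v k (ce PQ)].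

Lemma PgeP k PQ : wf_model PQ -> reflect (form_vge v PQ.1 k%:Z) (Pge k PQ).
Proof.
move=> [hP _]; apply: (iffP and3P) => [[h2 h1 h0] i|h].
  case: i => [|[|[|i]]]; [exact/vgeP|exact/vgeP|exact/vgeP|left].
  by rewrite nth_default // (leq_trans hP).
by split; apply/vgeP; exact: h.
Qed.

Lemma QgeP k PQ : wf_model PQ -> reflect (form_vge v PQ.2 k%:Z) (Qge k PQ).
Proof.
move=> [_ hQ]; apply: (iffP and5P) => [[h4 h3 h2 h1 h0] i|h].
  case: i => [|[|[|[|[|i]]]]]; [exact/vgeP|exact/vgeP|exact/vgeP|exact/vgeP|exact/vgeP|left].
  by rewrite nth_default // (leq_trans hQ).
by split; apply/vgeP; exact: h.
Qed.

Definition integralb PQ := Pge 0 PQ && Qge 0 PQ.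

Lemma integralP PQ : wf_model PQ -> reflect (integral v PQ) (integralb PQ).
Proof.
move=> wf; apply: (iffP andP) => [[/(PgeP _ wf) hP /(QgeP _ wf) hQ]|[hP hQ]] //.
by split; [apply/(PgeP _ wf)|apply/(QgeP _ wf)].
Qed.

Lemma GL2OP M : GL2O v M <->
  [/\ vgeb v 0 (M 0 0), vgeb v 0 (M 0 1), vgeb v 0 (M 1 0), vgeb v 0 (M 1 1)
    & vunit v (\det M)].
Proof.
split=> [[h [nd e]]|[/vgeP h00 /vgeP h01 /vgeP h10 /vgeP h11 /andP[nd /eqP e]]].
  by split; try (apply/vgeP; exact: h); rewrite /vunit nd e.
split=> // i j.
have two (k : 'I_2) : k = 0 \/ k = 1.
  by case: k => [[|[|k]] hk] //; [left|right]; apply/val_inj.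
by case: (two i) => ->; case: (two j) => ->.
Qed.

Lemma GL2O_mul M N : GL2O v M -> GL2O v N -> GL2O v (M *m N).
Proof.
move=> /GL2OP[m00 m01 m10 m11 dm] /GL2OP[n00 n01 n10 n11 dn]; apply/GL2OP.
by rewrite !mulmx2E det_mulmx; split; try vtac; exact: vunitM.
Qed.

Lemma GL2O_unitmx M : GL2O v M -> M \in unitmx.
Proof. by case=> _ [nd _]; rewrite unitmxE unitfE. Qed.

Lemma invmx2E M : \det M != 0 -> invmx M =
  mx2 (M 1 1 / \det M) (- M 0 1 / \det M) (- M 1 0 / \det M) (M 0 0 / \det M).
Proof.
move=> nd; have uM : M \in unitmx by rewrite unitmxE unitfE.
rewrite -[RHS]mulmx1 -[in RHS](mulmxV uM) mulmxA.
set N := mx2 _ _ _ _; suff -> : N *m M = 1%:M by rewrite mul1mx.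
move: nd; rewrite /N det_mx2 scalar_mx2 => nd.
by apply: mx2_eq; rewrite !mulmx2E !mx2E; field.
Qed.

Lemma GL2O_inv M : GL2O v M -> GL2O v (invmx M).
Proof.
move=> /GL2OP[m00 m01 m10 m11 dm]; have nd := vunit_neq0 dm.
have hi := vunit_ge0 (vunitV dm).
apply/GL2OP; rewrite det_inv (vunitV dm) invmx2E // !mx2E; split=> //; vtac.
Qed.

Lemma GL2O1 : GL2O v 1%:M.
Proof.
apply/GL2OP; rewrite det1 scalar_mx2 !mx2E.
by rewrite vgeb0 (vgeb1 v) (vunit1 v).
Qed.

Hypothesis h2 : vgeb v 1 2%:R.

Definition oequiv PQ A := exists M mu r0 r1 r2,
  [/\ GL2O v M, vunit v mu, [/\ vgeb v 0 r0, vgeb v 0 r1 & vgeb v 0 r2]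
    & A = transform M mu r0 r1 r2 PQ].

Lemma oequiv_wf PQ A : oequiv PQ A -> wf_model A.
Proof. by move=> [M [mu [r0 [r1 [r2 [_ _ _ ->]]]]]]; exact: wf_transform. Qed.

Lemma transform_id PQ : wf_model PQ -> transform 1%:M 1 0 0 0 PQ = PQ.
Proof.
move=> wf; apply: model_eq => //; first exact: wf_transform.
all: rewrite !transformE scalar_mx2 !mx2E; ring.
Qed.

Lemma oequiv_integral PQ A : integralb PQ -> oequiv PQ A -> integralb A.
Proof.
move=> /andP[/and3P[hl hm hn] /and5P[ha hb hc hd he]].
move=> [M [mu [r0 [r1 [r2 [/GL2OP[m00 m01 m10 m11 _] /vunit_ge0 hmu [k0 k1 k2] ->]]]]]].
by apply/andP; split; [apply/and3P|apply/and5P]; split; rewrite !transformE; vtac.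
Qed.

Lemma oequiv_trans A PQ B : oequiv PQ A -> oequiv A B -> oequiv PQ B.
Proof.
move=> [M [mu [r0 [r1 [r2 [gM umu [k0 k1 k2] ->]]]]]].
move=> [N [nu [s0 [s1 [s2 [gN unu [l0 l1 l2] ->]]]]]].
rewrite transform_comp ?(vunit_neq0 umu) //.
have imu := vunit_ge0 (vunitV umu); have /GL2OP[n00 n01 n10 n11 _] := gN.
do 5!eexists; split; last by [].
- exact: GL2O_mul.
- exact: vunitM.
- by split; vtac.
Qed.

Lemma oequiv_sym PQ A : wf_model PQ -> oequiv PQ A -> oequiv A PQ.
Proof.
move=> wf [M [mu [r0 [r1 [r2 [gM umu [k0 k1 k2] ->]]]]]].
have gN := GL2O_inv gM; have /GL2OP[n00 n01 n10 n11 _] := gN.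
have nmu := vunit_neq0 umu; have hmu := vunit_ge0 umu.
set N := invmx M in gN n00 n01 n10 n11.
exists N, mu^-1,
  (- mu * (r0 * N 0 0 ^+ 2 + r1 * N 0 0 * N 0 1 + r2 * N 0 1 ^+ 2)),
  (- mu * (2%:R * r0 * N 0 0 * N 1 0 + r1 * (N 0 0 * N 1 1 + N 1 0 * N 0 1)
     + 2%:R * r2 * N 0 1 * N 1 1)),
  (- mu * (r0 * N 1 0 ^+ 2 + r1 * N 1 0 * N 1 1 + r2 * N 1 1 ^+ 2)).
split=> //; [exact: vunitV|by split; vtac|].
rewrite transform_comp // mulVmx ?(GL2O_unitmx gM) // mulVf //.
rewrite -{1}[PQ]transform_id //; congr transform; by field.
Qed.

Lemma yequivE PQ A : yequiv v PQ A <-> exists r0 r1 r2,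
  [/\ vgeb v 0 r0, vgeb v 0 r1, vgeb v 0 r2 & A = transform 1%:M 1 r0 r1 r2 PQ].
Proof.
split=> [[r0 [r1 [r2 [/vgeP ? [/vgeP ? [/vgeP ? ->]]]]]]|[r0 [r1 [r2 [h0 h1 k2 ->]]]]].
  by exists r0, r1, r2.
by exists r0, r1, r2; do !split => //; exact/vgeP.
Qed.

Lemma yequiv_oequiv PQ A : yequiv v PQ A -> oequiv PQ A.
Proof.
move=> /yequivE[r0 [r1 [r2 [h0 h1 k2 ->]]]].
by exists 1%:M, 1, r0, r1, r2; split=> //; [exact: GL2O1|exact: vunit1].
Qed.

Lemma linear_oequiv M PQ : GL2O v M -> oequiv PQ (transform M 1 0 0 0 PQ).
Proof.
move=> gM; exists M, 1, 0, 0, 0; split=> //; first exact: vunit1.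
by rewrite !vgeb0.
Qed.

End IntegralModels.

(** * Invariance of the level *)

Section Level.
Variables (K : fieldType) (v : dvaluation K).
Implicit Types (PQ A : model K).

Lemma oequiv_jacobian PQ A : oequiv v PQ A ->
  exists2 x, vunit v x & jacobian_rel x PQ A.
Proof.
move=> [M [mu [r0 [r1 [r2 [/GL2OP[_ _ _ _ dM] umu _ ->]]]]]].
exists (mu * \det M); first exact: vunitM.
by apply: jacobian_rel_transform; [exact: vunit_neq0 dM|exact: vunit_neq0 umu].
Qed.

Lemma jacobian_rel_unit x PQ A : vunit v x -> jacobian_rel x PQ A ->
  exists u r s t, vunit v u /\ jacobian A = wtransform u r s t (jacobian PQ).
Proof.
move=> ux [u [r [s [t [hu e]]]]]; exists u, r, s, t; split=> //.
have nu : u != 0.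
  by apply: contra_eq_neq hu => ->; rewrite mulr0 expr0n eq_sym oner_neq0.
have nx := vunit_neq0 ux; move: ux; rewrite /vunit nu nx /= => /eqP ux.
have := dvX v 2 (mulf_neq0 nx nu); rewrite hu dv1 dv_mul // ux; lia.
Qed.

Lemma nonminimal_weier_rel x PQ A : vunit v x -> jacobian_rel x PQ A ->
  nonminimal_weier v (jacobian PQ) -> nonminimal_weier v (jacobian A).
Proof.
move=> ux h; have [u [r [s [t [uu e]]]]] := jacobian_rel_unit ux h.
move=> [u' [r' [s' [t' [nu' [ku' i']]]]]]; have nu := vunit_neq0 uu.
rewrite -(wtransform_inv r s t (jacobian PQ) nu) -e wtransform_comp ?invr_eq0 // in i'.
do 4!eexists; split; last split; last exact: i'.
  by rewrite mulf_neq0 ?invr_eq0.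
by have := vgebM (vunit_ge0 (vunitV uu)) ku'.
Qed.

Lemma min_disc_val_rel x PQ A delta : vunit v x -> jacobian_rel x PQ A ->
  discPQ PQ != 0 ->
  min_disc_val v (jacobian PQ) delta -> min_disc_val v (jacobian A) delta.
Proof.
move=> ux h nd; have [u [r [s [t [uu e]]]]] := jacobian_rel_unit ux h.
have nu := vunit_neq0 uu.
move=> [[u' [r' [s' [t' [nu' [i' <-]]]]]] hmin]; split.
  rewrite -(wtransform_inv r s t (jacobian PQ) nu) -e in i' *.
  rewrite wtransform_comp ?invr_eq0 // in i' *.
  by do 4!eexists; split; [|split; [exact: i'|by []]]; rewrite mulf_neq0 ?invr_eq0.
move=> u1 r1 s1 t1 nu1; rewrite e wtransform_comp // => i1.
by apply: hmin => //; exact: mulf_neq0.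
Qed.

Lemma level_is_rel x PQ A lev : vunit v x -> jacobian_rel x PQ A ->
  discPQ PQ != 0 -> level_is v PQ lev -> level_is v A lev.
Proof.
move=> ux h nd [delta [hd e]]; exists delta; split.
  exact: min_disc_val_rel ux h nd hd.
have /andP[nx /eqP hx] := ux.
by rewrite (jacobian_rel_disc h) dv_mul ?expf_neq0 // dvX // hx mulr0 add0r.
Qed.

(** For the change of coordinates to a minimal equation, $v(\Delta)=12v(u)+\delta$; comparison with
    $v(\Delta)=\delta+12\,$[lev] gives $v(u)=$ [lev]. *)
Lemma level_nonminimal PQ lev : discPQ PQ != 0 -> 0 < lev -> level_is v PQ lev ->
  nonminimal_weier v (jacobian PQ).
Proof.
move=> nd hlev [delta [[[u [r [s [t [nu [iW <-]]]]]] _] e]].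
exists u, r, s, t; split=> //; split=> //.
have ed := wdisc_wtransform r s t (jacobian PQ) nu.
rewrite -disc_jacobian in ed; have nw : wdisc (wtransform u r s t (jacobian PQ)) != 0.
  by apply: contra_neq nd => w0; rewrite ed w0 mulr0.
move: e; rewrite {1}ed dv_mul ?expf_neq0 // dvX // => e.
by rewrite /vgeb; apply/orP; right; move: e hlev; lia.
Qed.

End Level.

(** * Non-minimal models *)

Section Nonminimal.
Variables (K : fieldType) (v : dvaluation K).
Implicit Types (PQ A B : model K) (M N U V : 'M[K]_2).

Lemma vgeb_total (x y : K) : (x != 0) || (y != 0) ->
  (y != 0) && vgeb v 0 (x / y) || (x != 0) && vgeb v 0 (y / x).
Proof.
rewrite /vgeb !mulf_eq0 !invr_eq0.
case: (eqVneq x 0) => [->|nx]; case: (eqVneq y 0) => [->|ny] //= _.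
by rewrite !dv_mul ?invr_eq0 // !dvV //; lia.
Qed.

(** The entries of [M] lie in $K$, so only the quotient of the diagonal entries is required to be
    integral. Their order makes the substitution $x\leftarrow (p/q)x$ integral, in the direction in
    which the procedure rescales. *)
Definition smith_form M := exists U V p q,
  [/\ GL2O v U, GL2O v V, U *m M *m V = mx2 p 0 0 q, q != 0 & vgeb v 0 (p / q)].

Lemma GL2O_swap : GL2O v (mx2 0 1 1 0).
Proof.
apply/GL2OP; rewrite det_mx2 !mx2E mul0r mulr1 sub0r.
by rewrite vgeb0 vgeb1 (vunitN (vunit1 v)).
Qed.

Lemma smith_form_pivot M : M 1 1 != 0 -> vgeb v 0 (M 0 0 / M 1 1) ->
  vgeb v 0 (M 0 1 / M 1 1) -> vgeb v 0 (M 1 0 / M 1 1) -> smith_form M.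
Proof.
move=> n11 h00 h01 h10.
exists (mx2 1 (- (M 0 1 / M 1 1)) 0 1), (mx2 1 0 (- (M 1 0 / M 1 1)) 1).
exists (M 0 0 - M 0 1 * M 1 0 / M 1 1), (M 1 1); split=> //.
- apply/GL2OP; rewrite det_mx2 !mx2E !(mulr0, mulr1, subr0) vunit1; split=> //; vtac.
- apply/GL2OP; rewrite det_mx2 !mx2E !(mul0r, mulr1, subr0) vunit1; split=> //; vtac.
- by apply: mx2_eq; rewrite !mulmx2E !mx2E; field.
have -> : (M 0 0 - M 0 1 * M 1 0 / M 1 1) / M 1 1 =
  M 0 0 / M 1 1 - (M 0 1 / M 1 1) * (M 1 0 / M 1 1) by field.
vtac.
Qed.

Lemma smith_form_mull M N : GL2O v N -> smith_form (N *m M) -> smith_form M.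
Proof.
move=> gN [U [V [p [q [gU gV e nq h]]]]].
by exists (U *m N), V, p, q; split=> //; [exact: GL2O_mul|rewrite -e !mulmxA].
Qed.

Lemma smith_form_mulr M N : GL2O v N -> smith_form (M *m N) -> smith_form M.
Proof.
move=> gN [U [V [p [q [gU gV e nq h]]]]].
by exists U, (N *m V), p, q; split=> //; [exact: GL2O_mul|rewrite -e !mulmxA].
Qed.

(** An entry of least valuation is found by comparing the least entries of the two rows; swaps bring
    it to the lower right corner, where it divides all others and serves as pivot. *)
Lemma smithP M : \det M != 0 -> smith_form M.
Proof.
pose W : 'M[K]_2 := mx2 0 1 1 0.
have MW N : N *m W = mx2 (N 0 1) (N 0 0) (N 1 1) (N 1 0).
  by apply: mx2_eq; rewrite !mulmx2E !mx2E; ring.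
have WM N : W *m N = mx2 (N 1 0) (N 1 1) (N 0 0) (N 0 1).
  by apply: mx2_eq; rewrite !mulmx2E !mx2E; ring.
pose pivot (x y b : K) := [/\ b != 0, vgeb v 0 (x / b), vgeb v 0 (y / b) & b = x \/ b = y].
have pivotP x y : (x != 0) || (y != 0) -> exists b, pivot x y b.
  move=> /vgeb_total/orP[/andP[nb hb]|/andP[nb hb]]; [exists y|exists x];
    split; rewrite ?divff ?vgeb1 //; by [right|left].
have pivot_trans x y a b : pivot x y a -> vgeb v 0 (a / b) ->
    vgeb v 0 (x / b) /\ vgeb v 0 (y / b).
  case=> na hx hy _ hab.
  have -> : x / b = (x / a) * (a / b) by rewrite mulrA divfK.
  have -> : y / b = (y / a) * (a / b) by rewrite mulrA divfK.
  by split; vtac.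
have row1 N b : pivot (N 1 0) (N 1 1) b -> vgeb v 0 (N 0 0 / b) ->
    vgeb v 0 (N 0 1 / b) -> smith_form N.
  case=> nb h10 h11 [eb|eb] h00 h01; rewrite eb in nb h10 h11 h00 h01.
    by apply: (smith_form_mulr GL2O_swap); apply: smith_form_pivot; rewrite MW !mx2E.
  exact: smith_form_pivot.
rewrite det_mx2 => nd.
have [|a ha] := pivotP (M 0 0) (M 0 1).
  by apply: contraNT nd; rewrite negb_or !negbK => /andP[/eqP-> /eqP->]; rewrite !mul0r subr0.
have [|b hb] := pivotP (M 1 0) (M 1 1).
  by apply: contraNT nd; rewrite negb_or !negbK => /andP[/eqP-> /eqP->]; rewrite !mulr0 subr0.
have [na _ _ _] := ha; have [nb _ _ _] := hb.
case/orP: (vgeb_total (introT orP (or_introl na) : (a != 0) || (b != 0))) => /andP[_ h].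
  by have [h00 h01] := pivot_trans _ _ _ _ ha h; exact: row1 hb h00 h01.
have [h10 h11] := pivot_trans _ _ _ _ hb h.
by apply: (smith_form_mull GL2O_swap); apply: (row1 _ a); rewrite WM !mx2E.
Qed.

(* [A] becomes a model with [v(P,Q) >= 2] after [x <- pi^s x] and the division of
   [(P,Q)] by [(pi^s, pi^2s)]. *)
Definition adapted s A : bool := match s with
  | 0 => Pge v 1 A && Qge v 2 A
  | 1 => [&& vgeb v 0 (cl A), vgeb v 1 (cm A) & vgeb v 2 (cn A)] &&
         [&& vgeb v 0 (ca A), vgeb v 1 (cb A), vgeb v 2 (cc A), vgeb v 3 (cd A)
           & vgeb v 4 (ce A)]
  | _ => [&& vgeb v 0 (cl A), vgeb v 1 (cm A) & vgeb v 3 (cn A)] &&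
         [&& vgeb v 0 (ca A), vgeb v 0 (cb A), vgeb v 2 (cc A), vgeb v 4 (cd A)
           & vgeb v 6 (ce A)]
  end.

Variable pi : K.
Hypotheses (npi : pi != 0) (dvpi : dv v pi = 1) (h2 : vgeb v 1 2%:R).

(* The hypotheses say that [x <- w x] followed by the y-substitution
   [w s0 x^2 + w s1 xz + r2 z^2] makes [P] divisible by [pi w] and [Q] by [pi^2 w^2]. *)
Lemma adapted_ysub l m n a b c d e w s0 s1 r2 xl xm xn ya yb yc yd ye :
  [/\ vgeb v 0 l, vgeb v 0 m & vgeb v 0 n] ->
  [/\ vgeb v 0 a, vgeb v 0 b, vgeb v 0 c, vgeb v 0 d & vgeb v 0 e] ->
  w != 0 -> vgeb v 0 w ->
  [/\ vgeb v 1 xl, vgeb v 1 xm & vgeb v 1 xn] ->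
  [/\ vgeb v 2 ya, vgeb v 2 yb, vgeb v 2 yc, vgeb v 2 yd & vgeb v 2 ye] ->
  [/\ l * w + 2%:R * s0 = xl, m + 2%:R * s1 = xm & n + 2%:R * r2 = w * xn] ->
  [/\ a * w ^+ 2 - s0 * l * w - s0 ^+ 2 = ya,
      b * w - s0 * m - s1 * l * w - 2%:R * s0 * s1 = yb,
      c - s0 * xn - s1 * m - r2 * l - s1 ^+ 2 = yc,
      d - s1 * n - r2 * m - 2%:R * s1 * r2 = w * yd
    & e - r2 * n - r2 ^+ 2 = w ^+ 2 * ye] ->
  forall A, cl A = l -> cm A = m -> cn A = n -> ca A = a -> cb A = b ->
    cc A = c -> cd A = d -> ce A = e ->
  exists s r0 r1 r2, [/\ (s <= 2)%N, [/\ vgeb v 0 r0, vgeb v 0 r1 & vgeb v 0 r2]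
    & adapted s (transform 1%:M 1 r0 r1 r2 A)].
Proof.
move=> [hl hm hn] [ha hb hc hd he] nw hw [kl km kn] [ka kb kc kd ke].
move=> [el em en] [ea eb ec ed ee] A Al Am An Aa Ab Ac Ad Ae.
(* The equations for $e$, $a$ and $c$ are monic quadratics in $r_2$, $s_0$ and $s_1$. *)
have hr2 : vgeb v 0 r2.
  apply: (@vgeb_monic_root2 _ v (w ^+ 2 * ye - e) n) => //; first vtac.
  by rewrite -ee; ring.
have hs0 : vgeb v 0 s0.
  apply: (@vgeb_monic_root2 _ v (ya - a * w ^+ 2) (l * w)); [vtac|vtac|].
  by rewrite -ea; ring.
have hs1 : vgeb v 0 s1.
  apply: (@vgeb_monic_root2 _ v (s0 * xn + r2 * l + yc - c) m) => //; first vtac.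
  by rewrite -ec; ring.
(* Pulled back through $x\leftarrow wx$, the y-substitution becomes $(s_0/w)x^2+s_1xz+r_2z^2$. It
   can be used when $s_0/w$ is integral, which holds for $v(w)\le1$. *)
have small s r0 : r0 = s0 / w -> vgeb v 0 r0 -> (s <= 1)%N -> vgeb v s w ->
    vgeb v (1 - s) (xl / w) -> vgeb v (2 - s - s) (ya / w ^+ 2) ->
    vgeb v (2 - s) (yb / w) ->
    adapted s (transform 1%:M 1 r0 s1 r2 A).
  move=> er hr0 hs1w kw kl' ka' kb'.
  have C1 : l + 2%:R * r0 = xl / w by rewrite er -el; field.
  have C4 : a - r0 * l - r0 ^+ 2 = ya / w ^+ 2 by rewrite er -ea; field.
  have C5 : b - r0 * m - s1 * l - 2%:R * r0 * s1 = yb / w by rewrite er -eb; field.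
  have C6 : c - r0 * n - s1 * m - r2 * l - s1 ^+ 2 - 2%:R * r0 * r2 = yc.
    rewrite -ec er; have -> : xn = (n + 2%:R * r2) / w by rewrite en mulrC mulKf.
    by field.
  case: s hs1w kw kl' ka' kb' => [|[|//]] _ kw kl' ka' kb';
    rewrite /adapted /Pge /Qge !ysubE Al Am An Aa Ab Ac Ad Ae C1 em en C4 C5 C6 ed ee;
    apply/andP; split; [apply/and3P|apply/and5P|apply/and3P|apply/and5P]; split; vtac.
case: (boolP (vgeb v 1 w)) => kw1; last first.
  have iw := vunit_ge0 (vunitV (vunitI hw kw1)).
  have iw2 : vgeb v 0 (w ^+ 2)^-1 by rewrite -exprVn; vtac.
  exists 0%N, (s0 / w), s1, r2; split=> //; first by split; vtac.
  by apply: small => //; vtac.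
have ks0 : vgeb v 1 s0.
  apply: (vgeb_sqr_odd (k := 0)).
  by have -> : s0 ^+ 2 = a * w ^+ 2 - s0 * l * w - ya; [rewrite -ea; ring|vtac].
have [w' hw' ew] : exists2 w', vgeb v 0 w' & w = pi * w'.
  by have := vgeb_factor npi dvpi (j := 1) (k := 0) kw1; rewrite expr1.
have [t ht et] : exists2 t, vgeb v 0 t & s0 = pi * t.
  by have := vgeb_factor npi dvpi (j := 1) (k := 0) ks0; rewrite expr1.
have hpi := vgeb_pi dvpi.
have nw' : w' != 0 by apply: contra_neq nw => w0; rewrite ew w0 mulr0.
case: (boolP (vgeb v 1 w')) => kw'; last first.
  have iw := vunit_ge0 (vunitV (vunitI hw' kw')).
  have e0 : t / w' = s0 / w by rewrite et ew; field; rewrite npi nw'.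
  exists 1%N, (t / w'), s1, r2; split=> //; first by split=> //; vtac.
  apply: small => //; first vtac.
  - have -> : xl / w = xl / pi ^+ 1 / w' by rewrite ew expr1; field; rewrite nw' npi.
    have := vgeb_pidiv npi dvpi (j := 1) (k := 0) kl => hxl; vtac.
  - have -> : ya / w ^+ 2 = ya / pi ^+ 2 * w'^-1 ^+ 2.
      by rewrite ew; field; rewrite nw' npi.
    have := vgeb_pidiv npi dvpi (j := 2) (k := 0) ka => hya; vtac.
  - have -> : yb / w = yb / pi ^+ 1 / w' by rewrite ew expr1; field; rewrite nw' npi.
    have := vgeb_pidiv npi dvpi (j := 1) (k := 1) kb => hyb; vtac.
have kw : vgeb v 2 w by rewrite ew; vtac.
have h00 := vgeb0 v 0.
(* For $v(w)\ge2$ the quotient $s_0/w$ may fail to be integral, so the $x^2$ term is dropped. The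
   coefficients $l$, $a$, $b$ carry no condition here beyond integrality, and $c$ changes only by
   [s0 * xn], which is divisible by $\pi^2$. *)
exists 2%N, 0, s1, r2; split=> //.
rewrite /adapted !ysubE Al Am An Aa Ab Ac Ad Ae em en ed ee.
have -> : c - 0 * n - s1 * m - r2 * l - s1 ^+ 2 - 2%:R * 0 * r2 = yc + s0 * xn.
  by rewrite -ec; ring.
by apply/andP; split; [apply/and3P|apply/and5P]; split; vtac.
Qed.

(** In the Smith form of [M], the factor [V] turns [PQ] into the equivalent model [A], while [U]
    acts on the model of lower discriminant and keeps it integral. As $v(\mu pq)<0$, multiplying $P$
    and $Q$ of that model by $(\mu pq)^{-1}$ and its square makes them divisible by $\pi$ and
    $\pi^2$. *)
Lemma nonminimal_adapted PQ : wf_model PQ -> integralb v PQ -> discPQ PQ != 0 ->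
  nonminimal v PQ -> exists s A, [/\ (s <= 2)%N, oequiv v PQ A & adapted s A].
Proof.
move=> wf iPQ nd [_ [[M [mu [r0 [r1 [r2 [nM [nmu ->]]]]]]] [iPQ' hd]]].
have {}iPQ' := introT (integralP _ (wf_transform _ _ _ _ _ _)) iPQ'.
rewrite (jacobian_rel_disc (jacobian_rel_transform r0 r1 r2 PQ nM nmu)) in hd.
rewrite dv_mul ?expf_neq0 ?mulf_neq0 // dvX ?mulf_neq0 // dv_mul // in hd.
have [U [V [p [q [gU gV eD nq hpq]]]]] := smithP nM.
have eV : U *m M = mx2 p 0 0 q *m invmx V by rewrite -eD mulmxK ?(GL2O_unitmx gV).
pose A := transform (invmx V) 1 0 0 0 PQ.
have oA : oequiv v PQ A by apply: linear_oequiv; exact: GL2O_inv.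
have edet : p * q = \det U * \det M * \det V.
  by rewrite -!det_mulmx eD det_mx2 !mx2E mul0r subr0.
have /GL2OP[u00 u01 u10 u11 /andP[nU /eqP dU]] := gU.
have /GL2OP[_ _ _ _ /andP[nV /eqP dV]] := gV.
have np : p != 0.
  have : p * q != 0 by rewrite edet !mulf_neq0.
  by rewrite mulf_eq0 negb_or => /andP[].
have nh : mu * p * q != 0 by rewrite !mulf_neq0.
have kh : vgeb v 1 (mu * p * q)^-1.
  rewrite /vgeb dvV // -mulrA edet !dv_mul ?mulf_neq0 // dU dV; apply/orP; right.
  move: hd; move: (dv v (discPQ PQ)) (dv v mu) (dv v (\det M)); clear => x y z.
  lia.
have iB : integralb v (transform U 1 0 0 0 (transform M mu r0 r1 r2 PQ)).
  exact: oequiv_integral iPQ' (linear_oequiv _ gU).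
move: iB; rewrite transform_comp // mul1r !mul0r !addr0 eV.
set s0 := r0 * _ + _ + _; set s1 := _ + _ + _; set s2 := _ + _ + _ => iB.
have {iB} : integralb v (transform (mx2 p 0 0 q) mu s0 s1 s2 A).
  by rewrite /A transform_comp ?oner_neq0 // !divr1 !mul0r !mulr0 !mul0r !add0r mulr1.
have iA := oequiv_integral h2 iPQ oA.
clearbody A.
have [/and3P[hl hm hn] /and5P[ha hb hc hd' he]] := andP iA.
rewrite /integralb /Pge /Qge !transformE !mx2E => /andP[/and3P[]].
set Bl := mu * _; set Bm := mu * _; set Bn := mu * _ => kl km kn /and5P[].
set Ba := _ * _; set Bb := _ * _; set Bc := _ * _; set Bd := _ * _; set Be := _ * _.
move=> ka kb kc kd ke.
set h := _^-1 in kh; set w := p / q in hpq.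
have nw : w != 0 by rewrite mulf_neq0 ?invr_eq0.
(* Scaling $\mathrm{diag}(p,q)$ to $\mathrm{diag}(w,1)$ divides the y-substitution by $q^2$; in the
   form $ws_0x^2+ws_1xz+r_2z^2$ this puts $pq=wq^2$ in the first two denominators. *)
have [||||||s [t0 [t1 [t2 [hs ht hA]]]]] := @adapted_ysub (cl A) (cm A) (cn A) (ca A)
  (cb A) (cc A) (cd A) (ce A) w (s0 / (p * q)) (s1 / (p * q)) (s2 / q ^+ 2)
  (h * Bl) (h * Bm) (h * Bn) (h ^+ 2 * Ba) (h ^+ 2 * Bb) (h ^+ 2 * Bc) (h ^+ 2 * Bd)
  (h ^+ 2 * Be) _ _ nw hpq _ _ _ _ A erefl erefl erefl erefl erefl erefl erefl erefl.
- by split.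
- by split.
- by split; vtac.
- by split; vtac.
- by split; rewrite /h /w /Bl /Bm /Bn; field; rewrite ?np ?nq ?nmu ?oner_neq0.
- by split; rewrite /h /w /Ba /Bb /Bc /Bd /Be /Bn; field; rewrite ?np ?nq ?nmu ?oner_neq0.
exists s, (transform 1%:M 1 t0 t1 t2 A); split=> //.
apply: (oequiv_trans h2 oA); apply: yequiv_oequiv.
by apply/yequivE; exists t0, t1, t2; case: ht.
Qed.
End Nonminimal.

Lemma coef_double_root (R : comNzRingType) (x0 z0 : R) (G : {poly R}) i :
  ((z0 *: 'X - x0%:P) ^+ 2 * G)`_i =
  z0 ^+ 2 * (if (i < 2)%N then 0 else G`_(i - 2))
  - 2%:R * x0 * z0 * (if i == 0%N then 0 else G`_i.-1) + x0 ^+ 2 * G`_i.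
Proof.
have -> : (z0 *: 'X - x0%:P) ^+ 2 * G =
    (z0 ^+ 2) *: (G * 'X^2) - (2%:R * x0 * z0) *: (G * 'X) + x0 ^+ 2 *: G.
  by rewrite -!mul_polyC; ring.
by rewrite !coefD coefN !coefZ coefMXn coefMX.
Qed.

(** * One iteration of the procedure *)

Section Step.
Variables (K : fieldType) (v : dvaluation K) (pi : K).
Implicit Types (PQ A B : model K) (M N U V : 'M[K]_2).
Hypotheses (npi : pi != 0) (dvpi : dv v pi = 1) (h2 : vgeb v 1 2%:R).
Let hpi := vgeb_pi dvpi.

(* [(x0 : z0)] is a repeated root of [Q_1] mod [pi], in terms of coefficients.  In
   case 2 the vanishing mod [pi] of the cross term of [Q_1] is automatic. *)
Definition double_at PQ (x0 z0 : K) : Prop :=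
  [\/ ~~ Pge v 1 PQ /\ exists2 g, vgeb v 0 g &
        [/\ vgeb v 1 (cl PQ - g * z0 ^+ 2), vgeb v 1 (cm PQ)
          & vgeb v 1 (cn PQ - g * x0 ^+ 2)],
      [/\ Pge v 1 PQ, ~~ (vgeb v 1 (cb PQ) && vgeb v 1 (cd PQ)) &
        exists2 g, vgeb v 0 g &
        vgeb v 1 (cb PQ - g * z0 ^+ 2) /\ vgeb v 1 (cd PQ - g * x0 ^+ 2)]
    | [/\ Pge v 1 PQ, Qge v 1 PQ, ~~ Qge v 2 PQ & exists g0 g1 g2,
        [/\ vgeb v 0 g0, vgeb v 0 g1 & vgeb v 0 g2] /\
        [/\ vgeb v 2 (ca PQ - pi * (z0 ^+ 2 * g2)),
            vgeb v 2 (cb PQ - pi * (z0 ^+ 2 * g1 - 2%:R * x0 * z0 * g2)),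
            vgeb v 2 (cc PQ - pi * (z0 ^+ 2 * g0 - 2%:R * x0 * z0 * g1 + x0 ^+ 2 * g2)),
            vgeb v 2 (cd PQ - pi * (x0 ^+ 2 * g1 - 2%:R * x0 * z0 * g0))
          & vgeb v 2 (ce PQ - pi * (x0 ^+ 2 * g0))]]].

(** The bottom row of [N] is the image of $(0:1)$, and it must be the repeated root $(x_0:z_0)$.
    With $B=z_0N_{10}-x_0N_{11}$, in the first case $n$ of [A] is $gB^2$ mod $\pi$ up to a unit, in
    the second $d$ of [A] is $\det(N)\,gB^2$ up to a unit, and $g$ is a unit. The third case
    compares coefficients mod $\pi^2$. *)
Lemma double_at_transport PQ x0 z0 N mu r0 r1 r2 (A := transform N mu r0 r1 r2 PQ) :
  integralb v PQ -> vgeb v 0 x0 -> vgeb v 0 z0 -> double_at PQ x0 z0 ->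
  GL2O v N -> vunit v mu -> [/\ vgeb v 0 r0, vgeb v 0 r1 & vgeb v 0 r2] ->
  [/\ vgeb v 2 (cn A), vgeb v 2 (cc A), vgeb v 2 (cd A) & vgeb v 2 (ce A)] ->
  vgeb v 1 (z0 * N 1 0 - x0 * N 1 1).
Proof.
move=> /andP[/and3P[hl hm hn] /and5P[ha hb hc hd he]] hx hz hD.
move=> /GL2OP[n00 n01 n10 n11 dN] umu [hr0 hr1 hr2].
rewrite /A !transformE; move: dN; rewrite det_mx2 => dN.
move=> [kn kc kd ke].
have umu2 := vunitM umu umu; rewrite -expr2 in umu2.
have {}kn := vgeb_mull_unit (vunit_ge1 umu) kn.
have {}kc := vgeb_mull_unit (vunit_ge1 umu2) kc.
have {}kd := vgeb_mull_unit (vunit_ge1 umu2) kd.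
have {}ke := vgeb_mull_unit (vunit_ge1 umu2) ke.
case: hD => [[nP [g hg [kl km kn']]]|[/and3P[kl km kn'] nb [g hg [kb kd']]]|
    [/and3P[kl km kn'] /and5P[pa pb pc pd pe] nQ [g0 [g1 [g2 [[hg0 hg1 hg2] [ka kb kc' kd' ke']]]]]]].
- have ng : ~~ vgeb v 1 g.
    apply: contra nP => kg; apply/and3P; split=> //.
      vring (cl PQ - g * z0 ^+ 2 + g * z0 ^+ 2).
    vring (cn PQ - g * x0 ^+ 2 + g * x0 ^+ 2).
  apply: (vgeb_sqr_odd (k := 0)); apply: (vgeb_mull_unit ng).
  set E := _ + _ in kn.
  vring_unfold E (E - cm PQ * N 1 0 * N 1 1 - 2%:R * r2 - (cl PQ - g * z0 ^+ 2) * N 1 0 ^+ 2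
    - (cn PQ - g * x0 ^+ 2) * N 1 1 ^+ 2 - 2%:R * g * z0 * N 1 0 * x0 * N 1 1).
- have ng : ~~ vgeb v 1 g.
    apply: contra nb => kg; apply/andP; split=> //.
      vring (cb PQ - g * z0 ^+ 2 + g * z0 ^+ 2).
    vring (cd PQ - g * x0 ^+ 2 + g * x0 ^+ 2).
  apply: (vgeb_sqr_odd (k := 0)); apply: (vgeb_mull_unit ng).
  apply: (vgeb_mull_unit (vunit_ge1 dN)); set X := _ - _ in kd.
  set p := N 0 0 in n00 dN X kd *; set q := N 0 1 in n01 dN X kd *.
  set s := N 1 0 in n10 dN X kd *; set t := N 1 1 in n11 dN X kd *.
  vring_unfold X (X - 4%:R * ca PQ * p * s ^+ 3 - 4%:R * ce PQ * q * t ^+ 3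
    - cc PQ * (2%:R * (p * s * t ^+ 2) + 2%:R * (s ^+ 2 * q * t))
    + r1 * (cl PQ * s ^+ 2 + cm PQ * s * t + cn PQ * t ^+ 2)
    + r2 * (2%:R * cl PQ * p * s + cm PQ * (p * t + s * q) + 2%:R * cn PQ * q * t)
    + 2%:R * r1 * r2 - 2%:R * (p * t + s * q) * s ^+ 2 * cb PQ
    - 4%:R * s * q * t ^+ 2 * cd PQ
    - (p * t - q * s) * ((cb PQ - g * z0 ^+ 2) * s ^+ 2
       + (cd PQ - g * x0 ^+ 2) * t ^+ 2 + 2%:R * g * z0 * s * x0 * t)).
move: n00 n01 n10 n11 dN kn kc kd ke.
move: (N 0 0) (N 0 1) (N 1 0) (N 1 1) => p q s t hp hq hs ht dN kn kc kd ke.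
set l' := cl PQ * p ^+ 2 + _ + _ in kc kd ke; set n' := cl PQ * s ^+ 2 + _ + _ in kn kc kd ke.
set m' := _ + cm PQ * (p * t + s * q) + _ in kc kd ke.
have kl' : vgeb v 1 l' by rewrite /l'; vtac.
have km' : vgeb v 1 m' by rewrite /m'; vtac.
have kn1 : vgeb v 1 n' by rewrite /n'; vtac.
set E := ca PQ * s ^+ 4 + _ + _ + _ + _ in ke; set D := 4%:R * ca PQ * p * _ + _ + _ + _ + _ in kd.
set C := 6%:R * ca PQ * _ * _ + _ + _ + _ + _ in kc.
have kE : vgeb v 1 E by rewrite /E; vtac.
have kC : vgeb v 1 C by rewrite /C; vtac.
(* Once $\pi$ divides $r_2$ and $r_1$, the y-substitution alters the coefficients [E], [D], [C] of
   $z^4$, $xz^3$, $x^2z^2$ only by multiples of $\pi^2$. *)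
have kr2 : vgeb v 1 r2.
  by apply: (vgeb_sqr_odd (k := 0)); vring (E - r2 * n' - (E - r2 * n' - r2 ^+ 2)).
have kn2 : vgeb v 2 n' by vring (n' + 2%:R * r2 - 2%:R * r2).
have kr1 : vgeb v 1 r1.
  apply: (vgeb_sqr_odd (k := 0)).
  vring (C - r0 * n' - r1 * m' - r2 * l' - 2%:R * r0 * r2 -
   (C - r0 * n' - r1 * m' - r2 * l' - r1 ^+ 2 - 2%:R * r0 * r2)).
have {}kE : vgeb v 2 E by vring (E - r2 * n' - r2 ^+ 2 + r2 * n' + r2 ^+ 2).
have {}kD : vgeb v 2 D.
  vring (D - r1 * n' - r2 * m' - 2%:R * r1 * r2 + r1 * n' + r2 * m' + 2%:R * r1 * r2).
have {}kC : vgeb v 2 C.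
  vring (C - r0 * n' - r1 * m' - r2 * l' - r1 ^+ 2 - 2%:R * r0 * r2
   + r0 * n' + r1 * m' + r2 * l' + r1 ^+ 2 + 2%:R * r0 * r2).
(* Mod $\pi$, $\pi^{-1}Q$ composed with [N] is $(\alpha x+Bz)^2(j_2x^2+h_1xz+h_0z^2)$, with $\alpha$
   written [al]. If $B$ is a unit, its three lowest coefficients in $x$ vanish only if $h_0$, $h_1$,
   $j_2$ vanish in turn, and then $\pi^2\mid Q$. *)
apply: contraT => nB; case/negP: nQ.
pose B := z0 * s - x0 * t; pose al := z0 * p - x0 * q.
pose h0 := g2 * s ^+ 2 + g1 * s * t + g0 * t ^+ 2.
pose h1 := 2%:R * g2 * p * s + g1 * (p * t + s * q) + 2%:R * g0 * q * t.
pose j2 := g2 * p ^+ 2 + g1 * p * q + g0 * q ^+ 2.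
have hh0 : vgeb v 0 h0 by rewrite /h0; vtac.
have hh1 : vgeb v 0 h1 by rewrite /h1; vtac.
have hal : vgeb v 0 al by rewrite /al; vtac.
have hB : vgeb v 0 B by rewrite /B; vtac.
have nB2 : ~~ vgeb v 1 (B ^+ 2) by apply: contra nB => /(vgeb_sqr_odd (k := 0)).
have lift x : vgeb v 2 (pi * (B ^+ 2 * x)) -> vgeb v 1 x.
  by rewrite -[pi]expr1 (vgeb_pimul npi dvpi 1 1); exact: vgeb_mull_unit.
set da := _ - _ in ka; set db := _ - _ in kb; set dc := _ - _ in kc'.
set dd := _ - _ in kd'; set de := _ - _ in ke'.
have kh0 : vgeb v 1 h0.
  apply: lift.
  have -> : pi * (B ^+ 2 * h0) = E - (da * s ^+ 4 + db * s ^+ 3 * t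
      + dc * s ^+ 2 * t ^+ 2 + dd * s * t ^+ 3 + de * t ^+ 4).
    by rewrite /E /da /db /dc /dd /de /h0 /B; ring.
  vtac.
have kh1 : vgeb v 1 h1.
  apply: lift.
  have -> : pi * (B ^+ 2 * h1) = D - (4%:R * da * p * s ^+ 3
     + db * (s ^+ 3 * q + 3%:R * p * s ^+ 2 * t)
     + dc * (2%:R * p * s * t ^+ 2 + 2%:R * s ^+ 2 * q * t)
     + dd * (p * t ^+ 3 + 3%:R * s * q * t ^+ 2) + 4%:R * de * q * t ^+ 3)
     - pi * (2%:R * al * B * h0).
    by rewrite /D /da /db /dc /dd /de /h0 /h1 /al /B; ring.
  vtac.
have kh2 : vgeb v 1 j2.
  apply: lift.
  have -> : pi * (B ^+ 2 * j2) = C - (6%:R * da * p ^+ 2 * s ^+ 2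
     + db * (3%:R * p ^+ 2 * s * t + 3%:R * p * s ^+ 2 * q)
     + dc * (p ^+ 2 * t ^+ 2 + s ^+ 2 * q ^+ 2 + 4%:R * p * s * q * t)
     + dd * (3%:R * p * q * t ^+ 2 + 3%:R * s * q ^+ 2 * t)
     + 6%:R * de * q ^+ 2 * t ^+ 2)
     - pi * (2%:R * al * B * h1) - pi * (al ^+ 2 * h0).
    by rewrite /C /da /db /dc /dd /de /h0 /h1 /j2 /al /B; ring.
  vtac.
(* the inverse substitution gives back [G] *)
have dN2 : ~~ vgeb v 1 ((p * t - q * s) ^+ 2).
  by rewrite expr2; apply: vunit_ge1; exact: vunitM.
have kg2 : vgeb v 1 g2.
  apply: (vgeb_mull_unit dN2).
  have -> : (p * t - q * s) ^+ 2 * g2 = j2 * t ^+ 2 - h1 * t * q + h0 * q ^+ 2.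
    by rewrite /j2 /h1 /h0; ring.
  vtac.
have kg1 : vgeb v 1 g1.
  apply: (vgeb_mull_unit dN2).
  have -> : (p * t - q * s) ^+ 2 * g1 =
      - (2%:R * j2 * t * s) + h1 * (t * p + s * q) - 2%:R * h0 * q * p.
    by rewrite /j2 /h1 /h0; ring.
  vtac.
have kg0 : vgeb v 1 g0.
  apply: (vgeb_mull_unit dN2).
  have -> : (p * t - q * s) ^+ 2 * g0 = j2 * s ^+ 2 - h1 * s * p + h0 * p ^+ 2.
    by rewrite /j2 /h1 /h0; ring.
  vtac.
apply/and5P; split.
- vring_unfold da (da + pi * (z0 ^+ 2 * g2)).
- vring_unfold db (db + pi * (z0 ^+ 2 * g1 - 2%:R * x0 * z0 * g2)).
- vring_unfold dc (dc + pi * (z0 ^+ 2 * g0 - 2%:R * x0 * z0 * g1 + x0 ^+ 2 * g2)).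
- vring_unfold dd (dd + pi * (x0 ^+ 2 * g1 - 2%:R * x0 * z0 * g0)).
- vring_unfold de (de + pi * (x0 ^+ 2 * g0)).
Qed.
End Step.

(** * Square roots mod $\pi$, the repeated root in coefficients, the rescaling *)

Section Procedure.
Variables (K : fieldType) (v : dvaluation K) (pi : K).
Implicit Types (PQ A B : model K) (M N U V : 'M[K]_2).
Hypotheses (npi : pi != 0) (dvpi : dv v pi = 1) (h2 : vgeb v 1 2%:R).
Hypothesis perfect : residue_perfect v.
Let hpi := vgeb_pi dvpi.

Lemma sqrt_mod x : vgeb v 0 x -> exists2 y, vgeb v 0 y & vgeb v 1 (x - y ^+ 2).
Proof.
move=> /vgeP hx; have /vgeP h2' := h2.
by have [y [/vgeP hy /vgeP hxy]] := perfect (isT : prime 2) h2' hx; exists y.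
Qed.

(* As the residue field is perfect, the even part of [Q] is a square mod [pi]. *)
Lemma vPQ_ge1_odd PQ : integralb v PQ -> Pge v 1 PQ -> vgeb v 1 (cb PQ) ->
  vgeb v 1 (cd PQ) -> vPQ_ge v PQ 1.
Proof.
move=> /andP[_ /and5P[ha hb hc hd he]] /and3P[kl km kn] kb kd.
have [r0 hr0 k0] := sqrt_mod ha; have [r1 hr1 k1] := sqrt_mod hc.
have [r2 hr2 k2] := sqrt_mod he.
exists (transform 1%:M 1 r0 r1 r2 PQ); split; first by apply/yequivE; exists r0, r1, r2.
have wf := wf_transform 1%:M 1 r0 r1 r2 PQ.
have /(PgeP v _ wf) hP : Pge v 1 (transform 1%:M 1 r0 r1 r2 PQ).
  by apply/and3P; rewrite !ysubE; split; vtac.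
split; first by move=> i; apply/(vge2_1 v)/hP.
apply/(QgeP v 1 wf)/and5P; rewrite !ysubE; split; try vtac.
- have {}k0 : vgeb v 1 (ca PQ - r0 ^+ 2) := k0.
  vring (ca PQ - r0 ^+ 2 - r0 * cl PQ).
- have {}k1 : vgeb v 1 (cc PQ - r1 ^+ 2) := k1.
  vring (cc PQ - r1 ^+ 2 - (r0 * cn PQ + r1 * cm PQ + r2 * cl PQ + 2%:R * r0 * r2)).
- have {}k2 : vgeb v 1 (ce PQ - r2 ^+ 2) := k2.
  vring (ce PQ - r2 ^+ 2 - r2 * cn PQ).
Qed.

Lemma isQ1_double_at PQ dg F x0 z0 : wf_model PQ -> integralb v PQ ->
  isQ1 v pi PQ dg F -> double_root_modpi v dg F x0 z0 -> double_at v pi PQ x0 z0.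
Proof.
move=> wf iPQ hQ1 [/vgeP hx [/vgeP hz [_ [G [sG [hG hF]]]]]].
have {}hG i : vgeb v 0 G`_i by apply/vgeP; exact: hG.
have {}hF i : vgeb v 1 (F`_i - (z0 ^+ 2 * (if (i < 2)%N then 0 else G`_(i - 2))
  - 2%:R * x0 * z0 * (if i == 0%N then 0 else G`_i.-1) + x0 ^+ 2 * G`_i)).
  by have := hF i; rewrite coefB coef_double_root => /vgeP.
case: hQ1 => [[nP [edg eF]]|[[hP [[_ nv] [edg eF]]]|[hP [hQ [nQ [edg eF]]]]]].
- constructor 1; split; first by apply/negP => /(PgeP v _ wf).
  rewrite edg in sG; have G1 : G`_1 = 0 by rewrite nth_default.
  have G2 : G`_2 = 0 by rewrite nth_default // (leq_trans sG).
  have hm : vgeb v 1 (cm PQ + 2%:R * x0 * z0 * G`_0).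
    by apply: vgeb_eq (hF 1%N); rewrite /= eF G1 /cm; ring.
  have g0 := hG 0%N; exists G`_0 => //; split.
  + by apply: vgeb_eq (hF 2%N); rewrite /= eF G1 G2 /cl; ring.
  + vring (cm PQ + 2%:R * x0 * z0 * G`_0 - 2%:R * x0 * z0 * G`_0).
  + by apply: vgeb_eq (hF 0%N); rewrite /= eF /cn; ring.
- have /(PgeP v _ wf) {}hP := hP; constructor 2; split=> //.
    (* If $\pi$ divided both $b$ and $d$, a y-substitution would give $v(P,Q)\ge1$. *)
    by apply/negP => /andP[kb kd]; apply: nv; exact: vPQ_ge1_odd.
  rewrite edg in sG; have G1 : G`_1 = 0 by rewrite nth_default.
  have G2 : G`_2 = 0 by rewrite nth_default // (leq_trans sG).
  have i3 := vunit_ge0 (vunitV (vunit3 h2)); have n3 := vunit_neq0 (vunit3 h2).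
  have g0 := hG 0%N.
  exists (3%:R^-1 * G`_0); first vtac; split; apply: (vgeb_mull_unit (vunit_ge1 (vunit3 h2))).
  + by apply: vgeb_eq (hF 2%N); rewrite /= eF G1 G2 /dxdz !coefE /= /cb; field.
  + by apply: vgeb_eq (hF 0%N); rewrite /= eF /dxdz !coefE /= /cd; field.
have /(PgeP v _ wf) {}hP := hP; have /(QgeP v _ wf) {}hQ := hQ.
constructor 3; split=> //; first by apply/negP => /(QgeP v _ wf).
rewrite edg in sG; have G3 : G`_3 = 0 by rewrite nth_default.
have G4 : G`_4 = 0 by rewrite nth_default // (leq_trans sG).
exists G`_0, G`_1, G`_2; split; first by split; exact: hG.
have lift x y : vgeb v 1 (pi^-1 * x - y) -> vgeb v 2 (x - pi * y).
  move=> h; have -> : x - pi * y = pi * (pi^-1 * x - y) by field.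
  exact: (vgebM (i := 1) (j := 1)).
split; apply: lift.
- by apply: vgeb_eq (hF 4%N); rewrite /= eF coefZ G3 G4 /ca; ring.
- by apply: vgeb_eq (hF 3%N); rewrite /= eF coefZ G3 /cb; ring.
- by apply: vgeb_eq (hF 2%N); rewrite /= eF coefZ /cc; ring.
- by apply: vgeb_eq (hF 1%N); rewrite /= eF coefZ /cd; ring.
- by apply: vgeb_eq (hF 0%N); rewrite /= eF coefZ /ce; ring.
Qed.

(** As a substitution the last step has $\mu\det M=\pi^{-1}\pi=1$, so it preserves the
    discriminant. *)
Lemma rescaleE PQ : rescale pi PQ = transform (mx2 pi 0 0 1) pi^-1 0 0 0 PQ.
Proof.
apply: model_eq; last 8 first.
1-8: rewrite !transformE !mx2E /rescale /cl /cm /cn /ca /cb /cc /cd /ce /= coefZ coef_poly /=;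
  by field; rewrite ?npi.
- split; rewrite (leq_trans (size_scale_leq _ _)) ?size_poly //.
- exact: wf_transform.
Qed.

Lemma rescale_coefE PQ (A := rescale pi PQ) :
  (cl A = pi * cl PQ) * (cm A = cm PQ) * (cn A = cn PQ / pi) *
  (ca A = pi ^+ 2 * ca PQ) * (cb A = pi * cb PQ) * (cc A = cc PQ) *
  (cd A = cd PQ / pi) * (ce A = ce PQ / pi ^+ 2).
Proof.
by rewrite /A rescaleE !transformE !mx2E; do !split; field; rewrite npi.
Qed.

Lemma wf_rescale PQ : wf_model (rescale pi PQ).
Proof. by rewrite rescaleE; exact: wf_transform. Qed.

Lemma rescale_adapted s A : (s <= 1)%N -> adapted v s.+1 A -> adapted v s (rescale pi A).
Proof.
have dv1 k x : vgeb v k.+1 x -> vgeb v k (x / pi).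
  by move=> h; have := vgeb_pidiv npi dvpi (j := 1) (k := k) h; rewrite expr1.
have dv2 k x : vgeb v k.+2 x -> vgeb v k (x / pi ^+ 2).
  by move=> h; have := vgeb_pidiv npi dvpi (j := 2) (k := k) h.
case: s => [|[|//]] _ /andP[/and3P[kl km kn] /and5P[ka kb kc kd ke]];
  have kn' := dv1 _ _ kn; have kd' := dv1 _ _ kd; have ke' := dv2 _ _ ke;
  apply/andP; split; [apply/and3P|apply/and5P|apply/and3P|apply/and5P];
  rewrite !rescale_coefE; split; vtac.
Qed.

Lemma adapted_weak s A : (0 < s <= 2)%N -> adapted v s A -> integralb v A /\
  [/\ vgeb v 2 (cn A), vgeb v 2 (cc A), vgeb v 2 (cd A) & vgeb v 2 (ce A)].
Proof.
by case: s => [|[|[|//]]] // _ /andP[/and3P[kl km kn] /and5P[ka kb kc kd ke]];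
  split; [apply/andP; split; [apply/and3P|apply/and5P]| |apply/andP; split; [apply/and3P|apply/and5P]|];
  split; vtac.
Qed.

(** Linear substitutions over $O_K$ and unit scalings preserve divisibility of $P$ by $\pi$ and of
    $Q$ by $\pi^2$, so only the y-substitution of the equivalence has to be undone on [PQ]. *)
Lemma adapted0_vPQ_ge PQ A : wf_model PQ -> oequiv v PQ A -> adapted v 0 A ->
  vPQ_ge v PQ 2.
Proof.
move=> wf oA /andP[/and3P[kl km kn] /and5P[ka kb kc kd ke]].
have [N [mu [r0 [r1 [r2 [/GL2OP[n00 n01 n10 n11 _] umu [hr0 hr1 hr2] ePQ]]]]]] := oequiv_sym h2 wf oA.
have hmu := vunit_ge0 umu; have nmu := vunit_neq0 umu.
have e : transform 1%:M 1 (- mu * r0) (- mu * r1) (- mu * r2) PQ = transform N mu 0 0 0 A.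
  rewrite ePQ transform_comp // mul1mx mul1r scalar_mx2 !mx2E.
  by congr transform; field.
have wfB := wf_transform N mu 0 0 0 A.
exists (transform N mu 0 0 0 A); split.
  apply/yequivE; exists (- mu * r0), (- mu * r1), (- mu * r2).
  by split; rewrite ?e //; vtac.
split.
  have /(PgeP v _ wfB) hP : Pge v 1 (transform N mu 0 0 0 A).
    by apply/and3P; split; rewrite !transformE; vtac.
  by move=> i; apply: vge2_2; exact: hP.
by apply/(QgeP v 2 wfB)/and5P; split; rewrite !transformE; vtac.
Qed.
End Procedure.

(** * Comparison of a run with an adapted model *)

Section Iteration.
Variables (K : fieldType) (v : dvaluation K) (pi : K).
Implicit Types (PQ A B : model K) (M N U V : 'M[K]_2).
Hypotheses (npi : pi != 0) (dvpi : dv v pi = 1) (h2 : vgeb v 1 2%:R).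
Hypothesis perfect : residue_perfect v.
Let hpi := vgeb_pi dvpi.

Lemma oequiv_refl PQ : wf_model PQ -> oequiv v PQ PQ.
Proof. by move=> wf; rewrite -{2}[PQ]transform_id //; apply: linear_oequiv; exact: GL2O1. Qed.

Lemma procedure_stepE PQ R : wf_model PQ -> integralb v PQ ->
  vPQ_eq v PQ 0 \/ vPQ_eq v PQ 1 -> procedure_step v pi PQ R ->
  exists PQ1 M PQ3, [/\ wf_model PQ1, oequiv v PQ PQ1, GL2O v M &
    [/\ double_at v pi PQ1 (M 1 0) (M 1 1), yequiv v (transform M 1 0 0 0 PQ1) PQ3,
        vgeb v 1 (ce PQ3) & R = rescale pi PQ3]].
Proof.
move=> wf iPQ vPQ [PQ1 [h1 [h0 [dg [F [hQ1 [M [gM [hD [PQ3 [y3 [/vgeP e3 eR]]]]]]]]]]]].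
have o1 : oequiv v PQ PQ1.
  case: vPQ => [/h0 ->|/h1[/yequiv_oequiv h _]] //; exact: oequiv_refl.
have wf1 : wf_model PQ1.
  case: vPQ => [/h0 ->|/h1[/yequiv_oequiv h _]] //; exact: oequiv_wf h.
exists PQ1, M, PQ3; split=> //; split=> //.
exact: (isQ1_double_at npi dvpi h2 perfect wf1 (oequiv_integral h2 iPQ o1) hQ1 hD).
Qed.

(** Conjugation by $\mathrm{diag}(\pi,1)$ divides $N_{10}$ and $r_2$ by $\pi$ and keeps the other
    data integral. The first is divisible by hypothesis, the second because $\pi\mid e$ on both
    sides. *)
Lemma rescale_oequiv PQ A : wf_model PQ -> vgeb v 1 (cn A) -> vgeb v 1 (ce A) ->
  integralb v PQ -> vgeb v 1 (ce PQ) ->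
  (exists N mu r0 r1 r2, [/\ GL2O v N, vunit v mu, vgeb v 1 (N 1 0),
     [/\ vgeb v 0 r0, vgeb v 0 r1 & vgeb v 0 r2] & A = transform N mu r0 r1 r2 PQ]) ->
  oequiv v (rescale pi PQ) (rescale pi A).
Proof.
move=> wf kn ke /andP[/and3P[hl hm hn] /and5P[ha hb hc hd _]] he.
move=> [N [mu [r0 [r1 [r2 [gN umu k10 [hr0 hr1 hr2] eA]]]]]].
have nmu := vunit_neq0 umu; have /GL2OP[n00 n01 _ n11 dN] := gN.
have umu2 := vunitM umu umu; rewrite -expr2 in umu2.
(* Mod $\pi$, $N_{10}$, $e$ and the transformed $n$ vanish, so the formula for the new $e$ reduces
   to $-r_2^2$ up to a unit. *)
have kr2 : vgeb v 1 r2.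
  move: kn ke; rewrite eA !transformE => /(vgeb_mull_unit (vunit_ge1 umu)) kn.
  move=> /(vgeb_mull_unit (vunit_ge1 umu2)) ke; apply: (vgeb_sqr_odd (k := 0)).
  set n' := cl PQ * N 1 0 ^+ 2 + _ + _ in kn ke; set E := ca PQ * _ + _ + _ + _ + _ in ke.
  have kE : vgeb v 1 E by rewrite /E; vtac.
  have kn' : vgeb v 1 n' by vring (n' + 2%:R * r2 - 2%:R * r2).
  have {}ke : vgeb v 1 (E - r2 * n' - r2 ^+ 2) := ke.
  vring (E - r2 * n' - (E - r2 * n' - r2 ^+ 2)).
have kN := vgeb_pidiv npi dvpi (j := 1) (k := 0) k10.
have kr := vgeb_pidiv npi dvpi (j := 1) (k := 0) kr2.
rewrite !expr1 in kN kr.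
exists (mx2 (N 0 0) (pi * N 0 1) (N 1 0 / pi) (N 1 1)), mu, (pi * r0), r1, (r2 / pi).
split=> //.
- apply/GL2OP; rewrite det_mx2 !mx2E; split=> //; first vtac.
  have -> : N 0 0 * N 1 1 - pi * N 0 1 * (N 1 0 / pi) = \det N by rewrite det_mx2; field.
  by [].
- by split=> //; vtac.
rewrite !rescaleE // eA !transform_comp ?invr_eq0 //.
congr transform; rewrite ?mx2E; try by field; rewrite ?npi ?nmu ?oner_neq0.
by apply: mx2_eq; rewrite !mulmx2E !mx2E; field; rewrite ?npi.
Qed.

(** The matrix from the moved model to [A] is $NM^{-1}$, with lower left entry
    $(M_{11}N_{10}-M_{10}N_{11})/\det M$. By [double_at_transport] it is divisible by $\pi$,
    whatever choices the run made. *)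
Lemma procedure_step_adapted PQ A R : wf_model PQ -> integralb v PQ ->
  vPQ_eq v PQ 0 \/ vPQ_eq v PQ 1 -> oequiv v PQ A -> 
  [/\ vgeb v 2 (cn A), vgeb v 2 (cc A), vgeb v 2 (cd A) & vgeb v 2 (ce A)] ->
  procedure_step v pi PQ R -> oequiv v R (rescale pi A).
Proof.
move=> wf iPQ vPQ oA wA /(procedure_stepE wf iPQ vPQ).
move=> [PQ1 [M [PQ3 [wf1 o1 gM [hD y3 e3 ->]]]]].
have i1 := oequiv_integral h2 iPQ o1.
have [N [mu [r0 [r1 [r2 [gN umu hr eA]]]]]] := oequiv_trans h2 (oequiv_sym h2 wf o1) oA.
have /GL2OP[m00 m01 m10 m11 dM] := gM.
have kB : vgeb v 1 (M 1 1 * N 1 0 - M 1 0 * N 1 1).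
  by apply: (double_at_transport npi dvpi h2 i1 m10 m11 hD gN umu hr); rewrite -eA.
have wf3 := oequiv_wf (yequiv_oequiv y3).
have i3 := oequiv_integral h2 (oequiv_integral h2 i1 (linear_oequiv PQ1 gM)) (yequiv_oequiv y3).
have [hn _ _ he] := wA.
apply: rescale_oequiv => //; [exact: vgeb_le hn _|exact: vgeb_le he _|].
have [s0 [s1 [s2 [hs0 hs1 hs2 e32]]]] := (yequivE _ _ _).1 y3.
have gL := GL2O_mul gN (GL2O_inv gM).
have /GL2OP[l00 l01 l10 l11 _] := gL.
have imu := vunit_ge0 (vunitV umu); have nmu := vunit_neq0 umu.
have e21 : transform M 1 0 0 0 PQ1 = transform 1%:M 1 (- s0) (- s1) (- s2) PQ3.
  rewrite e32 transform_comp ?oner_neq0 // mul1mx scalar_mx2 !mx2E -[LHS]transform_id;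
    last exact: wf_transform.
  rewrite scalar_mx2; rewrite -scalar_mx2.
  by rewrite !(expr1n, expr0n, mulr1, mulr0, addr0, add0r, divr1) !addrN.
have e12 : PQ1 = transform (invmx M) 1 0 0 0 (transform M 1 0 0 0 PQ1).
  by rewrite -transform_mulmx mulVmx ?(GL2O_unitmx gM) // transform_id.
do 5!eexists; split; last first.
- by rewrite eA {1}e12 e21 !transform_comp ?oner_neq0 // mulr1.
- have [hr0 hr1 hr2] := hr.
  have /GL2OP[n00 n01 n10 n11 _] := gN.
  by rewrite !divr1; split; vtac.
- have idM := vunit_ge0 (vunitV dM).
  rewrite !mulmx2E invmx2E ?(vunit_neq0 dM) // !scalar_mx2 !mx2E.
  vring ((\det M)^-1 * (M 1 1 * N 1 0 - M 1 0 * N 1 1)).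
- by rewrite !mulr1.
- by rewrite mulmx1.
Qed.

(** The index [s] of the adapted model drops by one at each step, and [s] equal to 0 means
    $v(P,Q)\ge2$. Between the steps [R] is integral as an equivalent of the rescaled adapted model;
    so unless $v(P,Q)\ge2$ already holds for it, its value is again 0 or 1 and the argument
    repeats. *)
Lemma two_steps PQ R : wf_model PQ -> integralb v PQ -> discPQ PQ != 0 ->
  vPQ_eq v PQ 0 \/ vPQ_eq v PQ 1 -> nonminimal v PQ -> procedure_step v pi PQ R ->
  vPQ_ge v R 2 \/ (forall R', procedure_step v pi R R' -> vPQ_ge v R' 2).
Proof.
have wfstep A B : wf_model A -> integralb v A -> vPQ_eq v A 0 \/ vPQ_eq v A 1 ->
    procedure_step v pi A B -> wf_model B.
  move=> wf iA vA /(procedure_stepE wf iA vA)[? [? [? [_ _ _ [_ _ _ ->]]]]].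
  exact: wf_rescale.
move=> wf iPQ nd vPQ nm hR.
have [s [A [hs oA aA]]] := nonminimal_adapted npi dvpi h2 wf iPQ nd nm.
have n2 : ~ vPQ_ge v PQ 2.
  case: vPQ => [] [_ h] hv; apply: h => //.
  case: hv => A' [yA' [hP hQ]]; exists A'; split=> //; split=> i.
    by case: (hP i) => h; [left|right; move: h; lia].
  by case: (hQ i) => h; [left|right; move: h; lia].
case: s hs aA => [|s] hs aA.
  by case: n2; exact: (adapted0_vPQ_ge h2 wf oA aA).
have [iA wA] := adapted_weak (hs : (0 < s.+1 <= 2)%N) aA.
have oR := procedure_step_adapted wf iPQ vPQ oA wA hR.
have aR := rescale_adapted npi dvpi hs aA.
have wfR := wfstep _ _ wf iPQ vPQ hR.
case: s hs aA aR => [|[|//]] hs aA aR.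
  by left; exact: (adapted0_vPQ_ge h2 wfR oR aR).
case: (classic (vPQ_ge v R 2)) => [?|nR]; [by left|right=> R' hR'].
have [iA' wA'] := adapted_weak (isT : (0 < 1 <= 2)%N) aR.
have iR := oequiv_integral h2 iA' (oequiv_sym h2 wfR oR).
have vR : vPQ_eq v R 0 \/ vPQ_eq v R 1.
  case: (classic (vPQ_ge v R 1)) => h1; [by right|left; split=> //].
  have /(integralP v wfR)[hP hQ] := iR.
  exists R; split; first by apply/yequivE; exists 0, 0, 0; rewrite transform_id // vgeb0.
  by split; [move=> i; apply: vge2_0; exact: hP|exact: hQ].
have oR' := procedure_step_adapted wfR iR vR oR wA' hR'.
have aR' := rescale_adapted npi dvpi (isT : (0 <= 1)%N) aR.
exact: (adapted0_vPQ_ge h2 (wfstep _ _ wfR iR vR hR') oR' aR').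
Qed.
End Iteration.

(** * Consequences of positive level *)

Section PositiveLevel.
Variables (K : fieldType) (v : dvaluation K).
Implicit Types (PQ A B : model K) (M N U V : 'M[K]_2).
Hypothesis h2 : vgeb v 1 2%:R.

Section Coefficients.
Variable PQ : model K.
Hypotheses (iPQ : integralb v PQ) (nmin : nonminimal_weier v (jacobian PQ)).
Let l := cl PQ. Let m := cm PQ. Let n := cn PQ.
Let a := ca PQ. Let b := cb PQ. Let c := cc PQ. Let d := cd PQ. Let e := ce PQ.
Let a2 := c - l * n.
Let a3 := n * b + l * d.
Let a4 := b * d - 4%:R * a * e - n ^+ 2 * a - l * n * c - l ^+ 2 * e.
Let a6 := b ^+ 2 * e + a * d ^+ 2 - 4%:R * a * c * e - n ^+ 2 * a * c
  + m * n * a * d - m ^+ 2 * a * e - l * n * b * d + l * m * b * e - l ^+ 2 * c * e.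

Let hPQ : [/\ vgeb v 0 l, vgeb v 0 m, vgeb v 0 n & [/\ vgeb v 0 a, vgeb v 0 b, vgeb v 0 c,
   vgeb v 0 d & vgeb v 0 e]].
Proof. by case/andP: iPQ => /and3P[? ? ?] /and5P[]. Qed.

Let hjac : [/\ vgeb v 0 a2, vgeb v 0 a3, vgeb v 0 a4 & vgeb v 0 a6].
Proof.
have [hl hm hn [ha hb hc hd he]] := hPQ.
by split; rewrite /a2 /a3 /a4 /a6; vtac.
Qed.

Lemma positive_level_m : vgeb v 1 m.
Proof.
have [_ hm _ _] := hPQ; have [h2' h3 h4 h6] := hjac.
exact: (nonminimal_weier_a1 h2 hm h2' h3 h4 h6 nmin).
Qed.

(** This is the case $Q_1=P$ with the root at $(0:1)$. As $a_3=nb+ld$ with $l$ a unit, $\pi\mid d$;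
    then $\pi$ divides $a_4$ and $a_6$, so Tate's algorithm passes type II and yields congruences
    mod $\pi^2$. *)
Lemma positive_level_case1 : ~~ vgeb v 1 l -> vgeb v 1 n -> vgeb v 1 e ->
  vgeb v 1 d /\ vgeb v 2 e.
Proof.
move=> ul kn ke.
have [hl hm _ [ha hb hc hd _]] := hPQ; have [h2' h3 h4 h6] := hjac.
have km := positive_level_m.
have k3 := nonminimal_weier_a3 h2 hm h2' h3 h4 h6 nmin.
have kd : vgeb v 1 d.
  by apply: (vgeb_mull_unit ul); vring_unfold a3 (a3 - n * b).
have [] := nonminimal_weier_pi2 h2 hm h2' h3 h4 h6 nmin.
- by rewrite /a4; vtac.
- by rewrite /a6; vtac.
rewrite -/a3 -/a4 -/a6 => q3 q4 q6; split=> //.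
have qe : vgeb v 2 (e * (b ^+ 2 - l ^+ 2 * c)).
  vring_unfold a6 (a6 - a * d ^+ 2 + 4%:R * a * c * e + n ^+ 2 * a * c
  - m * n * a * d + m ^+ 2 * a * e + l * n * b * d - l * m * b * e).
(* If $b^2-l^2c$ is a unit, the congruence from $a_6$ suffices. Otherwise $ba_3-la_4$, in which
   $lbd$ cancels, isolates $l^3e$. *)
case: (boolP (vgeb v 1 (b ^+ 2 - l ^+ 2 * c))) => [kb|]; last by move/vgeb_mulr_unit; exact.
apply: (vgeb_mull_unit ul); apply: (vgeb_mull_unit ul); apply: (vgeb_mull_unit ul).
have -> : l * (l * (l * e)) = b * a3 - n * (b ^+ 2 - l ^+ 2 * c) - 2%:R * l ^+ 2 * c * n
    - 4%:R * l * a * e - l * n ^+ 2 * a - l * a4.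
  by rewrite /a3 /a4; ring.
vtac.
Qed.

Lemma positive_level_case2 : Pge v 1 PQ -> ~~ vgeb v 1 b -> vgeb v 1 d -> vgeb v 1 e ->
  vgeb v 2 e.
Proof.
have [_ hm _ [ha hb hc _ _]] := hPQ; have [h2' h3 h4 h6] := hjac.
rewrite /Pge -/l -/m -/n => /and3P[kl km kn] ub kd ke.
have [] := nonminimal_weier_pi2 h2 hm h2' h3 h4 h6 nmin.
- by rewrite /a4; vtac.
- by rewrite /a6; vtac.
rewrite -/a3 -/a4 -/a6 => q3 q4 q6.
apply: (vgeb_mull_unit ub); apply: (vgeb_mull_unit ub).
vring_unfold a6 (a6 - (a * d ^+ 2 - 4%:R * a * c * e - n ^+ 2 * a * c
  + m * n * a * d - m ^+ 2 * a * e - l * n * b * d + l * m * b * e - l ^+ 2 * c * e)).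
Qed.

(** With $\pi$ dividing $P$ and $Q$, $a_2\equiv c$ mod $\pi^2$, $a_4\equiv bd$ mod $\pi^3$ and
    $a_6\equiv b^2e+ad^2$ mod $\pi^4$; the triple root conditions on the Jacobian become conditions
    on $Q$. *)
Lemma positive_level_case3 : Pge v 1 PQ -> Qge v 1 PQ ->
  vgeb v 3 (b * d - c ^+ 2) /\ vgeb v 4 (b ^+ 2 * e + a * d ^+ 2 - b * c * d).
Proof.
have [_ hm _ _] := hPQ; have [h2' h3 h4 h6] := hjac.
rewrite /Pge /Qge -/l -/m -/n -/a -/b -/c -/d -/e.
move=> /and3P[kl km kn] /and5P[ka kb kc kd ke].
have [] := nonminimal_weier_triple h2 hm h2' h3 h4 h6 nmin.
- by rewrite /a2; vtac.
- by rewrite /a3; vtac.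
- by rewrite /a4; vtac.
- by rewrite /a6; vtac.
move=> q4 q6; have {}q4 : vgeb v 3 (a4 - a2 ^+ 2) := q4.
have {}q6 : vgeb v 4 (a6 - a2 * a4) := q6; split.
- have -> : b * d - c ^+ 2 = (a4 - a2 ^+ 2) + 4%:R * a * e + n ^+ 2 * a + l * n * c
     + l ^+ 2 * e - 2%:R * c * l * n + l ^+ 2 * n ^+ 2 by rewrite /a4 /a2; ring.
  vtac.
have -> : b ^+ 2 * e + a * d ^+ 2 - b * c * d = (a6 - a2 * a4) + 4%:R * a * c * e
   + n ^+ 2 * a * c - m * n * a * d + m ^+ 2 * a * e + l * n * b * d - l * m * b * e
   + l ^+ 2 * c * e + c * (a4 - b * d) - l * n * a4 by rewrite /a6 /a4 /a2; ring.
have k4 : vgeb v 2 a4 by rewrite /a4; vtac.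
have k4' : vgeb v 3 (a4 - b * d).
  vring_unfold a4 (- (4%:R * a * e + n ^+ 2 * a + l * n * c + l ^+ 2 * e)).
vtac.
Qed.
End Coefficients.

(* In the quartic case the last two conditions say that the invariants [I] and [J]
   vanish mod [pi]. *)
Definition Q1_shape (dg : nat) (F : {poly K}) : Prop :=
  (forall i, vgeb v 0 F`_i) /\
  ([/\ dg = 2%N, (size F <= 3)%N, vgeb v 1 F`_1 & ~~ (vgeb v 1 F`_2 && vgeb v 1 F`_0)] \/
   [/\ dg = 4%N, (size F <= 5)%N, exists i, ~~ vgeb v 1 F`_i &
     vgeb v 1 (F`_3 * F`_1 - F`_2 ^+ 2) /\
     vgeb v 1 (F`_3 ^+ 2 * F`_0 + F`_4 * F`_1 ^+ 2 - F`_3 * F`_2 * F`_1)]).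

Variable pi : K.
Hypotheses (npi : pi != 0) (dvpi : dv v pi = 1) (perfect : residue_perfect v).
Let hpi := vgeb_pi dvpi.

Lemma isQ1_shape PQ dg F : wf_model PQ -> integralb v PQ ->
  nonminimal_weier v (jacobian PQ) -> isQ1 v pi PQ dg F -> Q1_shape dg F.
Proof.
move=> wf iPQ nm; have km := positive_level_m iPQ nm.
have /(integralP v wf)[iP iQ] := iPQ.
have [/and3P[hl hm hn] /and5P[ha hb hc hd he]] := andP iPQ.
case=> [[nP [-> ->]]|[[hP [[_ nv] [-> ->]]]|[hP [hQ [nQ [-> ->]]]]]].
- split; first by move=> i; apply/vgeP; exact: iP.
  left; split=> //; first by case: wf.
  by apply/negP => /andP[kl kn]; apply: nP; apply/(PgeP v 1 wf)/and3P.
- have /(PgeP v _ wf) {}hP := hP.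
  have cD i : (dxdz PQ.2)`_i = if i == 2 then 3%:R * cb PQ else
      if i == 1 then 4%:R * cc PQ else if i == 0 then 3%:R * cd PQ else 0.
    by rewrite /dxdz !coefE; case: i => [|[|[|i]]] /=; rewrite ?mulr0 ?mulr1 ?add0r ?addr0.
  split; first by move=> i; rewrite cD; case: i => [|[|[|i]]] /=; vtac.
  left; split=> //.
  + by apply/leq_sizeP => -[|[|[|i]]] //; rewrite cD.
  + by rewrite cD /=; vtac.
  rewrite !cD /=; apply/negP => /andP[kb kd]; apply: nv.
  have u3 := vunit_ge1 (vunit3 h2).
  by apply: (vPQ_ge1_odd h2 perfect iPQ hP); apply: (vgeb_mull_unit u3).
have /(PgeP v _ wf) {}hP := hP; have /(QgeP v _ wf) {}hQ' := hQ.
have [kk1 kk2] := positive_level_case3 iPQ nm hP hQ'.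
have div1 k x : vgeb v k.+1 x -> vgeb v k (pi^-1 * x).
  by move=> h; have := vgeb_pidiv npi dvpi (j := 1) (k := k) h; rewrite expr1 mulrC.
split; first by move=> i; rewrite coefZ; apply: div1; apply/vgeP; exact: hQ.
right; split=> //.
- by case: wf => _; apply: leq_trans; exact: size_scale_leq.
- have : ~~ Qge v 2 PQ by apply/negP => /(QgeP v _ wf).
  have dv' i : vgeb v 1 (pi^-1 *: PQ.2)`_i -> vgeb v 2 PQ.2`_i.
    rewrite coefZ => h; have -> : PQ.2`_i = pi * (pi^-1 * PQ.2`_i) by rewrite mulVKf.
    exact: (vgebM (i := 1) (j := 1)).
  rewrite /Qge !negb_and; case/or4P => [h|h|h|/orP[h|h]];
    [exists 4%N|exists 3%N|exists 2%N|exists 1%N|exists 0%N];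
    by apply: contra h => /dv'.
rewrite !coefZ -!/(ca PQ) -!/(cb PQ) -!/(cc PQ) -!/(cd PQ) -!/(ce PQ); split.
- have -> : pi^-1 * cb PQ * (pi^-1 * cd PQ) - (pi^-1 * cc PQ) ^+ 2 =
    (cb PQ * cd PQ - cc PQ ^+ 2) / pi ^+ 2 by field.
  exact: vgeb_pidiv.
set x := _ - _; have -> : x = (cb PQ ^+ 2 * ce PQ + ca PQ * cd PQ ^+ 2
   - cb PQ * cc PQ * cd PQ) / pi ^+ 3 by rewrite /x; field.
exact: vgeb_pidiv.
Qed.
End PositiveLevel.

(** * The repeated root *)

Section RepeatedRoot.
Variables (K : fieldType) (v : dvaluation K).
Hypotheses (h2 : vgeb v 1 2%:R) (perfect : residue_perfect v).

Lemma double_root_modpi_quadratic (F : {poly K}) x0 z0 g :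
  (size F <= 3)%N -> vgeb v 0 x0 -> vgeb v 0 z0 -> ~~ (vgeb v 1 x0 && vgeb v 1 z0) ->
  vgeb v 0 g -> vgeb v 1 F`_1 ->
  vgeb v 1 (F`_2 - z0 ^+ 2 * g) -> vgeb v 1 (F`_0 - x0 ^+ 2 * g) ->
  double_root_modpi v 2 F x0 z0.
Proof.
move=> sF hx hz nxz hg k1 k2 k0; split; [exact/vgeP|split; [exact/vgeP|split]].
  by move=> [/vgeP kx /vgeP kz]; move: nxz; rewrite kx kz.
exists (Poly [:: g]); split; first exact: size_Poly.
split=> i; first by apply/vgeP; rewrite coef_Poly; case: i => [|i] //=; rewrite nth_nil vgeb0.
apply/vgeP; rewrite coefB coef_double_root !coef_Poly; case: i => [|[|[|i]]] /=.
- by apply: vgeb_eq k0; ring.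
- have {}k1 : vgeb v 1 (F`_1 + 2%:R * x0 * z0 * g) by vtac.
  by apply: vgeb_eq k1; ring.
- by apply: vgeb_eq k2; ring.
rewrite (nth_default _ (leq_trans sF _)) //.
by case: i => [|i] /=; rewrite ?nth_nil !mulr0 addr0 subrr ?subr0 vgeb0.
Qed.

Lemma double_root_modpi_quartic (F : {poly K}) x0 z0 g0 g1 g2 :
  (size F <= 5)%N -> vgeb v 0 x0 -> vgeb v 0 z0 -> ~~ (vgeb v 1 x0 && vgeb v 1 z0) ->
  [/\ vgeb v 0 g0, vgeb v 0 g1 & vgeb v 0 g2] ->
  [/\ vgeb v 1 (F`_4 - z0 ^+ 2 * g2), vgeb v 1 (F`_3 - z0 ^+ 2 * g1),
      vgeb v 1 (F`_2 - z0 ^+ 2 * g0 - x0 ^+ 2 * g2), vgeb v 1 (F`_1 - x0 ^+ 2 * g1)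
    & vgeb v 1 (F`_0 - x0 ^+ 2 * g0)] ->
  double_root_modpi v 4 F x0 z0.
Proof.
move=> sF hx hz nxz [hg0 hg1 hg2] [k4 k3 k2 k1 k0].
split; [exact/vgeP|split; [exact/vgeP|split]].
  by move=> [/vgeP kx /vgeP kz]; move: nxz; rewrite kx kz.
exists (Poly [:: g0; g1; g2]); split; first exact: size_Poly.
split=> i; apply/vgeP; rewrite ?coefB ?coef_double_root !coef_Poly.
  by case: i => [|[|[|i]]] //=; rewrite nth_nil vgeb0.
case: i => [|[|[|[|[|i]]]]] /=.
- by apply: vgeb_eq k0; ring.
- have {}k1 : vgeb v 1 (F`_1 - x0 ^+ 2 * g1 + 2%:R * x0 * z0 * g0) by vtac.
  by apply: vgeb_eq k1; ring.
- have {}k2 : vgeb v 1 (F`_2 - z0 ^+ 2 * g0 - x0 ^+ 2 * g2 + 2%:R * x0 * z0 * g1) by vtac.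
  by apply: vgeb_eq k2; ring.
- have {}k3 : vgeb v 1 (F`_3 - z0 ^+ 2 * g1 + 2%:R * x0 * z0 * g2) by vtac.
  by apply: vgeb_eq k3; ring.
- by apply: vgeb_eq k4; ring.
rewrite (nth_default _ (leq_trans sF _)) //.
by case: i => [|i] /=; rewrite ?nth_nil !mulr0 addr0 subrr ?subr0 vgeb0.
Qed.

(** Perfectness of $k$ supplies the square roots that make the root rational. The normalised
    coordinates let [procedure_step_exists] complete the root to a matrix in $GL_2(O_K)$. *)
Lemma Q1_shape_root dg F : Q1_shape v dg F ->
  exists x0 z0, double_root_modpi v dg F x0 z0 /\ (z0 = 1 \/ x0 = 1 /\ z0 = 0).
Proof.
have u1 := vgeb1_unit v; have h11 := vgeb1 v.
have nx1 x : ~~ (vgeb v 1 x && vgeb v 1 1) by rewrite negb_and u1 orbT.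
have n1x x : ~~ (vgeb v 1 1 && vgeb v 1 x) by rewrite negb_and u1.
move=> [hF [[-> sF k1 nF]|[-> sF nF [kI kJ]]]].
  have f0 := hF 0%N; have f2 := hF 2%N.
  case: (boolP (vgeb v 1 F`_2)) => k2.
    exists 1, 0; split; last by right.
    by apply: (@double_root_modpi_quadratic _ _ _ F`_0);
      rewrite // ?expr1n ?mul1r ?subrr; vtac.
  have u2 := vunitI f2 k2; have i2 := vunit_ge0 (vunitV u2); have n2 := vunit_neq0 u2.
  have [|x hx kx] := sqrt_mod h2 perfect (x := F`_0 / F`_2); first vtac.
  exists x, 1; split; last by left.
  apply: (@double_root_modpi_quadratic _ _ _ F`_2) => //;
    first by rewrite expr1n mul1r subrr vgeb0.
  have -> : F`_0 - x ^+ 2 * F`_2 = F`_2 * (F`_0 / F`_2 - x ^+ 2) by field.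
  have {}kx : vgeb v 1 (F`_0 / F`_2 - x ^+ 2) := kx.
  vtac.
have f0 := hF 0%N; have f1 := hF 1%N; have f2 := hF 2%N; have f3 := hF 3%N.
have f4 := hF 4%N; case: (boolP (vgeb v 1 F`_3)) => k3; last first.
  have u3 := vunitI f3 k3; have i3 := vunit_ge0 (vunitV u3); have n3 := vunit_neq0 u3.
  (* In characteristic 2 the derivative of the quartic is $F_3x^2+F_1$, and its only root
     $\sqrt{F_1/F_3}$ equals $F_2/F_3$ because $F_3F_1\equiv F_2^2$. *)
  exists (F`_2 / F`_3), 1; split; last by left.
  set x := F`_2 / F`_3; have hx : vgeb v 0 x by rewrite /x; vtac.
  have kd : vgeb v 1 (F`_1 - x ^+ 2 * F`_3).
    have -> : F`_1 - x ^+ 2 * F`_3 = (F`_3)^-1 * (F`_3 * F`_1 - F`_2 ^+ 2) by rewrite /x; field.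
    vtac.
  have kg : vgeb v 0 (F`_2 - x ^+ 2 * F`_4) by vtac.
  apply: (@double_root_modpi_quartic _ _ _ (F`_2 - x ^+ 2 * F`_4) F`_3 F`_4) => //.
  split=> //; rewrite ?expr1n ?mul1r ?subrr ?vgeb0 //.
    by vring (0 : K).
  have -> : F`_0 - x ^+ 2 * (F`_2 - x ^+ 2 * F`_4) =
    (F`_3)^-1 ^+ 2 * (F`_3 ^+ 2 * F`_0 + F`_4 * F`_1 ^+ 2 - F`_3 * F`_2 * F`_1)
    + F`_2 * (F`_3)^-1 * (F`_1 - x ^+ 2 * F`_3)
    - F`_4 * (F`_3)^-1 ^+ 2 * (F`_1 - x ^+ 2 * F`_3) * (F`_1 + x ^+ 2 * F`_3).
    by rewrite /x; field.
  vtac.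
have k2 : vgeb v 1 F`_2.
  by apply: (vgeb_sqr_odd (k := 0)); vring (F`_3 * F`_1 - (F`_3 * F`_1 - F`_2 ^+ 2)).
case: (boolP (vgeb v 1 F`_4)) => k4.
  exists 1, 0; split; last by right.
  apply: (@double_root_modpi_quartic _ _ _ F`_0 F`_1 F`_2) => //; first exact: vgeb0.
  by rewrite !expr0n /= !mul0r !subr0 !expr1n !mul1r !subrr vgeb0.
have k1 : vgeb v 1 F`_1.
  apply: (vgeb_sqr_odd (k := 0)); apply: (vgeb_mull_unit k4).
  vring (F`_3 ^+ 2 * F`_0 + F`_4 * F`_1 ^+ 2 - F`_3 * F`_2 * F`_1
     - F`_3 ^+ 2 * F`_0 + F`_3 * F`_2 * F`_1).
have u4 := vunitI f4 k4; have i4 := vunit_ge0 (vunitV u4); have n4 := vunit_neq0 u4.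
(* Here $F\equiv F_4x^4+F_0z^4$ is a multiple of a fourth power, so two successive square roots are
   taken. *)
have [|s hs ks] := sqrt_mod h2 perfect (x := F`_0 / F`_4); first vtac.
have [x hx kx] := sqrt_mod h2 perfect hs.
exists x, 1; split; last by left.
apply: (@double_root_modpi_quartic _ _ _ (x ^+ 2 * F`_4) 0 F`_4) => //.
  by split=> //; vtac.
split; rewrite ?mulr0 ?subr0 //; first by rewrite expr1n mul1r subrr vgeb0.
  have -> : F`_2 - 1 ^+ 2 * (x ^+ 2 * F`_4) - x ^+ 2 * F`_4 = F`_2 - 2%:R * x ^+ 2 * F`_4 by ring.
  vtac.
have -> : F`_0 - x ^+ 2 * (x ^+ 2 * F`_4) =
  F`_4 * (F`_0 / F`_4 - s ^+ 2 + (s - x ^+ 2) * (s + x ^+ 2)) by field.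
have {}ks : vgeb v 1 (F`_0 / F`_4 - s ^+ 2) := ks.
have {}kx : vgeb v 1 (s - x ^+ 2) := kx.
vtac.
Qed.

(** * Reduction into a field containing the residue field *)

Section ResidueEmbedding.
Variables (L : fieldType) (rho : K -> L).
Hypothesis hrho : residue_embedding v rho.

Lemma rho_eq0 x : vgeb v 0 x -> (rho x == 0) = vgeb v 1 x.
Proof.
case: hrho => _ [_ h] /vgeP hx.
by apply/eqP/idP => [/(h _ hx)/vgeP|/vgeP/(h _ hx)].
Qed.

Lemma rhoM x y : vgeb v 0 x -> vgeb v 0 y -> rho (x * y) = rho x * rho y.
Proof. by case: hrho => h _ /vgeP hx /vgeP hy; case: (h x y hx hy). Qed.

Lemma rhoD x y : vgeb v 0 x -> vgeb v 0 y -> rho (x + y) = rho x + rho y.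
Proof. by case: hrho => h _ /vgeP hx /vgeP hy; case: (h x y hx hy). Qed.

Lemma rho0 : rho 0 = 0.
Proof. by apply/eqP; rewrite rho_eq0 vgeb0. Qed.

Lemma rhoN x : vgeb v 0 x -> rho (- x) = - rho x.
Proof.
move=> hx; apply/eqP; rewrite -addr_eq0 -rhoD ?addNr ?rho0 //; vtac.
Qed.

Lemma rhoX x n : vgeb v 0 x -> rho (x ^+ n) = rho x ^+ n.
Proof.
move=> hx; elim: n => [|n IHn]; first by rewrite !expr0; case: hrho => _ [].
by rewrite !exprS rhoM ?IHn //; have := vgebX n hx; rewrite muln0.
Qed.

Lemma rho2 : 2%:R = 0 :> L.
Proof.
case: hrho => _ [r1 _]; have h1 := vgeb1 v.
have <- : rho 2%:R = 2%:R by rewrite !mulr2n rhoD // r1.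
by apply/eqP; rewrite rho_eq0 //; vtac.
Qed.

Lemma rho_map (F : {poly K}) i : (map_poly rho F)`_i = rho F`_i.
Proof. by rewrite coef_map_id0 ?rho0. Qed.

Lemma double_root_rho dg (F : {poly K}) x0 z0 : (forall i, vgeb v 0 F`_i) ->
  double_root_modpi v dg F x0 z0 -> double_root dg (map_poly rho F) (rho x0) (rho z0).
Proof.
move=> hF [/vgeP hx [/vgeP hz [nxz [G [sG [hG hFG]]]]]].
have {}hG i : vgeb v 0 G`_i by apply/vgeP; exact: hG.
split.
  rewrite !rho_eq0 //; case: (boolP (vgeb v 1 x0)) => kx; last by left.
  by right; apply/negP => kz; apply: nxz; split; exact/vgeP.
exists (map_poly rho G); split; first exact: leq_trans (size_poly _ _) sG.
apply/polyP => i; rewrite coef_double_root !rho_map; move: (hFG i) => /vgeP.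
rewrite coefB coef_double_root.
set g1 := if (i < 2)%N then _ else _; set g2 := if i == 0%N then _ else _.
have -> : (if (i < 2)%N then 0 else rho G`_(i - 2)) = rho g1.
  by rewrite /g1; case: ifP => _; rewrite ?rho0.
have -> : (if i == 0%N then 0 else rho G`_i.-1) = rho g2.
  by rewrite /g2; case: ifP => _; rewrite ?rho0.
have hg1 : vgeb v 0 g1 by rewrite /g1; case: ifP => _; rewrite ?vgeb0.
have hg2 : vgeb v 0 g2 by rewrite /g2; case: ifP => _; rewrite ?vgeb0.
move=> k; have f := hF i; have g := hG i.
have e : vgeb v 1 (F`_i - (z0 ^+ 2 * g1 + x0 ^+ 2 * G`_i)).
  have k' : vgeb v 1 (2%:R * x0 * z0 * g2) by vtac.
  by apply: vgeb_eq (vgebD_same k (vgebN k')); ring.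
have h : vgeb v 0 (F`_i - (z0 ^+ 2 * g1 + x0 ^+ 2 * G`_i)) by exact: vgeb_le e _.
have hz1 : vgeb v 0 (z0 ^+ 2 * g1) by vtac.
have hx1 : vgeb v 0 (x0 ^+ 2 * G`_i) by vtac.
have hx2 : vgeb v 0 (x0 ^+ 2) by vtac.
have hz2 : vgeb v 0 (z0 ^+ 2) by vtac.
move: e; rewrite -(rho_eq0 h) rhoD ?rhoN ?vgebN ?rhoD ?rhoM ?rhoX //; last 2 first.
- exact: vgebD_same.
- exact: vgebD_same.
rewrite subr_eq0 => /eqP ->; rewrite rho2; ring.
Qed.
End ResidueEmbedding.

(* In characteristic 2 the quadratic form [a x^2 + c z^2] is a multiple of a square. *)
Lemma double_root2_unique (L : fieldType) (F : {poly L}) x0 z0 x1 z1 :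
  2%:R = 0 :> L -> (F`_2 != 0) || (F`_0 != 0) ->
  double_root 2 F x0 z0 -> double_root 2 F x1 z1 -> x1 * z0 = x0 * z1.
Proof.
move=> c2 nF.
have dr x z : double_root 2 F x z -> exists g, F`_2 = z ^+ 2 * g /\ F`_0 = x ^+ 2 * g.
  move=> [_ [G [sG eF]]]; exists G`_0; rewrite eF !coef_double_root /= c2.
  rewrite [G`_1]nth_default ?[G`_2]nth_default ?(leq_trans sG) //.
  by split; ring.
move=> /dr[g [e2 e0]] /dr[g1 [e2' e0']].
have ng : g != 0.
  by apply: contraTneq nF => g0; rewrite e2 e0 g0 !mulr0 eqxx.
have ng1 : g1 != 0.
  by apply: contraTneq nF => g0; rewrite e2' e0' g0 !mulr0 eqxx.
apply/eqP; rewrite -subr_eq0 -sqrf_eq0.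
have : g * g1 * (x1 * z0 - x0 * z1) ^+ 2 = 0.
  have -> : g * g1 * (x1 * z0 - x0 * z1) ^+ 2 = (x1 ^+ 2 * g1) * (z0 ^+ 2 * g)
     + (x0 ^+ 2 * g) * (z1 ^+ 2 * g1) - 2%:R * (g * g1 * x1 * z0 * x0 * z1) by ring.
  rewrite -e2 -e0' -e2' -e0 c2 mul0r subr0 -mulr2n -mulr_natl c2; ring.
by move/eqP; rewrite !mulf_eq0 (negbTE ng) (negbTE ng1).
Qed.

(* The vanishing of [I] and [J] forces the repeated root to be at least triple. *)
Lemma double_root4_unique (L : fieldType) (F : {poly L}) x0 z0 x1 z1 :
  2%:R = 0 :> L -> (exists i, F`_i != 0) ->
  F`_3 * F`_1 = F`_2 ^+ 2 ->
  F`_3 ^+ 2 * F`_0 + F`_4 * F`_1 ^+ 2 = F`_3 * F`_2 * F`_1 ->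
  double_root 4 F x0 z0 -> double_root 4 F x1 z1 -> x1 * z0 = x0 * z1.
Proof.
move=> c2 nF eI eJ.
have F5 x z i : double_root 4 F x z -> F`_i.+1.+4 = 0.
  move=> [_ [G [sG ->]]]; rewrite coef_double_root /= subSS subn1.
  by rewrite !nth_default ?(leq_trans sG) //; ring.
have dr x z : double_root 4 F x z -> exists g0 g1 g2, [/\ F`_4 = z ^+ 2 * g2,
    F`_3 = z ^+ 2 * g1, F`_2 = z ^+ 2 * g0 + x ^+ 2 * g2, F`_1 = x ^+ 2 * g1
    & F`_0 = x ^+ 2 * g0].
  move=> [_ [G [sG eF]]]; exists G`_0, G`_1, G`_2; rewrite eF !coef_double_root /= c2.
  rewrite [G`_3]nth_default ?[G`_4]nth_default ?(leq_trans sG) //.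
  by split; ring.
have sq0 (y w : L) : y ^+ 2 = w ^+ 2 -> y = w.
  move=> h; apply/eqP; rewrite -subr_eq0 -sqrf_eq0.
  have -> : (y - w) ^+ 2 = y ^+ 2 - w ^+ 2 + 2%:R * (w ^+ 2 - y * w) by ring.
  by rewrite h c2 mul0r addr0 subrr.
(* The two linear relations determine $(x:z)$ unless $F_1=F_2=F_3=0$; the third relation covers that
   case, where $F$ is a multiple of a fourth power. *)
have fx x z : double_root 4 F x z -> [/\ F`_2 * z = F`_3 * x, F`_1 * z = F`_2 * x &
    F`_3 = 0 -> F`_1 = 0 -> F`_4 * x ^+ 4 = F`_0 * z ^+ 4].
  move=> /dr[g0 [g1 [g2 [e4 e3 e2 e1 e0]]]].
  have e2' : F`_2 = x * z * g1.
    by apply: sq0; rewrite -eI e3 e1; ring.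
  split; [rewrite e2' e3; ring|rewrite e2' e1; ring|].
  move=> e30 e10; have e20 : F`_2 = 0.
    by apply/eqP; rewrite -sqrf_eq0 -eI e30 mul0r.
  have -> : F`_4 * x ^+ 4 = z ^+ 2 * x ^+ 2 * (x ^+ 2 * g2) by rewrite e4; ring.
  have -> : x ^+ 2 * g2 = - (z ^+ 2 * g0) by apply/eqP; rewrite -addr_eq0 addrC -e2 e20.
  have -> : F`_0 * z ^+ 4 = z ^+ 2 * x ^+ 2 * (z ^+ 2 * g0) by rewrite e0; ring.
  have -> : - (z ^+ 2 * g0) = z ^+ 2 * g0 - 2%:R * (z ^+ 2 * g0) by ring.
  by rewrite c2 mul0r subr0.
move=> d0 d1; have [a1 a2 a3] := fx _ _ d0; have [b1 b2 b3] := fx _ _ d1.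
case: (eqVneq F`_3 0) => [e3|n3]; last first.
  apply: (mulfI n3); rewrite mulrA -b1 mulrA -a1; ring.
have e2 : F`_2 = 0 by apply/eqP; rewrite -sqrf_eq0 -eI e3 mul0r.
have [nxz0 _] := d0; have [nxz1 _] := d1.
case: (eqVneq F`_1 0) => [e1|n1]; last first.
  have z00 : z0 = 0 by apply: (mulfI n1); rewrite a2 e2; ring.
  have z10 : z1 = 0 by apply: (mulfI n1); rewrite b2 e2; ring.
  by rewrite z00 z10; ring.
have {}a3 := a3 e3 e1; have {}b3 := b3 e3 e1.
case: (eqVneq F`_4 0) => [e4|n4].
  have n0 : F`_0 != 0.
    case: nF => -[|[|[|[|[|i]]]]] //; rewrite ?e1 ?e2 ?e3 ?e4 ?eqxx //.
    by rewrite (F5 _ _ _ d0) eqxx.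
  have zz z : F`_4 * x0 ^+ 4 = F`_0 * z ^+ 4 -> z = 0.
    by move/eqP; rewrite e4 mul0r eq_sym mulf_eq0 (negbTE n0) expf_eq0 => /eqP.
  have z00 := zz _ a3; have z10 : z1 = 0.
    by move/eqP: b3; rewrite e4 mul0r eq_sym mulf_eq0 (negbTE n0) expf_eq0 => /eqP.
  by rewrite z00 z10; ring.
apply/sq0/sq0/(mulfI n4).
have -> : F`_4 * ((x1 * z0) ^+ 2) ^+ 2 = F`_4 * x1 ^+ 4 * z0 ^+ 4 by ring.
have -> : F`_4 * ((x0 * z1) ^+ 2) ^+ 2 = F`_4 * x0 ^+ 4 * z1 ^+ 4 by ring.
rewrite a3 b3; ring.
Qed.

Lemma Q1_shape_unique_root dg F : Q1_shape v dg F -> unique_rational_double_root v dg F.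
Proof.
move=> sF L rho hrho; have [x0 [z0 [hD _]]] := Q1_shape_root sF.
have [hF _] := sF; have [hx [hz _]] := hD.
exists x0, z0; split=> //; split=> //.
have dD := double_root_rho hrho hF hD; split=> // x1 z1 dD1.
have c2 := rho2 hrho; have r0 i : (rho F`_i == 0) = vgeb v 1 F`_i by rewrite (rho_eq0 hrho).
have f0 := hF 0%N; have f1 := hF 1%N; have f2 := hF 2%N; have f3 := hF 3%N.
have f4 := hF 4%N; case: sF => _ [[edg _ k1 nF]|[edg _ nF [kI kJ]]]; subst dg.
  apply: (double_root2_unique c2 _ dD dD1).
  by rewrite !(rho_map hrho) !r0 -negb_and.
apply: (double_root4_unique c2 _ _ _ dD dD1); rewrite ?(rho_map hrho).
- by case: nF => i ni; exists i; rewrite (rho_map hrho) r0.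
- have g1 : vgeb v 0 (F`_3 * F`_1) by vtac.
  have g2 : vgeb v 0 (F`_2 ^+ 2) by vtac.
  have h : vgeb v 0 (F`_3 * F`_1 - F`_2 ^+ 2) by vtac.
  move: kI; rewrite -(rho_eq0 hrho h) (rhoD hrho) ?vgebN // (rhoN hrho) //.
  by rewrite (rhoM hrho) // (rhoX hrho) // subr_eq0 => /eqP.
have g1 : vgeb v 0 (F`_3 ^+ 2 * F`_0) by vtac.
have g2 : vgeb v 0 (F`_4 * F`_1 ^+ 2) by vtac.
have g3 : vgeb v 0 (F`_3 * F`_2 * F`_1) by vtac.
have g4 : vgeb v 0 (F`_3 * F`_2) by vtac.
have g5 : vgeb v 0 (F`_3 ^+ 2) by vtac.
have g6 : vgeb v 0 (F`_1 ^+ 2) by vtac.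
have h : vgeb v 0 (F`_3 ^+ 2 * F`_0 + F`_4 * F`_1 ^+ 2) by vtac.
have h' : vgeb v 0 (F`_3 ^+ 2 * F`_0 + F`_4 * F`_1 ^+ 2 - F`_3 * F`_2 * F`_1) by vtac.
move: kJ; rewrite -(rho_eq0 hrho h') (rhoD hrho) ?vgebN // (rhoN hrho) //.
rewrite (rhoD hrho) // !(rhoM hrho) // ?(rhoX hrho) // subr_eq0 => /eqP; exact.
Qed.
End RepeatedRoot.

(** * Soundness and existence of the procedure *)

Section ProcedureSound.
Variables (K : fieldType) (v : dvaluation K) (pi : K).
Implicit Types (PQ A B : model K) (M N U V : 'M[K]_2).
Hypotheses (npi : pi != 0) (dvpi : dv v pi = 1) (h2 : vgeb v 1 2%:R).
Hypothesis perfect : residue_perfect v.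
Let hpi := vgeb_pi dvpi.

(** The substitution turns $z_0x-x_0z$ into $\det(M)\,x$. Hence mod $\pi$ the new $l$ is
    $g\det(M)^2$ in the first case and the new $b$ is $g\det(M)^3$ in the second, both units, while
    the value of $Q_1$ at the root gives $n$, $d$ or $\pi^{-1}e$. *)
Lemma double_at_move PQ M (A := transform M 1 0 0 0 PQ) : integralb v PQ -> GL2O v M ->
  double_at v pi PQ (M 1 0) (M 1 1) ->
  [\/ ~~ vgeb v 1 (cl A) /\ vgeb v 1 (cn A),
      [/\ Pge v 1 A, ~~ vgeb v 1 (cb A) & vgeb v 1 (cd A)]
    | [/\ Pge v 1 A, Qge v 1 A & vgeb v 2 (ce A)]].
Proof.
move=> /andP[/and3P[hl hm hn] /and5P[ha hb hc hd he]].
move=> /GL2OP[h00 h01 h10 h11 dM] hD.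
have P1 : Pge v 1 PQ -> Pge v 1 A.
  by move=> /and3P[kl km kn]; apply/and3P; rewrite /A !transformE; split; vtac.
have det_unit g : vgeb v 1 (g * (\det M) ^+ 2) -> vgeb v 1 g.
  by rewrite expr2 mulrA => /(vgeb_mulr_unit (vunit_ge1 dM))/(vgeb_mulr_unit (vunit_ge1 dM)).
have hdet := vunit_ge0 dM; have ndet := vunit_ge1 dM.
rewrite det_mx2 in det_unit hdet ndet.
case: hD => [[nP [g hg [kl km kn]]]|[hP nb [g hg [kb kd]]]|
    [hP hQ _ [g0 [g1 [g2 [[hg0 hg1 hg2] [ka kb kc kd ke]]]]]]].
- constructor 1; rewrite /A !transformE.
  move: (M 0 0) (M 0 1) (M 1 0) (M 1 1) h00 h01 h10 h11 kl kn det_unit hdet.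
  move=> p q s t hp hq hs ht kl kn det_unit hdet; split.
    apply: contra nP; rewrite mul1r; set X := _ + _ => kX.
    have kg : vgeb v 1 g.
      apply: det_unit; vring_unfold X (X - cm PQ * p * q - (cl PQ - g * t ^+ 2) * p ^+ 2
        - (cn PQ - g * s ^+ 2) * q ^+ 2 - 2%:R * 0 - 2%:R * (g * p * t * q * s)).
    apply/and3P; split=> //; first by vring (cl PQ - g * t ^+ 2 + g * t ^+ 2).
    vring (cn PQ - g * s ^+ 2 + g * s ^+ 2).
  vring ((cl PQ - g * t ^+ 2) * s ^+ 2 + cm PQ * s * t + (cn PQ - g * s ^+ 2) * t ^+ 2
    + 2%:R * (g * s ^+ 2 * t ^+ 2)).
- constructor 2; have /and3P[kl km kn] := hP; split; first exact: P1.
    move: nb; apply: contra; rewrite /A !transformE.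
    move: (M 0 0) (M 0 1) (M 1 0) (M 1 1) h00 h01 h10 h11 kb kd det_unit hdet ndet.
    move=> p q s t hp hq hs ht kb kd det_unit hdet ndet; rewrite expr1n mul1r.
    set X := _ - _ => kX; have kg : vgeb v 1 g.
      apply: det_unit; apply: (vgeb_mulr_unit ndet).
      vring_unfold X (X - 4%:R * ca PQ * p ^+ 3 * s - 4%:R * ce PQ * q ^+ 3 * t
          - 2%:R * cc PQ * (p * s * q ^+ 2 + p ^+ 2 * q * t)
          - 2%:R * cb PQ * p ^+ 2 * s * q * 2%:R - 2%:R * cd PQ * q ^+ 2 * (p * t + q * s)
          - (p * t - q * s) * ((cb PQ - g * t ^+ 2) * p ^+ 2
             + (cd PQ - g * s ^+ 2) * q ^+ 2 + 2%:R * (g * p * t * q * s))).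
    apply/andP; split; first by vring (cb PQ - g * t ^+ 2 + g * t ^+ 2).
    vring (cd PQ - g * s ^+ 2 + g * s ^+ 2).
  rewrite /A !transformE.
  move: (M 0 0) (M 0 1) (M 1 0) (M 1 1) h00 h01 h10 h11 kb kd hdet.
  move=> p q s t hp hq hs ht kb kd hdet.
  vring ((p * t - q * s) * ((cb PQ - g * t ^+ 2) * s ^+ 2 + (cd PQ - g * s ^+ 2) * t ^+ 2
     + 2%:R * (g * s ^+ 2 * t ^+ 2)) + 2%:R * (s * q + p * t) * s ^+ 2 * cb PQ
     + 4%:R * s * q * t ^+ 2 * cd PQ + 4%:R * ca PQ * p * s ^+ 3
     + 2%:R * cc PQ * (p * s * t ^+ 2 + s ^+ 2 * q * t) + 4%:R * ce PQ * q * t ^+ 3).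
constructor 3; split; first exact: P1.
  have /and3P[kl km kn] := hP; have /and5P[qa qb qc qd qe] := hQ.
  by apply/and5P; rewrite /A !transformE; split; vtac.
rewrite /A !transformE.
move: (M 0 0) (M 0 1) (M 1 0) (M 1 1) h00 h01 h10 h11 ka kb kc kd ke.
move=> p q s t hp hq hs ht.
set da := ca PQ - _; set db := cb PQ - _; set dc := cc PQ - _; set dd := cd PQ - _.
set de := ce PQ - _ => ka kb kc kd ke.
set X := _ * _; have -> : X = da * s ^+ 4 + db * s ^+ 3 * t + dc * s ^+ 2 * t ^+ 2
  + dd * s * t ^+ 3 + de * t ^+ 4.
  by rewrite /X /da /db /dc /dd /de; ring.
vtac.
Qed.

(** Each of the three shapes survives a y-substitution with $\pi\mid e$ afterwards. In the first
    two, positive level supplies the missing divisibility of $d$ or $e$; in the third, $\pi\mid e$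
    forces $\pi\mid r_2$, and then $\pi^2\mid e$ is kept. *)
Lemma rescale_integral PQ A : integralb v PQ -> yequiv v PQ A ->
  nonminimal_weier v (jacobian A) -> vgeb v 1 (ce A) ->
  [\/ ~~ vgeb v 1 (cl PQ) /\ vgeb v 1 (cn PQ),
      [/\ Pge v 1 PQ, ~~ vgeb v 1 (cb PQ) & vgeb v 1 (cd PQ)]
    | [/\ Pge v 1 PQ, Qge v 1 PQ & vgeb v 2 (ce PQ)]] ->
  integralb v (rescale pi A).
Proof.
move=> iPQ yA nm ke cases; have iA := oequiv_integral h2 iPQ (yequiv_oequiv yA).
suff [kn kd ke2] : [/\ vgeb v 1 (cn A), vgeb v 1 (cd A) & vgeb v 2 (ce A)].
  have [/and3P[hl hm hn] /and5P[ha hb hc hd he]] := andP iA.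
  have jn := vgeb_pidiv npi dvpi (j := 1) (k := 0) kn.
  have jd := vgeb_pidiv npi dvpi (j := 1) (k := 0) kd.
  have je := vgeb_pidiv npi dvpi (j := 2) (k := 0) ke2.
  rewrite expr1 in jn jd.
  by apply/andP; split; [apply/and3P|apply/and5P]; rewrite !rescale_coefE //; split; vtac.
have [r0 [r1 [r2 [hr0 hr1 hr2 eA]]]] := (yequivE _ _ _).1 yA.
have [/and3P[hl hm hn] /and5P[ha hb hc hd he]] := andP iPQ.
case: cases => [[ul kn]|[hP ub kd]|[hP hQ k2]].
- have kn' : vgeb v 1 (cn A) by rewrite eA ysubE; vtac.
  have ul' : ~~ vgeb v 1 (cl A).
    apply: contra ul; rewrite eA ysubE; set X := _ + _ => h.
    vring_unfold X (X - 2%:R * r0).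
  by have [] := positive_level_case1 h2 iA nm ul' kn' ke.
- have [kl km kn] := and3P hP.
  have hP' : Pge v 1 A by rewrite eA; apply/and3P; rewrite !ysubE; split; vtac.
  have kd' : vgeb v 1 (cd A) by rewrite eA ysubE; vtac.
  have ub' : ~~ vgeb v 1 (cb A).
    apply: contra ub; rewrite eA ysubE; set X := _ - _ => h.
    vring_unfold X (X + r0 * cm PQ + r1 * cl PQ + 2%:R * r0 * r1).
  split=> //; first by have /and3P[] := hP'.
  exact: (positive_level_case2 h2 iA nm hP' ub' kd' ke).
have [kl km kn] := and3P hP; have [qa qb qc qd _] := and5P hQ.
have kr2 : vgeb v 1 r2.
  move: ke; rewrite eA ysubE; set X := _ - _ => ke; apply: (vgeb_sqr_odd (k := 0)).
  vring_unfold X (ce PQ - r2 * cn PQ - X).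
by rewrite eA !ysubE; split; vtac.
Qed.

Lemma procedure_step_sound PQ R : wf_model PQ -> integralb v PQ -> nonsingular PQ ->
  vPQ_eq v PQ 0 \/ vPQ_eq v PQ 1 -> nonminimal_weier v (jacobian PQ) ->
  procedure_step v pi PQ R ->
  [/\ integral v R, Kequiv PQ R & forall lev, level_is v PQ lev -> level_is v R lev].
Proof.
move=> wf iPQ nd vPQ nm /(procedure_stepE npi dvpi h2 perfect wf iPQ vPQ).
move=> [PQ1 [M [PQ3 [wf1 o1 gM [hD y3 e3 ->]]]]].
have i1 := oequiv_integral h2 iPQ o1.
have o12 := linear_oequiv PQ1 gM.
have i2 := oequiv_integral h2 i1 o12.
have o3 := oequiv_trans h2 (oequiv_trans h2 o1 o12) (yequiv_oequiv y3).
have [x ux jx] := oequiv_jacobian o3.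
have nm3 := nonminimal_weier_rel ux jx nm.
have npi' : pi^-1 != 0 by rewrite invr_eq0.
have nD : \det (mx2 pi 0 0 1) != 0 by rewrite det_mx2 !mx2E mul0r subr0 mulr1.
split.
- apply/(integralP v (wf_rescale npi PQ3)).
  exact: (rescale_integral i2 y3 nm3 e3 (double_at_move i1 gM hD)).
- have [N [mu [r0 [r1 [r2 [gN umu _ e]]]]]] := o3.
  rewrite rescaleE // e transform_comp ?(vunit_neq0 umu) //.
  do 5!eexists; split; last split; last reflexivity.
    by rewrite det_mulmx mulf_neq0 //; case: gN => _ [].
  by rewrite mulf_neq0 // (vunit_neq0 umu).
move=> lev; apply: (level_is_rel (x := x)) => //; rewrite rescaleE //.
(* The rescaling contributes the factor $\pi^{-1}\cdot\pi=1$, so the total factor is the unit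
   [x]. *)
have := jacobian_rel_comp jx (jacobian_rel_transform 0 0 0 PQ3 nD npi').
by rewrite det_mx2 !mx2E mul0r subr0 mulr1 mulVf // mul1r.
Qed.

Lemma procedure_step_exists PQ : wf_model PQ -> integralb v PQ ->
  vPQ_eq v PQ 0 \/ vPQ_eq v PQ 1 -> nonminimal_weier v (jacobian PQ) ->
  exists R, procedure_step v pi PQ R.
Proof.
move=> wf iPQ vPQ nm.
have [PQ1 [wf1 o1 hPQ1 [dg [F hF]]]] : exists PQ1, [/\ wf_model PQ1, oequiv v PQ PQ1,
    (vPQ_eq v PQ 1 -> yequiv v PQ PQ1 /\ form_vge v PQ1.2 1) /\
    (vPQ_eq v PQ 0 -> PQ1 = PQ) & exists dg F, isQ1 v pi PQ1 dg F].
  case: vPQ => [v0|[[PQ1 [y1 [hP hQ]]] n2]].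
    exists PQ; split=> //; first exact: oequiv_refl.
      by split=> // -[h1 _]; case: v0 => _ [].
    case: (boolP (Pge v 1 PQ)) => [/(PgeP v 1 wf) hP|nP].
      by exists 2, (dxdz PQ.2); right; left.
    by exists 2, PQ.1; left; split=> // /(PgeP v 1 wf) hP; rewrite hP in nP.
  have o1 := yequiv_oequiv y1; exists PQ1; split=> //; first exact: oequiv_wf o1.
    split=> // -[_ []]; exists PQ1; by split.
  exists 4, (pi^-1 *: PQ1.2); right; right; do !split=> //.
    by move=> i; apply/(vge2_1 v)/hP.
  move=> hQ2; apply: n2; exists PQ1; split=> //; split=> // i.
  by apply: vge2_2; apply/(vge2_1 v)/hP.
have i1 := oequiv_integral h2 iPQ o1.
have [x ux jx] := oequiv_jacobian o1.
have nm1 := nonminimal_weier_rel ux jx nm.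
have sF := isQ1_shape h2 npi dvpi perfect wf1 i1 nm1 hF.
have [x0 [z0 [hD hxz]]] := Q1_shape_root h2 perfect sF.
have [hx _] := hD.
(* One coordinate of the root is 1, so it is the second row of a matrix of determinant 1 or $-1$. *)
have [M [gM [ex ez]]] : exists M : 'M[K]_2, GL2O v M /\ M 1 0 = x0 /\ M 1 1 = z0.
  case: hxz => [->|[-> ->]].
    exists (mx2 1 0 x0 1); rewrite !mx2E; split=> //; apply/GL2OP.
    rewrite det_mx2 !mx2E mul0r subr0 mulr1 vgeb0 (vgeb1 v) (vunit1 v).
    by split=> //; apply/vgeP.
  exists (mx2 0 1 1 0); rewrite !mx2E; split=> //; exact: GL2O_swap.
have i2 := oequiv_integral h2 i1 (linear_oequiv PQ1 gM).
have hDM : double_at v pi PQ1 (M 1 0) (M 1 1).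
  by rewrite ex ez; exact: (isQ1_double_at npi dvpi h2 perfect wf1 i1 hF hD).
have kn : vgeb v 1 (cn (transform M 1 0 0 0 PQ1)).
  by case: (double_at_move i1 gM hDM) => [[]|[/and3P[]]|[/and3P[]]].
have [_ /and5P[_ _ _ _ he]] := andP i2.
(* As $\pi\mid n$ at this point, $y\leftarrow y+rz^2$ changes $e$ to $e-r^2$ mod $\pi$. *)
have [r hr kr] := sqrt_mod h2 perfect he.
set PQ2 := transform M 1 0 0 0 PQ1 in kn he kr *.
exists (rescale pi (transform 1%:M 1 0 0 r PQ2)), PQ1.
have [hp1 hp0] := hPQ1; split; [exact: hp1|split; [exact: hp0|]].
exists dg, F; split=> //; exists M; split=> //; split; first by rewrite ex ez.
exists (transform 1%:M 1 0 0 r PQ2); split.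
  by apply/yequivE; exists 0, 0, r; rewrite vgeb0.
split=> //; apply/vgeP; rewrite ysubE.
have {}kr : vgeb v 1 (ce PQ2 - r ^+ 2) := kr.
vring (ce PQ2 - r ^+ 2 - r * cn PQ2).
Qed.
End ProcedureSound.

Theorem theorem4p13 (K : fieldType) (v : dvaluation K) (pi : K)
  (P Q : {poly K}) :
  (* standing assumptions: pi is a uniformiser, the residue field k is perfect *)
  pi != 0 -> dv v pi = 1 -> residue_perfect v ->
  (* char(k) = 2 *)
  residue_char2 v ->
  (* (P,Q) in X_2(O_K), non-singular, v(P,Q) in {0,1}, positive level *)
  wf_model (P, Q) -> integral v (P, Q) -> nonsingular (P, Q) ->
  (vPQ_eq v (P, Q) 0 \/ vPQ_eq v (P, Q) 1) ->
  (exists lev : int, 0 < lev /\ level_is v (P, Q) lev) ->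
  (* (i) *)
  (forall (dg : nat) (F : {poly K}), isQ1 v pi (P, Q) dg F ->
     unique_rational_double_root v dg F) /\
  (* (ii) *)
  ((exists PQ' : model K, procedure_step v pi (P, Q) PQ') /\
   (forall PQ' : model K, procedure_step v pi (P, Q) PQ' ->
      integral v PQ' /\ Kequiv (P, Q) PQ' /\
      (forall lev : int, level_is v (P, Q) lev -> level_is v PQ' lev))) /\
  (* (iii) *)
  (nonminimal v (P, Q) ->
     forall PQ1 : model K, procedure_step v pi (P, Q) PQ1 ->
       vPQ_ge v PQ1 2 \/
       (forall PQ2 : model K, procedure_step v pi PQ1 PQ2 -> vPQ_ge v PQ2 2)).
Proof.
move=> npi dvpi perfect /vgeP h2 wf /(integralP v wf) iPQ nd vPQ [lev [hlev hl]].
have nm := level_nonminimal nd hlev hl.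
split; last split; [|split|].
- move=> dg F /(isQ1_shape h2 npi dvpi perfect wf iPQ nm) sF.
  exact: (Q1_shape_unique_root h2 perfect sF).
- exact: (procedure_step_exists npi dvpi h2 perfect wf iPQ vPQ nm).
- by move=> R /(procedure_step_sound npi dvpi h2 perfect wf iPQ nd vPQ nm)[].
- move=> nmin R; exact: (two_steps npi dvpi h2 perfect wf iPQ nd vPQ nmin).
Qed.
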